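(* Let $0<\rho\leq R$, let $\Omega\subset\mathbb{D}(0,R)$ be measurable, and let $F$ be polyanalytic of order $n$ in $\mathbb{D}(0,5R)$. If we write $M:=\sup_{\mathbb{D}(0,4R)}|F|$ and assume that $m:=|F(0)|>0$, then $$\sup_{\mathbb{D}(0,\rho)}|F|\leq\left(\frac{\kappa|\mathbb{D}(0,\rho)|}{|\Omega|}\right)^{c\left[\ln\frac{M}{m}+(n+2)^2\ln\left(4(n+2)\right)\right]}\sup_{\Omega}|F|,$$ where the constant $c$ can be chosen so that it only depends on the fraction $\rho/R$, and $\kappa=\kappa(2)\geq1$ is the constant in Brudnyi's theorem on plurisubharmonic functions for dimension $d=2$ (recalled in the context).
   Context: $\mathbb{D}(z,R)\subset\mathbb{C}$ is the disc of radius $R$ centered at $z$, and $|E|$ denotes the Lebesgue measure of $E$. A function $F$ is polyanalytic of order $n$ on a disc if it satisfies the higher order Cauchy-Riemann equation $(\bar\partial)^{n+1}F=0$ there; in that case $F(z)=\sum_{k=0}^nF_k(z)\overline{z}^k$ with $F_0,\dots,F_n$ holomorphic. Brudnyi's theorem, which provides $\kappa$: write $B_{\mathbb{C}}(x,t)$ for the ball of radius $t$ centered at $x$ in $\mathbb{C}^d$ and $B_{\mathbb{R}}(x,t)$ for its restriction to $\mathbb{R}^d$. Let $h:\mathbb{C}^d\to\mathbb{R}$ be plurisubharmonic and $r>1$, with $\sup_{B_{\mathbb{C}}(0,r)}h=0$ and $\sup_{B_{\mathbb{C}}(0,1)}h\geq-1$, and let $a>1$ be such that $B_{\mathbb{R}}(x,t)\subset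 B_{\mathbb{C}}(x,at)\subset B_{\mathbb{C}}(0,1)$. Then there exist constants $c'=c'(a,r)>0$ and $\kappa=\kappa(d)\geq1$ such that $\sup_{B_{\mathbb{R}}(x,t)}h\leq c'\ln\left(\frac{\kappa|B_{\mathbb{R}}(x,t)|}{|E|}\right)+\sup_{E}h$ for every measurable set $E\subset B_{\mathbb{R}}(x,t)$ of positive measure.
   Formalization: Ω is additionally assumed to satisfy 0 < |Ω| ≤ |D(0,ρ)|; with only Ω ⊂ D(0,R) the inequality fails for every c when κρ² < R² (take F = 1 with Ω = D(0,R), then F = 1 + z/(2R) with Ω a tiny disc near −R). *)

(* Defs.v *)
From HB Require Import structures.
From mathcomp Require Import all_boot all_order all_algebra.
From mathcomp Require Import complex.
From mathcomp Require Import all_classical all_reals all_analysis.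
From mathcomp Require Import measurable_realfun.

Set Implicit Arguments.
Unset Strict Implicit.
Unset Printing Implicit Defensive.

Import Order.TTheory GRing.Theory Num.Theory.
Import numFieldNormedType.Exports.

Local Open Scope classical_set_scope.
Local Open Scope complex_scope.
Local Open Scope ring_scope.

Notation normc := ComplexField.Normc.normc.

Section Plane.
Context {R : realType}.

Definition disc (z : R[i]) (r : R) : set R[i] := [set w | normc (w - z) < r].

(** Lebesgue measure on the plane: [area2] is the outer measure induced by the
    Borel product measure, so that it has the right value on every Lebesgue
    measurable set, and the Lebesgue measurable sets are the members of the
    completion of the Borel sigma-algebra. *)
Definition borel2 : set (R * R) -> \bar R :=
  (@lebesgue_measure R \x @lebesgue_measure R)%E.

Definition area2 (E : set (R * R)) : \bar R := mu_ext borel2 E.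

Definition lebesgue_measurable2 (E : set (R * R)) : Prop :=
  completed_algebra_gen borel2 E.

Definition coords (E : set R[i]) : set (R * R) :=
  [set p | E (p.1 +i* p.2)].

Definition area (E : set R[i]) : \bar R := area2 (coords E).

Definition lebesgue_measurable (E : set R[i]) : Prop :=
  lebesgue_measurable2 (coords E).

Definition sup_mod (F : R[i] -> R[i]) (E : set R[i]) : R :=
  sup [set normc (F z) | z in E].

End Plane.

Section Polyanalytic.
Context {R : realType}.

Definition re_part (F : R[i] -> R[i]) (p : R * R) : R :=
  complex.Re (F (p.1 +i* p.2)).
Definition im_part (F : R[i] -> R[i]) (p : R * R) : R :=
  complex.Im (F (p.1 +i* p.2)).

Definition real_differentiable (F : R[i] -> R[i]) (z : R[i]) : Prop :=
  differentiable (re_part F) (complex.Re z, complex.Im z) /\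
  differentiable (im_part F) (complex.Re z, complex.Im z).

(** For [F = u + i v], [dbar F] is
    [(d/dx + i d/dy) F / 2 = ((u_x - v_y) + i (v_x + u_y)) / 2]. *)
Definition dbar (F : R[i] -> R[i]) (z : R[i]) : R[i] :=
  let p := (complex.Re z, complex.Im z) : R * R in
  let ex := (1, 0) : R * R in
  let ey := (0, 1) : R * R in
  (('D_ex (re_part F) p - 'D_ey (im_part F) p) / 2) +i*
  (('D_ex (im_part F) p + 'D_ey (re_part F) p) / 2).

(** The derivatives ['D_v] are total, so the existence of the iterates of [dbar]
    is a separate requirement.  On an open set, the solutions of the equation
    that are of class C^(n+1) satisfy it, and conversely everything satisfying it
    is smooth. *)
Definition polyanalytic (n : nat) (F : R[i] -> R[i]) (U : set R[i]) : Prop :=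
  (forall k, (k <= n)%N ->
     forall z, U z -> real_differentiable (iter k dbar F) z) /\
  (forall z, U z -> iter n.+1 dbar F z = 0).

End Polyanalytic.

Section Brudnyi.
Context {R : realType}.

Notation C2 := (R[i] * R[i])%type.

Definition norm2 (z : C2) : R := Num.sqrt (normc z.1 ^+ 2 + normc z.2 ^+ 2).

Definition ball_C (x : C2) (t : R) : set C2 :=
  [set z | norm2 (z.1 - x.1, z.2 - x.2) < t].

Definition of_real (x : R * R) : C2 := (x.1%:C, x.2%:C).

Definition ball_R (x : R * R) (t : R) : set (R * R) :=
  of_real @^-1` ball_C (of_real x) t.

Definition upper_semicontinuous_C (u : R[i] -> R) : Prop :=
  forall z a, u z < a ->
    exists2 e, 0 < e & forall w, normc (w - z) < e -> u w < a.

Definition upper_semicontinuous_C2 (h : C2 -> R) : Prop :=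
  forall z a, h z < a -> exists2 e, 0 < e & forall w, ball_C z e w -> h w < a.

(** Local sub-mean value property; it is equivalent to the one for circles of
    arbitrary radius.  An upper semicontinuous function is bounded above on
    circles, so the integral is well defined in [[-oo, +oo)]. *)
Definition subharmonic (u : R[i] -> R) : Prop :=
  upper_semicontinuous_C u /\
  forall z, exists2 e, 0 < e & forall r, 0 < r -> r < e ->
    ((2 * pi * u z)%:E <= \int[@lebesgue_measure R]_(t in `[0%R, (2 * pi)%R])
       (u (z + r%:C * (cos t +i* sin t)))%:E)%E.

Definition plurisubharmonic (h : C2 -> R) : Prop :=
  upper_semicontinuous_C2 h /\
  forall a b : C2,
    subharmonic (fun z : R[i] => h (a.1 + z * b.1, a.2 + z * b.2)).

(** [kappa] is an admissible constant in Brudnyi's theorem for dimension 2.  All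
    the suprema are those of nonempty sets bounded above, by upper
    semicontinuity. *)
Definition brudnyi_constant (kappa : R) : Prop :=
  1 <= kappa /\
  forall a r : R, 1 < a -> 1 < r ->
  exists2 c' : R, 0 < c' &
  forall h : C2 -> R, plurisubharmonic h ->
    sup [set h z | z in ball_C 0 r] = 0 ->
    -1 <= sup [set h z | z in ball_C 0 1] ->
  forall (x : R * R) (t : R), ball_C (of_real x) (a * t) `<=` ball_C 0 1 ->
  forall E : set (R * R), lebesgue_measurable2 E -> E `<=` ball_R x t ->
    (0 < area2 E)%E ->
    sup [set h (of_real y) | y in ball_R x t] <=
      c' * ln (kappa * fine (area2 (ball_R x t)) / fine (area2 E)) +
      sup [set h (of_real y) | y in E].

End Brudnyi.

(* Main.v *)
(* The function F is a sum of G_k(z) conj(z)^k with G_k holomorphic (Goursat's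
   argument is needed, since the dbar derivatives are not assumed continuous), so
   after scaling to radius 1 it is a uniform limit on |z| <= 4 of polynomials
   Q(z, conj z).  On the circle |z| = t one has conj z = t^2/z; the Fourier
   coefficients of Q there are, up to a power of t, polynomials of degree n in
   t^2, and interpolation at n+1 radii in [3, 4[ bounds the coefficients of Q,
   hence |Q(u, v)| for |u|, |v| <= 27/10, by (C(n+1))^(n+1) sup |F|.  Brudnyi's
   inequality is applied to the plurisubharmonic function
   ln |Q(s(z_1 + i z_2), s(z_1 - i z_2))| with s = 3/2, divided by the logarithm
   of that bound over |F(0)|.  This gives the estimate on the disc of radius r,
   with the ratio r^2/|Omega|; as an admissible kappa is always larger than 1,
   the factor (r/rho)^2 is a power of kappa |D_rho|/|Omega| whose exponent
   depends on rho/r only. *)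
Require Import Defs.
From mathcomp Require Import all_boot all_order all_algebra.
From mathcomp Require Import complex.
From mathcomp Require Import all_classical all_reals all_analysis.
From mathcomp Require Import measurable_realfun.
From mathcomp Require Import ring lra.

Import Order.TTheory GRing.Theory Num.Theory.

Local Open Scope classical_set_scope.
Local Open Scope complex_scope.
Local Open Scope ring_scope.

Set Implicit Arguments.
Unset Strict Implicit.
Unset Printing Implicit Defensive.

Import numFieldNormedType.Exports.

(** For a polyanalytic [F] the function ln |F| is in general not subharmonic. It is replaced by the
    complexification, where z and conj z become independent variables and the result is holomorphic
    in both. A bound on [F] controls it only on the totally real plane v = conj u, while Brudnyi's
    normalisation needs its size on a ball of C^2; the passage between the two produces the term in
    n of the exponent. Polynomials are used because [brudnyi_constant] speaks of functions
    plurisubharmonic on all of C^2, while [F] is controlled only on a disc. The radii fit together: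
    Brudnyi's theorem is used with a = 5/4 and r = 6/5 on the real ball of radius t = 2/3, so that a
    t < 1 and s t = 1; on the ball of radius 6/5 the arguments of Q have modulus at most (3/2)(9/5)
    = 27/10, below the smallest interpolation radius 3, which leaves a geometric series of ratio
    9/10. Strictness of kappa > 1 matters when |Omega| = |D_rho|: the base of the power is then
    kappa itself, and with base 1 no exponent could absorb the factor (r/rho)^2. *)

Section Modulus.
Context {R : realType}.
Implicit Types (x y : R) (z w : R[i]).

Lemma normc_ge0 z : 0 <= normc z.
Proof. by case: z => a b; exact: sqrtr_ge0. Qed.

Lemma normc_eq0 z : (normc z == 0) = (z == 0).
Proof.
apply/eqP/eqP => [|->]; first exact: ComplexField.Normc.eq0_normc.
exact: ComplexField.Normc.normc0.
Qed.

Lemma normc_gt0 z : (0 < normc z) = (z != 0).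
Proof. by rewrite lt_def normc_ge0 andbT normc_eq0. Qed.

Lemma normc0 : normc (0 : R[i]) = 0.
Proof. exact: ComplexField.Normc.normc0. Qed.

Lemma normc1 : normc (1 : R[i]) = 1.
Proof. exact: ComplexField.Normc.normc1. Qed.

Lemma normcM z w : normc (z * w) = normc z * normc w.
Proof. exact: ComplexField.Normc.normcM. Qed.

Lemma normcV z : normc z^-1 = (normc z)^-1.
Proof. exact: ComplexField.Normc.normcV. Qed.

Lemma normcN z : normc (- z) = normc z.
Proof. by case: z => a b /=; rewrite !sqrrN. Qed.

Lemma normcX z n : normc (z ^+ n) = normc z ^+ n.
Proof. by elim: n => [|n IH]; rewrite ?expr0 ?normc1// !exprS normcM IH. Qed.

Lemma ler_normcD z w : normc (z + w) <= normc z + normc w.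
Proof. exact: (@complex.le_normcD R z w). Qed.

Lemma ler_normcB z w : normc (z - w) <= normc z + normc w.
Proof. by rewrite -(normcN w) ler_normcD. Qed.

Lemma normcB z w : normc (z - w) = normc (w - z).
Proof. by rewrite -normcN opprB. Qed.

Lemma ler_normc_sub z w : normc z - normc w <= normc (z - w).
Proof. by rewrite lerBlDr (le_trans _ (ler_normcD _ _))// subrK. Qed.

Lemma normc_le_add z w (e K : R) : normc (z - w) <= e -> normc w <= K -> normc z <= K + e.
Proof.
by move=> h1 h2; rewrite -[z](subrK w) addrC (le_trans (ler_normcD _ _))// lerD.
Qed.

Lemma normcR x : normc x%:C = `|x|.
Proof. by rewrite /= expr0n/= addr0 sqrtr_sqr. Qed.

Lemma normc_conj z : normc z^*%C = normc z.
Proof. by case: z => a b /=; rewrite sqrrN. Qed.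

Lemma ler_Re_normc z : `|complex.Re z| <= normc z.
Proof.
by case: z => a b /=; rewrite -sqrtr_sqr ler_wsqrtr// lerDl sqr_ge0.
Qed.

Lemma ler_Im_normc z : `|complex.Im z| <= normc z.
Proof.
by case: z => a b /=; rewrite -sqrtr_sqr ler_wsqrtr// lerDr sqr_ge0.
Qed.

Lemma complexRI z : z = (complex.Re z)%:C + 'i * (complex.Im z)%:C.
Proof.
by case: z => a b; rewrite /real_complex_def; simpc.
Qed.

Lemma normc_i : normc ('i : R[i]) = 1.
Proof. by rewrite /= expr0n/= add0r expr1n sqrtr1. Qed.

Lemma ler_normc_ReIm z : normc z <= `|complex.Re z| + `|complex.Im z|.
Proof.
by rewrite {1}[z]complexRI (le_trans (ler_normcD _ _))// normcM normc_i !normcR mul1r.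
Qed.

Lemma normc_sum (I : Type) (r : seq I) (P : pred I) (f : I -> R[i]) :
  normc (\sum_(i <- r | P i) f i) <= \sum_(i <- r | P i) normc (f i).
Proof.
elim/big_rec2: _ => [|i x y _ h]; first by rewrite normc0.
by rewrite (le_trans (ler_normcD _ _))// lerD2l.
Qed.

Lemma Re_add z w : complex.Re (z + w) = complex.Re z + complex.Re w.
Proof. by case: z w => a b [c d]. Qed.
Lemma Im_add z w : complex.Im (z + w) = complex.Im z + complex.Im w.
Proof. by case: z w => a b [c d]. Qed.
Lemma Re_opp z : complex.Re (- z) = - complex.Re z.
Proof. by case: z. Qed.
Lemma Im_opp z : complex.Im (- z) = - complex.Im z.
Proof. by case: z. Qed.
Lemma Re_mul z w : complex.Re (z * w) = complex.Re z * complex.Re w - complex.Im z * complex.Im w.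
Proof. by case: z w => a b [c d]. Qed.
Lemma Im_mul z w : complex.Im (z * w) = complex.Re z * complex.Im w + complex.Im z * complex.Re w.
Proof. by case: z w => a b [c d]. Qed.

Lemma complex_ext z w : complex.Re z = complex.Re w -> complex.Im z = complex.Im w -> z = w.
Proof. by case: z w => a b [c d] /= -> ->. Qed.

Lemma mulii : 'i * 'i = -1 :> R[i].
Proof. by apply: complex_ext; rewrite /=; ring. Qed.

End Modulus.

(** * Real differentiability in the plane *)

Section Near.
Context {R : realType}.

Definition near0 (P : R[i] -> Prop) :=
  exists2 d : R, 0 < d & forall h, normc h < d -> P h.

Lemma near0I P Q : near0 P -> near0 Q -> near0 (fun h => P h /\ Q h).
Proof.
move=> [d d0 hd] [e e0 he]; exists (Num.min d e); first by rewrite lt_min d0.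
by move=> h; rewrite lt_min => /andP[hd' he']; split; [exact: hd|exact: he].
Qed.

Lemma near0S P Q : near0 P -> (forall h, P h -> Q h) -> near0 Q.
Proof. by move=> [d d0 hd] PQ; exists d => // h /hd /PQ. Qed.

Lemma near0_lt (e : R) : 0 < e -> near0 (fun h => normc h < e).
Proof. by move=> e0; exists e. Qed.

Definition rlinear (X Y h : R[i]) := (complex.Re h)%:C * X + (complex.Im h)%:C * Y.

(* [X] and [Y] are the partial derivatives d/dx and d/dy, so that dbar F is
   [(X + 'i * Y) / 2]. *)
Definition rdiff (F : R[i] -> R[i]) z X Y := forall e : R, 0 < e ->
  near0 (fun h => normc (F (z + h) - F z - rlinear X Y h) <= e * normc h).

(** The relation [Y = 'i * X] is the Cauchy-Riemann system in complex form, so [l] is the complex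
    derivative. *)
Definition cdiff F z l := rdiff F z l ('i * l).

Lemma rlinear_cdiff l h : rlinear l ('i * l) h = l * h.
Proof. by rewrite /rlinear [in RHS](complexRI h); ring. Qed.

Lemma normc_rlinear X Y h : normc (rlinear X Y h) <= (normc X + normc Y) * normc h.
Proof.
rewrite /rlinear (le_trans (ler_normcD _ _))// !normcM !normcR mulrDl.
by rewrite [normc X * _]mulrC [normc Y * _]mulrC lerD// ler_wpM2r ?normc_ge0// ?ler_Re_normc ?ler_Im_normc.
Qed.

Lemma Re_sub_lin u v X Y h : complex.Re (u - v - rlinear X Y h) =
  complex.Re u - complex.Re v - (complex.Re h * complex.Re X + complex.Im h * complex.Re Y).
Proof. by rewrite /rlinear !(Re_add, Re_opp, Re_mul) /= !mul0r !subr0. Qed.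

Lemma Im_sub_lin u v X Y h : complex.Im (u - v - rlinear X Y h) =
  complex.Im u - complex.Im v - (complex.Re h * complex.Im X + complex.Im h * complex.Im Y).
Proof. by rewrite /rlinear !(Im_add, Im_opp, Im_mul) /= !mul0r !addr0. Qed.

Lemma rdiff_lip F z X Y : rdiff F z X Y ->
  near0 (fun h => normc (F (z + h) - F z) <= (normc X + normc Y + 1) * normc h).
Proof.
move=> /(_ 1 ltr01) h; apply: (near0S h) => {}h H.
rewrite -[F _ - _](subrK (rlinear X Y h)) (le_trans (ler_normcD _ _))//.
by have := normc_rlinear X Y h; lra.
Qed.

Lemma rdiff_cont F z X Y : rdiff F z X Y ->
  forall e : R, 0 < e -> near0 (fun h => normc (F (z + h) - F z) < e).
Proof.
move=> /rdiff_lip H e e0; set K := normc X + normc Y + 1 in H.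
have K0 : 0 < K by rewrite /K; have := normc_ge0 X; have := normc_ge0 Y; lra.
have := near0I H (near0_lt (divr_gt0 e0 K0)).
move=> h; apply: (near0S h) => {}h [h1 h2]; rewrite (le_lt_trans h1)//.
by rewrite mulrC -ltr_pdivlMr.
Qed.

Lemma eq_rdiff F G z X Y : near0 (fun h => F (z + h) = G (z + h)) ->
  rdiff F z X Y -> rdiff G z X Y.
Proof.
move=> FG dF e e0; have /= := near0I FG (dF e e0); have Fz : F z = G z.
  by have [d d0 /(_ 0)] := FG; rewrite normc0 addr0 => /(_ d0).
by move=> h; apply: (near0S h) => {}h []; rewrite Fz => ->.
Qed.

Lemma rdiff_cst c z : rdiff (fun=> c) z 0 0.
Proof.
move=> e e0; exists 1 => // h _; rewrite subrr /rlinear !mulr0 addr0 subr0 normc0.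
by rewrite mulr_ge0 ?normc_ge0// ltW.
Qed.

Lemma rdiff_rlinear a X Y z : rdiff (fun w => a + rlinear X Y w) z X Y.
Proof.
move=> e e0; exists 1 => // h _.
rewrite (_ : _ - _ = 0) ?normc0 ?mulr_ge0 ?normc_ge0// ?ltW//.
by rewrite /rlinear Re_add Im_add !rmorphD /=; ring.
Qed.

Lemma rdiffD F G z X Y X' Y' : rdiff F z X Y -> rdiff G z X' Y' ->
  rdiff (fun w => F w + G w) z (X + X') (Y + Y').
Proof.
move=> dF dG e e0; have e20 : 0 < e / 2 by rewrite divr_gt0.
have := near0I (dF _ e20) (dG _ e20); move=> h; apply: (near0S h) => {}h [h1 h2].
rewrite (_ : _ - _ = (F (z + h) - F z - rlinear X Y h) + (G (z + h) - G z - rlinear X' Y' h)); last first.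
  by rewrite /rlinear; ring.
by rewrite (le_trans (ler_normcD _ _))//; lra.
Qed.

Lemma rdiffM F G z X Y X' Y' : rdiff F z X Y -> rdiff G z X' Y' ->
  rdiff (fun w => F w * G w) z (X * G z + F z * X') (Y * G z + F z * Y').
Proof.
move=> dF dG e e0.
have [nF nG] := (normc_ge0 (F z), normc_ge0 (G z)).
set K := normc X + normc Y + 1; set K' := normc X' + normc Y' + 1.
have K0 : 0 < K by rewrite /K; have := normc_ge0 X; have := normc_ge0 Y; lra.
have K'0 : 0 < K' by rewrite /K'; have := normc_ge0 X'; have := normc_ge0 Y'; lra.
(* The error is [F z] times the remainder of [G], plus [G z] times the remainder of [F], plus the
   product of the two increments. [e1] settles the first two; the third is at most
   [K * K' * normc h ^+ 2], which smallness of [h] brings under [e / 3 * normc h]. *)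
set e1 := e / (3 * (normc (F z) + normc (G z) + 1)).
have e10 : 0 < e1 by rewrite divr_gt0// mulr_gt0//; lra.
have e1E : e1 * (normc (F z) + normc (G z) + 1) * 3 = e.
  by rewrite /e1; field; lra.
have e20 : 0 < e / (3 * (K * K')) by rewrite divr_gt0// !mulr_gt0.
have := near0I (near0I (dF _ e10) (dG _ e10))
  (near0I (near0I (rdiff_lip dF) (rdiff_lip dG)) (near0_lt e20)).
move=> h; apply: (near0S h) => {}h [[h1 h2] [[h3 h4] h5]].
rewrite (_ : _ - _ = F z * (G (z + h) - G z - rlinear X' Y' h)
  + G z * (F (z + h) - F z - rlinear X Y h) + (F (z + h) - F z) * (G (z + h) - G z)); last first.
  by rewrite /rlinear; ring.
have nh := normc_ge0 h.
rewrite (le_trans (ler_normcD _ _))// (le_trans (lerD (ler_normcD _ _) (lexx _)))// !normcM.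
have H1 := ler_wpM2l nF h2; have H2 := ler_wpM2l nG h1.
have H3 := ler_pM (normc_ge0 _) (normc_ge0 _) h3 h4.
have H4 : K * normc h * (K' * normc h) <= e / 3 * normc h.
  rewrite (_ : _ * _ = (K * K' * normc h) * normc h); last by ring.
  rewrite ler_wpM2r//.
  move: h5; rewrite ltr_pdivlMr ?mulr_gt0// => h5; rewrite ler_pdivlMr//.
  by rewrite (_ : _ * _ = normc h * (3 * (K * K'))) 1?ltW//; ring.
have H5 : 0 <= e1 * normc h by rewrite mulr_ge0// ltW.
have H6 : e1 * (normc (F z) + normc (G z) + 1) * normc h = e / 3 * normc h.
  by rewrite -e1E; field.
have H7 := mulr_ge0 (ltW e0) nh.
by move: H1 H2 H3 H4 H5 H6 H7; rewrite -/K -/K'; lra.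
Qed.

Lemma rdiff_comp F G z X Y l : rdiff F z X Y -> cdiff G (F z) l ->
  rdiff (fun w => G (F w)) z (l * X) (l * Y).
Proof.
move=> dF dG e e0.
set K := normc X + normc Y + 1.
have K0 : 0 < K by rewrite /K; have := normc_ge0 X; have := normc_ge0 Y; lra.
have nl := normc_ge0 l.
have e10 : 0 < e / (2 * K) by rewrite divr_gt0// mulr_gt0.
have e20 : 0 < e / (2 * (normc l + 1)) by rewrite divr_gt0// mulr_gt0//; lra.
have [d d0 hd] := dG _ e10.
have := near0I (near0I (rdiff_cont dF d0) (dF _ e20)) (rdiff_lip dF).
move=> h; apply: (near0S h) => {}h [[h1 h2] h3]; have := hd _ h1.
rewrite rlinear_cdiff addrCA subrr addr0 => h4.
set f := F (z + h) - F z in h1 h2 h3 h4 *.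
rewrite (_ : _ - _ = (G (F (z + h)) - G (F z) - l * f) + l * (f - rlinear X Y h)); last first.
  by rewrite /rlinear; ring.
rewrite (le_trans (ler_normcD _ _))// normcM.
have nh := normc_ge0 h.
have H1 : normc (G (F (z + h)) - G (F z) - l * f) <= e / 2 * normc h.
  rewrite (le_trans h4)// (le_trans (ler_wpM2l (ltW e10) h3))//.
  rewrite -/K (_ : e / (2 * K) * (K * normc h) = e / 2 * normc h)//.
  by field; rewrite gt_eqF.
have H2 : normc l * normc (f - rlinear X Y h) <= e / 2 * normc h.
  rewrite (le_trans (ler_wpM2l nl h2))// mulrA ler_wpM2r//.
  rewrite mulrA ler_pdivrMr; last by rewrite mulr_gt0//; lra.
  have -> : e / 2 * (2 * (normc l + 1)) = normc l * e + e by field.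
  by rewrite lerDl ltW.
by lra.
Qed.

Lemma cdiff_cst c z : cdiff (fun=> c) z 0.
Proof. by rewrite /cdiff mulr0; exact: rdiff_cst. Qed.

Lemma cdiff_id z : cdiff id z 1.
Proof.
have := @rdiff_rlinear 0 1 ('i * 1) z; apply: eq_rdiff.
by exists 1 => // h _; rewrite add0r rlinear_cdiff mul1r.
Qed.

Lemma cdiffD F G z l l' : cdiff F z l -> cdiff G z l' ->
  cdiff (fun w => F w + G w) z (l + l').
Proof. by rewrite /cdiff mulrDr; exact: rdiffD. Qed.

Lemma cdiffM F G z l l' : cdiff F z l -> cdiff G z l' ->
  cdiff (fun w => F w * G w) z (l * G z + F z * l').
Proof.
rewrite /cdiff (_ : 'i * (l * G z + F z * l') = 'i * l * G z + F z * ('i * l')); last by ring.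
exact: rdiffM.
Qed.

Lemma cdiff_comp F G z l l' : cdiff F z l -> cdiff G (F z) l' ->
  cdiff (fun w => G (F w)) z (l' * l).
Proof.
rewrite /cdiff => h /(rdiff_comp h); rewrite (_ : 'i * (l' * l) = l' * ('i * l))//; ring.
Qed.

Lemma cdiffX z n : cdiff (fun w => w ^+ n) z (n%:R * z ^+ n.-1).
Proof.
elim: n => [|n IH]; first by rewrite mul0r; exact: cdiff_cst.
have := cdiffM (cdiff_id z) IH; rewrite /= mul1r.
have -> : z ^+ n + z * (n%:R * z ^+ n.-1) = n.+1%:R * z ^+ n.
  by case: n {IH} => [|n]; rewrite ?mul0r ?mulr0 ?addr0 ?mul1r// exprS -[n.+2]addn1 natrD; ring.
by under eq_fun do rewrite -exprS.
Qed.

Lemma cdiffV z : z != 0 -> cdiff (fun w => w^-1) z (- z^-2).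
Proof.
move=> z0 e e0; have nz : 0 < normc z by rewrite normc_gt0.
have d10 : 0 < normc z / 2 by rewrite divr_gt0.
have d20 : 0 < e * normc z ^+ 3 / 2 by rewrite divr_gt0// mulr_gt0// exprn_gt0.
have := near0I (near0_lt d10) (near0_lt d20); move=> h; apply: (near0S h) => {}h [h1 h2].
have nzh : normc z / 2 <= normc (z + h).
  have := ler_normc_sub z (- h); rewrite opprK normcN; lra.
have zh : z + h != 0 by rewrite -normc_gt0; lra.
rewrite rlinear_cdiff.
rewrite (_ : _ - _ = h * (h / (z ^+ 2 * (z + h)))); last first.
  by field; rewrite z0 zh.
rewrite normcM mulrC ler_wpM2r ?normc_ge0// normcM normcV normcM normcX.
have z20 : 0 < normc z ^+ 2 by rewrite exprn_gt0.
rewrite ler_pdivrMr; last by rewrite mulr_gt0//; lra.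
have H := ler_wpM2l (ltW (mulr_gt0 e0 z20)) nzh.
rewrite mulrA (le_trans _ H)// (le_trans (ltW h2))//.
by rewrite (_ : e * normc z ^+ 3 / 2 = e * normc z ^+ 2 * (normc z / 2))//; ring.
Qed.

Lemma rdiff_conj z : rdiff (fun w => w^*%C) z 1 (- 'i).
Proof.
have := @rdiff_rlinear 0 1 (- 'i) z; apply: eq_rdiff.
exists 1 => // h _; rewrite add0r /rlinear; case: (z + h) => a b.
by apply: complex_ext; rewrite ?(Re_add, Im_add, Re_mul, Im_mul, Re_opp, Im_opp) /=; ring.
Qed.

Lemma cdiff_sum (I : Type) (r : seq I) (P : pred I) (f : I -> R[i] -> R[i]) z :
  (forall i, P i -> exists l, cdiff (f i) z l) ->
  exists l, cdiff (fun w => \sum_(i <- r | P i) f i w) z l.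
Proof.
move=> H; elim: r => [|i r [l IH]].
  by exists 0; under eq_fun do rewrite big_nil; exact: cdiff_cst.
case: (boolP (P i)) => Pi; last first.
  by exists l; apply: eq_rdiff IH; exists 1 => // h _; rewrite big_cons (negbTE Pi).
have [l' h] := H i Pi; exists (l' + l); apply: eq_rdiff (cdiffD h IH).
by exists 1 => // k _; rewrite big_cons Pi.
Qed.

End Near.

(** * Decomposition of polyanalytic functions *)

Section Polyanalytic.
Context {R : realType}.

(** The differential on [R * R] is controlled in the max norm, which is at most the modulus, so the
    remainder estimate passes to [near0] with the same [e]. *)
Lemma differentiable_expand (f : R * R -> R) (p : R * R) (e : R) :
  differentiable f p -> 0 < e ->
  near0 (fun h : R[i] => `|f (p.1 + complex.Re h, p.2 + complex.Im h) - f p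
    - (complex.Re h * 'D_((1, 0) : R * R) f p + complex.Im h * 'D_((0, 1) : R * R) f p)|
    <= e * normc h).
Proof.
move=> df e0.
have /eqaddoP /(_ e e0) := diff_locally df.
move=> /nbhs_normP [d /= d0 H]; exists d => // h hd.
have nh : `|(complex.Re h, complex.Im h)| <= normc h.
  by rewrite prod_normE /= ge_max ler_Re_normc ler_Im_normc.
have := H (complex.Re h, complex.Im h).
rewrite /= sub0r normrN => /(_ (le_lt_trans nh hd)).
rewrite !fctE /= => h1.
have E : 'd f p (complex.Re h, complex.Im h) =
    complex.Re h * 'D_((1, 0) : R * R) f p + complex.Im h * 'D_((0, 1) : R * R) f p.
  rewrite !deriveE// (_ : (complex.Re h, complex.Im h) =
     complex.Re h *: ((1, 0) : R * R) + complex.Im h *: ((0, 1) : R * R)); last first.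
    by congr pair; rewrite /= /GRing.scale /= ?mulr0 ?mulr1 ?addr0 ?add0r.
  by rewrite linearD !linearZ.
move: h1; rewrite E; have -> : (complex.Re h, complex.Im h) + p =
    (p.1 + complex.Re h, p.2 + complex.Im h) by case: p {df H E} => a b; rewrite addrC.
rewrite opprD addrA => h1; rewrite (le_trans h1)// ler_wpM2l// ltW//.
Qed.

Lemma dbar_formula (a b c d : R) :
  ((a - d) / 2) +i* ((b + c) / 2) = ((a +i* b) + 'i * (c +i* d)) / 2.
Proof.
have -> : (2 : R[i])^-1 = (2^-1)%:C by rewrite [RHS]fmorphV /= rmorph_nat.
by apply: complex_ext; rewrite /=; ring.
Qed.

Lemma real_differentiable_rdiff (F : R[i] -> R[i]) z : real_differentiable F z ->
  exists X Y, rdiff F z X Y /\ dbar F z = (X + 'i * Y) / 2.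
Proof.
move=> [dre dim]; set p := (complex.Re z, complex.Im z) in dre dim.
pose X : R[i] := 'D_((1, 0) : R * R) (re_part F) p +i* 'D_((1, 0) : R * R) (im_part F) p.
pose Y : R[i] := 'D_((0, 1) : R * R) (re_part F) p +i* 'D_((0, 1) : R * R) (im_part F) p.
exists X, Y; split.
  move=> e e0; have e20 : 0 < e / 2 by rewrite divr_gt0.
  have := near0I (differentiable_expand dre e20) (differentiable_expand dim e20).
  move=> h; apply: (near0S h) => {}h [h1 h2].
  rewrite (le_trans (ler_normc_ReIm _))// (_ : e * _ = e / 2 * normc h + e / 2 * normc h); last first.
    by field.
  rewrite lerD//.
    rewrite Re_sub_lin; move: h1; rewrite /re_part /=; case: (z) => a b; case: h {h2} => c d.
    exact.
  rewrite Im_sub_lin; move: h2; rewrite /im_part /=; case: (z) => a b; case: h {h1} => c d.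
  exact.
exact: dbar_formula.
Qed.

Lemma rdiff_conjX (z : R[i]) n : rdiff (fun w => (w^*%C) ^+ n) z
  (n%:R * (z^*%C) ^+ n.-1) (- 'i * (n%:R * (z^*%C) ^+ n.-1)).
Proof.
have := rdiff_comp (rdiff_conj z) (cdiffX (z^*%C) n).
by rewrite mulr1 [_ * - 'i]mulrC.
Qed.

(* [H k] plays the role of [dbar^k F]. *)
Definition dbar_chain (U : set R[i]) n (H : nat -> R[i] -> R[i]) :=
  (forall k, (k <= n)%N -> forall z, U z ->
     exists X Y, rdiff (H k) z X Y /\ H k.+1 z = (X + 'i * Y) / 2) /\
  (forall z, U z -> H n.+1 z = 0).

Lemma dbar0_cdiff (F : R[i] -> R[i]) z X Y : rdiff F z X Y ->
  (X + 'i * Y) / 2 = 0 -> cdiff F z X.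
Proof.
rewrite /cdiff => dF /eqP; rewrite mulf_eq0 invr_eq0 pnatr_eq0 orbF addr_eq0 => /eqP XE.
suff -> : 'i * X = Y by [].
by rewrite XE mulrN mulrA mulii mulN1r opprK.
Qed.

(** The last function T of the chain has vanishing dbar, hence is holomorphic. Subtracting T
    conj(z)^(n+1) / (n+1)! from [H 0], and its successive dbar derivatives from the functions that
    follow, cancels T itself and leaves a chain shorter by one. *)
Lemma dbar_chain_decomp (U : set R[i]) n H : dbar_chain U n H ->
  exists G : nat -> R[i] -> R[i],
    (forall k z, U z -> exists l, cdiff (G k) z l) /\
    forall z, U z -> H 0%N z = \sum_(k < n.+1) G k z * (z^*%C) ^+ k.
Proof.
elim: n H => [|n IH] H [dH H0].
  exists (fun=> H 0%N); split=> [k z Uz|z Uz]; last first.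
    by rewrite big_ord1 expr0 mulr1.
  have [X [Y [h1 h2]]] := dH 0%N isT z Uz; exists X; apply: dbar0_cdiff h1 _.
  by rewrite -h2 H0.
(* [g z k] is the k-th dbar derivative of [g z 0], since the holomorphic [H n.+1] behaves as a
   constant for dbar. *)
pose g z k := H n.+1 z * (z^*%C) ^+ (n.+1 - k) / ((n.+1 - k)`!)%:R.
have cH z : U z -> exists l, cdiff (H n.+1) z l.
  move=> Uz; have [X [Y [h1 h2]]] := dH n.+1 (leqnn _) z Uz.
  by exists X; apply: dbar0_cdiff h1 _; rewrite -h2 H0.
have [|G [cG GE]] := IH (fun k z => if (k <= n.+1)%N then H k z - g z k else 0).
  split=> [k kn z Uz|z Uz]; last first.
    by rewrite leqnn /g subnn expr0 fact0 mulr1 divr1 subrr.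
  have kn' := leqW kn; rewrite kn' ltnS kn.
  have [X [Y [h1 h2]]] := dH k kn' z Uz; have [l hl] := cH z Uz.
  have := rdiffM hl (rdiff_conjX z (n.+1 - k)).
  move=> /(fun h => rdiffM h (rdiff_cst (- ((n.+1 - k)`!)%:R^-1) z)).
  move=> /(rdiffD h1) h3; eexists; eexists; split.
    apply: eq_rdiff h3; exists 1 => // h _.
    by rewrite /g mulrN.
  rewrite h2 /g subSS (subSn kn) factS natrM /=; set f : R[i] := ((n - k)`!)%:R.
  have f0 : f != 0 by rewrite pnatr_eq0 -lt0n fact_gt0.
  have n0 : (n - k).+1%:R != 0 :> R[i] by rewrite pnatr_eq0.
  rewrite mulr0 addr0.
  (* [field] treats ['i] as an indeterminate, so the relation i^2 = -1 is isolated in the factors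
     [1 - 'i * 'i], equal to 2, and [1 + 'i * 'i], equal to 0; the vanishing factor multiplies the
     derivative [l] of [H n.+1]. *)
  transitivity ((X + 'i * Y) / 2 + (1 - 'i * 'i) / 2 * (- (H n.+1 z * z^*%C ^+ (n - k) / f)) + (1 + 'i * 'i) * (- (l * z^*%C ^+ (n - k).+1 / ((n - k).+1%:R * f)) / 2)).
    by rewrite mulii opprK addrN mul0r addr0 divff ?mul1r ?pnatr_eq0// [1 + 1]/(2).
  rewrite exprS; move: n0 f0 (z^*%C ^+ (n - k)); move: (_.+1%:R) f => N f N0 f0 w.
  by field; rewrite N0 f0.
exists (fun k => if (k <= n)%N then G k else fun z => H n.+1 z / (n.+1`!)%:R); split.
  move=> k z Uz; case: ifP => _; first exact: cG.
  have [l hl] := cH z Uz; exists (l * (n.+1`!)%:R^-1 + H n.+1 z * 0).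
  exact: cdiffM hl (cdiff_cst _ _).
move=> z Uz; have := GE z Uz; rewrite /= /g subn0 => /(canRL (subrK _)) ->.
rewrite [in RHS]big_ord_recr /= ltnn; congr (_ + _); last by ring.
by apply: eq_bigr => i _; rewrite -ltnS ltn_ord.
Qed.

Lemma polyanalytic_decomp n (F : R[i] -> R[i]) (U : set R[i]) :
  polyanalytic n F U ->
  exists G : nat -> R[i] -> R[i],
    (forall k z, U z -> exists l, cdiff (G k) z l) /\
    forall z, U z -> F z = \sum_(k < n.+1) G k z * (z^*%C) ^+ k.
Proof.
move=> [dF F0]; apply: (@dbar_chain_decomp U n (fun k => iter k dbar F)).
by split=> // k kn z Uz; exact: real_differentiable_rdiff (dF k kn z Uz).
Qed.

End Polyanalytic.

(** * Integrals over segments *)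

Section Integral.
Context {R : realType}.
Notation mu := (@lebesgue_measure R).
Implicit Types (f g : R -> R) (a b c : R).

Definition integrable_seg f a b := mu.-integrable `[a, b] (EFin \o f).
Definition integral_seg f a b : R := \int[mu]_(x in `[a, b]) f x.

Lemma continuous_integrable_seg f a b :
  (forall x, a <= x <= b -> {for x, continuous f}) -> integrable_seg f a b.
Proof.
move=> cf; apply: continuous_compact_integrable; first exact: segment_compact.
apply: continuous_in_subspaceT => x; rewrite inE /= in_itv /=; exact: cf.
Qed.

Lemma integrable_seg_sub f a b c d : a <= c -> d <= b -> integrable_seg f a b -> integrable_seg f c d.
Proof.
move=> ac db; apply: integrableS => //.
by apply: subset_itv; rewrite bnd_simp.
Qed.

Lemma integral_seg_split f a b c : a <= c -> c <= b -> integrable_seg f a b ->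
  integral_seg f a b = integral_seg f a c + integral_seg f c b.
Proof.
move=> ac cb fab.
have h := Rintegral_itvB (x := c) fab.
have {}h := h ac cb.
rewrite /integral_seg -[LHS](subrK (\int[mu]_(x in `[a, c]) f x)) h addrC.
congr (_ + _); rewrite Rintegral_itv_obnd_cbnd//.
apply: integrableS fab => //; apply: subset_itv; rewrite bnd_simp//.
Qed.

Lemma integral_seg_cst c a b : a <= b -> integral_seg (fun=> c) a b = c * (b - a).
Proof.
move=> ab; rewrite /integral_seg Rintegral_cst//= lebesgue_measure_itv /= lte_fin.
case: ltP => // ba; have -> : a = b by apply/le_anti; rewrite ab ba.
by rewrite subrr. Qed.

Lemma integrable_seg_cst c a b : integrable_seg (fun=> c) a b.
Proof. by apply: continuous_integrable_seg => x _; exact: cvg_cst. Qed.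

Lemma integrable_seg_id a b : integrable_seg id a b.
Proof. by apply: continuous_integrable_seg => x _; exact: cvg_id. Qed.

Lemma integral_seg_bound f a b K : a <= b -> integrable_seg f a b ->
  (forall x, a <= x <= b -> `|f x| <= K) -> `|integral_seg f a b| <= K * (b - a).
Proof.
move=> ab fab H; rewrite (le_trans (le_normr_Rintegral _ fab))//.
rewrite -(integral_seg_cst K ab) /integral_seg; apply: le_Rintegral => //=.
- exact: integrable_norm fab.
- exact: integrable_seg_cst.
Qed.

Lemma integral_seg_FTC f (F : R -> R) a b : a <= b ->
  (forall x, {for x, continuous f}) -> (forall x, is_derive x (1 : R) F (f x)) ->
  integral_seg f a b = F b - F a.
Proof.
rewrite le_eqVlt => /predU1P[->|ab] cf dF.
  by rewrite /integral_seg set_itv1 Rintegral_set1 subrr.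
have cF : continuous F.
  by move=> x; apply: differentiable_continuous; apply/derivable1_diffP; exact: ex_derive.
rewrite /integral_seg /Rintegral (continuous_FTC2 ab (F := F)) //.
- apply: continuous_in_subspaceT => x _; exact: cf.
- split; [move=> x _; exact: ex_derive | |].
    by apply: cvg_at_right_filter; exact: cF.
  by apply: cvg_at_left_filter; exact: cF.
- by move=> x _; rewrite derive1E; exact: derive_val.
Qed.

Lemma integral_seg_id a b : a <= b -> integral_seg id a b = (b ^+ 2 - a ^+ 2) / 2.
Proof.
move=> ab.
have dF x : is_derive x (1 : R) (fun x : R => x ^+ 2 / 2) x.
  have H := is_deriveM (is_deriveX 2 (is_derive_id x (1 : R))) (is_derive_cst (2^-1 : R) x (1 : R)).
  apply: (is_derive_eq H).
  by rewrite scaler0 add0r /GRing.scale /= expr1; field.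
by rewrite (integral_seg_FTC ab _ dF) ?mulrBl// => x; exact: cvg_id.
Qed.

End Integral.

(** * Complex-valued integrals over segments, by real and imaginary parts *)

Section ComplexIntegral.
Context {R : realType}.
Implicit Types (f g : R -> R[i]) (a b c : R).

Definition cintegrable f a b := integrable_seg (fun x => complex.Re (f x)) a b /\ integrable_seg (fun x => complex.Im (f x)) a b.
Definition cintegral f a b : R[i] :=
  integral_seg (fun x => complex.Re (f x)) a b +i* integral_seg (fun x => complex.Im (f x)) a b.

Definition ccont f x := forall e : R, 0 < e -> exists2 d : R, 0 < d &
  forall y, `|y - x| < d -> normc (f y - f x) < e.

Lemma integrable_segD (f g : R -> R) a b : integrable_seg f a b -> integrable_seg g a b -> integrable_seg (fun x => f x + g x) a b.
Proof.
move=> hf hg; have := integrableD _ hf hg; apply => //.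
Qed.

Lemma integrable_segZ (k : R) (f : R -> R) a b : integrable_seg f a b -> integrable_seg (fun x => k * f x) a b.
Proof.
move=> hf; have := integrableZl _ k hf; apply => //.
Qed.

Lemma integral_segD (f g : R -> R) a b : integrable_seg f a b -> integrable_seg g a b ->
  integral_seg (fun x => f x + g x) a b = integral_seg f a b + integral_seg g a b.
Proof. by move=> hf hg; rewrite /integral_seg RintegralD. Qed.

Lemma integral_segZ (k : R) (f : R -> R) a b : integrable_seg f a b ->
  integral_seg (fun x => k * f x) a b = k * integral_seg f a b.
Proof. by move=> hf; rewrite /integral_seg RintegralZl. Qed.

Lemma eq_integrable_seg (f g : R -> R) a b : f =1 g -> integrable_seg f a b -> integrable_seg g a b.
Proof. by move=> /funext ->. Qed.

Lemma eq_cintegrable f g a b : f =1 g -> cintegrable f a b -> cintegrable g a b.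
Proof. by move=> /funext ->. Qed.

Lemma eq_cintegral f g a b : f =1 g -> cintegral f a b = cintegral g a b.
Proof. by move=> /funext ->. Qed.

Lemma cintegrableD f g a b : cintegrable f a b -> cintegrable g a b -> cintegrable (fun x => f x + g x) a b.
Proof.
move=> [f1 f2] [g1 g2]; split.
  by apply: eq_integrable_seg (integrable_segD f1 g1) => x; rewrite Re_add.
by apply: eq_integrable_seg (integrable_segD f2 g2) => x; rewrite Im_add.
Qed.

Lemma cintegralD f g a b : cintegrable f a b -> cintegrable g a b ->
  cintegral (fun x => f x + g x) a b = cintegral f a b + cintegral g a b.
Proof.
move=> [f1 f2] [g1 g2]; rewrite /cintegral.
under [X in integral_seg X]eq_fun do rewrite Re_add.
under [X in _ +i* integral_seg X _ _]eq_fun do rewrite Im_add.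
by rewrite !integral_segD.
Qed.

Lemma cintegrableZ (k : R[i]) f a b : cintegrable f a b -> cintegrable (fun x => k * f x) a b.
Proof.
move=> [f1 f2]; split.
  apply: eq_integrable_seg (integrable_segD (integrable_segZ (complex.Re k) f1) (integrable_segZ (- complex.Im k) f2)) => x.
  by rewrite Re_mul mulNr.
apply: eq_integrable_seg (integrable_segD (integrable_segZ (complex.Re k) f2) (integrable_segZ (complex.Im k) f1)) => x.
by rewrite Im_mul.
Qed.

Lemma cintegralZ (k : R[i]) f a b : cintegrable f a b -> cintegral (fun x => k * f x) a b = k * cintegral f a b.
Proof.
move=> [f1 f2]; rewrite /cintegral.
under [X in integral_seg X]eq_fun do rewrite Re_mul -mulNr.
under [X in _ +i* integral_seg X _ _]eq_fun do rewrite Im_mul.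
rewrite !integral_segD ?integral_segZ//; try exact: integrable_segZ.
by apply: complex_ext; rewrite ?(Re_mul, Im_mul) /=; ring.
Qed.

Lemma cintegralB f g a b : cintegrable f a b -> cintegrable g a b ->
  cintegral (fun x => f x - g x) a b = cintegral f a b - cintegral g a b.
Proof.
move=> hf hg; have -> : (fun x => f x - g x) = (fun x => f x + -1 * g x).
  by apply/funext => x; rewrite mulN1r.
by rewrite cintegralD// ?cintegralZ// ?mulN1r//; exact: cintegrableZ.
Qed.

Lemma cintegrableB f g a b : cintegrable f a b -> cintegrable g a b -> cintegrable (fun x => f x - g x) a b.
Proof.
move=> hf hg; apply: eq_cintegrable (cintegrableD hf (cintegrableZ (-1) hg)) => x; by rewrite mulN1r.
Qed.

Lemma cintegrable_cst (c : R[i]) a b : cintegrable (fun=> c) a b.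
Proof. by split; exact: integrable_seg_cst. Qed.

Lemma cintegral_cst (c : R[i]) a b : a <= b -> cintegral (fun=> c) a b = (b - a)%:C * c.
Proof.
by move=> ab; rewrite /cintegral !integral_seg_cst//; apply: complex_ext; rewrite ?(Re_mul, Im_mul) /=; ring.
Qed.

Lemma cintegrable_id a b : cintegrable (fun x => x%:C) a b.
Proof. by split; [exact: integrable_seg_id|exact: integrable_seg_cst]. Qed.

Lemma cintegral_id a b : a <= b -> cintegral (fun x => x%:C) a b = ((b ^+ 2 - a ^+ 2) / 2)%:C.
Proof. by move=> ab; rewrite /cintegral -integral_seg_id// integral_seg_cst// mul0r. Qed.

Lemma cintegrable_sub f a b c d : a <= c -> d <= b -> cintegrable f a b -> cintegrable f c d.
Proof. by move=> ac db [h1 h2]; split; exact: integrable_seg_sub ac db _. Qed.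

Lemma cintegral_split f a b c : a <= c -> c <= b -> cintegrable f a b ->
  cintegral f a b = cintegral f a c + cintegral f c b.
Proof.
move=> ac cb [h1 h2]; rewrite /cintegral (integral_seg_split ac cb h1) (integral_seg_split ac cb h2).
by [].
Qed.

(** The factor 2 is the price of bounding the real and imaginary parts separately; it only affects
    numerical constants later on. *)
Lemma cintegral_bound f a b K : a <= b -> cintegrable f a b ->
  (forall x, a <= x <= b -> normc (f x) <= K) -> normc (cintegral f a b) <= 2 * K * (b - a).
Proof.
move=> ab [h1 h2] H; rewrite (le_trans (ler_normc_ReIm _))//.
rewrite -mulrA mulr_natl mulr2n lerD// integral_seg_bound// => x xab.
  by rewrite (le_trans (ler_Re_normc _))// H.
by rewrite (le_trans (ler_Im_normc _))// H.
Qed.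

Lemma cintegral_sum n (f : nat -> R -> R[i]) a b : (forall k, cintegrable (f k) a b) ->
  cintegrable (fun x => \sum_(k < n) f k x) a b /\
  cintegral (fun x => \sum_(k < n) f k x) a b = \sum_(k < n) cintegral (f k) a b.
Proof.
move=> H; elim: n => [|n [IH1 IH2]].
  have E : (fun x : R => \sum_(k < 0) f k x) = fun=> 0 by apply/funext => x; rewrite big_ord0.
  rewrite E big_ord0; split; first exact: cintegrable_cst.
  have -> : (fun=> 0) = (fun x : R => 0 * (0 : R[i])) by apply/funext => x; rewrite mulr0.
  by rewrite cintegralZ ?mul0r//; exact: cintegrable_cst.
have E : (fun x : R => \sum_(k < n.+1) f k x) = fun x => \sum_(k < n) f k x + f n x.
  by apply/funext => x; rewrite big_ord_recr.
by rewrite E big_ord_recr; split; [exact: cintegrableD|rewrite cintegralD// IH2].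
Qed.

Lemma ccont_Re f x : ccont f x -> {for x, continuous (fun y => complex.Re (f y))}.
Proof.
move=> cf; apply/cvgrPdist_lt => e e0; have [d d0 H] := cf e e0.
apply/nbhs_normP; exists d => //= y yd.
rewrite -Re_opp -Re_add (le_lt_trans (ler_Re_normc _))// normcB H//.
by move: yd; rewrite /ball_ /= distrC.
Qed.

Lemma ccont_Im f x : ccont f x -> {for x, continuous (fun y => complex.Im (f y))}.
Proof.
move=> cf; apply/cvgrPdist_lt => e e0; have [d d0 H] := cf e e0.
apply/nbhs_normP; exists d => //= y yd.
rewrite -Im_opp -Im_add (le_lt_trans (ler_Im_normc _))// normcB H//.
by move: yd; rewrite /ball_ /= distrC.
Qed.

Lemma ccont_cintegrable f a b : (forall x, a <= x <= b -> ccont f x) -> cintegrable f a b.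
Proof.
by move=> H; split; apply: continuous_integrable_seg => x /H; [exact: ccont_Re|exact: ccont_Im].
Qed.

Lemma rdiff_ccont F u v x X Y : rdiff F (u + x%:C * v) X Y ->
  ccont (fun x => F (u + x%:C * v)) x.
Proof.
move=> /rdiff_cont dF e /dF [d d0 H].
have K0 : 0 < normc v + 1 by rewrite ltr_wpDl ?normc_ge0.
exists (d / (normc v + 1)); first by rewrite divr_gt0.
move=> y yx; have := H ((y - x)%:C * v).
rewrite (_ : u + x%:C * v + (y - x)%:C * v = u + y%:C * v); last first.
  by rewrite rmorphB /=; ring.
apply; rewrite normcM normcR.
have h : `|y - x| * (normc v + 1) < d by rewrite -ltr_pdivlMr.
by rewrite (le_lt_trans _ h)// ler_wpM2l// lerDl.
Qed.

End ComplexIntegral.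

(** * Closed differential forms on rectangles *)

Section Goursat.
Context {R : realType}.
Implicit Types (x y : R).

Definition cpoint x y : R[i] := x%:C + 'i * y%:C.

Lemma Re_cpoint x y : complex.Re (cpoint x y) = x.
Proof. by rewrite /cpoint Re_add Re_mul /=; ring. Qed.

Lemma Im_cpoint x y : complex.Im (cpoint x y) = y.
Proof. by rewrite /cpoint Im_add Im_mul /=; ring. Qed.

Lemma nested_intervals (a b : nat -> R) :
  (forall n, a n <= a n.+1) -> (forall n, b n.+1 <= b n) -> (forall n, a n <= b n) ->
  exists x, forall n, a n <= x <= b n.
Proof.
move=> ha hb ab.
have mona m n : (m <= n)%N -> a m <= a n.
  by have /nondecreasing_seqP := ha; apply.
have monb m n : (m <= n)%N -> b n <= b m.
  by have /nonincreasing_seqP := hb; apply.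
have le_ab m n : a m <= b n.
  rewrite (le_trans (mona m (maxn m n) _)) ?leq_maxl//.
  by rewrite (le_trans (ab _))// monb ?leq_maxr.
have S0 : has_sup (range a).
  split; first by exists (a 0%N), 0%N.
  by exists (b 0%N) => _ [n _ <-].
exists (sup (range a)) => n; apply/andP; split.
  by apply: (sup_upper_bound S0); exists n.
by apply: ge_sup; [case: S0|move=> _ [m _ <-]].
Qed.

Lemma halving_lt (x d : R) : 0 < d -> exists n, x / 2 ^+ n < d.
Proof.
move=> d0; exists (Num.truncn (x / d)).+1.
rewrite ltr_pdivrMr ?exprn_gt0// mulrC -ltr_pdivrMr//.
rewrite (lt_le_trans (truncnS_gt _))// -natrX ler_nat ltnW// ltn_expl//.
Qed.

Definition half_itv (s : bool) (I : R * R) : R * R :=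
  let m := (I.1 + I.2) / 2 in if s then (m, I.2) else (I.1, m).

(** If [P] failed on [I], [J], it would fail on one of the four quarters, and so on forever; the
    quarters shrink to a point, where the local hypothesis gives a contradiction. *)
Lemma bisection (P : R * R -> R * R -> Prop) (I J : R * R) :
  I.1 <= I.2 -> J.1 <= J.2 ->
  (forall I' J', I'.1 <= I'.2 -> J'.1 <= J'.2 ->
    (forall s t, P (half_itv s I') (half_itv t J')) -> P I' J') ->
  (forall x y, I.1 <= x <= I.2 -> J.1 <= y <= J.2 -> exists2 d : R, 0 < d &
     forall I' J', I.1 <= I'.1 -> I'.2 <= I.2 -> J.1 <= J'.1 -> J'.2 <= J.2 ->
       I'.1 <= x <= I'.2 -> J'.1 <= y <= J'.2 ->
       I'.2 - I'.1 < d -> J'.2 - J'.1 < d -> P I' J') ->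
  P I J.
Proof.
move=> hI hJ step loc; apply: contrapT => nP.
pose good (Q : (R * R) * (R * R)) := Q.1.1 <= Q.1.2 /\ Q.2.1 <= Q.2.2 /\ ~ P Q.1 Q.2.
(* [choice] needs a successor for every [Q], hence the guard [good Q ->]. *)
have nxt Q : exists Q', good Q -> good Q' /\ exists s t, Q' = (half_itv s Q.1, half_itv t Q.2).
  have [gQ|] := pselect (good Q); last by exists Q.
  have [h1 [h2 h3]] := gQ.
  have [s [t st]] : exists s t, ~ P (half_itv s Q.1) (half_itv t Q.2).
    apply: contrapT => H; apply: h3; apply: step => // s t.
    by apply: contrapT => ?; apply: H; exists s, t.
  exists (half_itv s Q.1, half_itv t Q.2) => _; split; last by exists s, t.
  by split; [|split] => //=; rewrite /half_itv; [case: (s)|case: (t)] => /=; lra.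
have [f Hf] := choice nxt.
pose Q n := iter n f (I, J).
have gQ n : good (Q n) by elim: n => [|n IH] //=; have [] := Hf _ IH.
have hQ n : exists s t, Q n.+1 = (half_itv s (Q n).1, half_itv t (Q n).2).
  by have [] := Hf _ (gQ n).
have le1 n : (Q n).1.1 <= (Q n).1.2 by have [] := gQ n.
have le2 n : (Q n).2.1 <= (Q n).2.2 by have [_ []] := gQ n.
have m1 n : (Q n).1.1 <= (Q n.+1).1.1.
  have [s [t ->]] /= := hQ n; rewrite /half_itv; have := le1 n; case: s => /=; lra.
have m2 n : (Q n).2.1 <= (Q n.+1).2.1.
  have [s [t ->]] /= := hQ n; rewrite /half_itv; have := le2 n; case: t => /=; lra.
have m3 n : (Q n.+1).1.2 <= (Q n).1.2.
  have [s [t ->]] /= := hQ n; rewrite /half_itv; have := le1 n; case: s => /=; lra.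
have m4 n : (Q n.+1).2.2 <= (Q n).2.2.
  have [s [t ->]] /= := hQ n; rewrite /half_itv; have := le2 n; case: t => /=; lra.
have [x hx] := nested_intervals m1 m3 le1.
have [y hy] := nested_intervals m2 m4 le2.
have d1 n : (Q n).1.2 - (Q n).1.1 = (I.2 - I.1) / 2 ^+ n.
  elim: n => [|n IH]; first by rewrite expr0 divr1.
  have -> : (Q n.+1).1.2 - (Q n.+1).1.1 = ((Q n).1.2 - (Q n).1.1) / 2.
    by have [s [t ->]] /= := hQ n; rewrite /half_itv; case: s => /=; field.
  by rewrite IH exprS; field; rewrite expf_neq0.
have d2 n : (Q n).2.2 - (Q n).2.1 = (J.2 - J.1) / 2 ^+ n.
  elim: n => [|n IH]; first by rewrite expr0 divr1.
  have -> : (Q n.+1).2.2 - (Q n.+1).2.1 = ((Q n).2.2 - (Q n).2.1) / 2.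
    by have [s [t ->]] /= := hQ n; rewrite /half_itv; case: t => /=; field.
  by rewrite IH exprS; field; rewrite expf_neq0.
have [d d0 H] := loc x y (hx 0%N) (hy 0%N).
have [n hn] := halving_lt ((I.2 - I.1) + (J.2 - J.1)) d0.
have [_ [_ nPn]] := gQ n; apply: nPn.
have mono (u : nat -> R) k : (forall n, u n <= u n.+1) -> u 0%N <= u k.
  by move=> hu; elim: k => // k IH; exact: le_trans (hu k).
have p2 : 0 < (2 : R) ^+ n by rewrite exprn_gt0.
apply: H => //.
- exact: (mono (fun n => (Q n).1.1)).
- rewrite -lerN2; apply: (mono (fun n => - (Q n).1.2)) => k; by rewrite lerN2.
- exact: (mono (fun n => (Q n).2.1)).
- rewrite -lerN2; apply: (mono (fun n => - (Q n).2.2)) => k; by rewrite lerN2.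
- by rewrite d1; apply: le_lt_trans hn; rewrite ler_pM2r ?invr_gt0//; lra.
- by rewrite d2; apply: le_lt_trans hn; rewrite ler_pM2r ?invr_gt0//; lra.
Qed.

(** The integral of the form p dx + q dy along the boundary of the rectangle, counterclockwise. *)
Definition circulation (p q : R[i] -> R[i]) (I J : R * R) : R[i] :=
  cintegral (fun x => p (cpoint x J.1)) I.1 I.2 - cintegral (fun x => p (cpoint x J.2)) I.1 I.2
  + (cintegral (fun y => q (cpoint I.2 y)) J.1 J.2 - cintegral (fun y => q (cpoint I.1 y)) J.1 J.2).

Definition inrect (I J : R * R) x y := I.1 <= x <= I.2 /\ J.1 <= y <= J.2.

(** The shared [Y] expresses dp/dy = dq/dx, that is, d(p dx + q dy) = 0 at each point. *)
Definition closed_form (p q : R[i] -> R[i]) I J := forall x y, inrect I J x y ->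
  exists X Y Z, rdiff p (cpoint x y) X Y /\ rdiff q (cpoint x y) Y Z.

Lemma rdiff_hor F x y X Y : rdiff F (cpoint x y) X Y -> ccont (fun x => F (cpoint x y)) x.
Proof.
have E z : cpoint z y = 'i * y%:C + z%:C * 1 by rewrite /cpoint; ring.
rewrite E => /rdiff_ccont h e /h [d d0 H]; exists d => // z zx.
by rewrite !E; exact: H.
Qed.

Lemma rdiff_ver F x y X Y : rdiff F (cpoint x y) X Y -> ccont (fun y => F (cpoint x y)) y.
Proof.
have E z : cpoint x z = x%:C + z%:C * 'i by rewrite /cpoint; ring.
rewrite E => /rdiff_ccont h e /h [d d0 H]; exists d => // z zx.
by rewrite !E; exact: H.
Qed.

Definition circulation_integrable (p q : R[i] -> R[i]) (I J : R * R) :=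
  (forall y, J.1 <= y <= J.2 -> cintegrable (fun x => p (cpoint x y)) I.1 I.2) /\
  (forall x, I.1 <= x <= I.2 -> cintegrable (fun y => q (cpoint x y)) J.1 J.2).

Lemma closed_form_integrable p q I J : closed_form p q I J -> circulation_integrable p q I J.
Proof.
move=> H; split=> [y hy|x hx]; apply: ccont_cintegrable => t ht.
  by have [|X [Y [Z [h _]]]] := H t y; [split|exact: rdiff_hor h].
by have [|X [Y [Z [_ h]]]] := H x t; [split|exact: rdiff_ver h].
Qed.

Lemma circulation_integrable_sub p q I J I' J' : I.1 <= I'.1 -> I'.2 <= I.2 ->
  J.1 <= J'.1 -> J'.2 <= J.2 -> circulation_integrable p q I J -> circulation_integrable p q I' J'.
Proof.
move=> h1 h2 h3 h4 [H1 H2]; split=> [y hy|x hx].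
  by apply: cintegrable_sub h1 h2 _; apply: H1; lra.
by apply: cintegrable_sub h3 h4 _; apply: H2; lra.
Qed.

Lemma circulation_split p q I J : I.1 <= I.2 -> J.1 <= J.2 -> circulation_integrable p q I J ->
  circulation p q I J = \sum_(s : bool) \sum_(t : bool) circulation p q (half_itv s I) (half_itv t J).
Proof.
case: I => a b; case: J => c d /= ab cd [H1 H2]; rewrite !big_bool /= /circulation /half_itv /=.
set m := (a + b) / 2; set n := (c + d) / 2.
have [am mb] : a <= m /\ m <= b by rewrite /m; lra.
have [cn nd] : c <= n /\ n <= d by rewrite /n; lra.
have xs y : c <= y <= d -> cintegral (fun x => p (cpoint x y)) a b = cintegral (fun x => p (cpoint x y)) a m + cintegral (fun x => p (cpoint x y)) m b.
  by move=> hy; apply: cintegral_split am mb _; exact: H1.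
have ys x : a <= x <= b -> cintegral (fun y => q (cpoint x y)) c d = cintegral (fun y => q (cpoint x y)) c n + cintegral (fun y => q (cpoint x y)) n d.
  by move=> hx; apply: cintegral_split cn nd _; exact: H2.
rewrite !xs ?lexx ?cd// !ys ?lexx ?ab//; ring.
Qed.

Lemma circulationD p q p' q' I J : I.1 <= I.2 -> J.1 <= J.2 ->
  circulation_integrable p q I J -> circulation_integrable p' q' I J ->
  circulation (fun z => p z + p' z) (fun z => q z + q' z) I J = circulation p q I J + circulation p' q' I J.
Proof.
move=> hI hJ [h1 h2] [h3 h4]; rewrite /circulation !cintegralD; first by ring.
all: try (by apply: h1; rewrite lexx hJ).
all: try (by apply: h2; rewrite lexx hI).
all: try (by apply: h3; rewrite lexx hJ).
all: try (by apply: h4; rewrite lexx hI).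
Qed.

Lemma circulation_bound p q I J K : I.1 <= I.2 -> J.1 <= J.2 -> circulation_integrable p q I J ->
  (forall x y, inrect I J x y -> normc (p (cpoint x y)) <= K /\ normc (q (cpoint x y)) <= K) ->
  normc (circulation p q I J) <= 4 * K * ((I.2 - I.1) + (J.2 - J.1)).
Proof.
move=> hI hJ [H1 H2] H.
have bx y : J.1 <= y <= J.2 -> normc (cintegral (fun x => p (cpoint x y)) I.1 I.2) <= 2 * K * (I.2 - I.1).
  move=> hy; apply: cintegral_bound hI _ _; first exact: H1.
  by move=> x hx; have [] := H x y (conj hx hy).
have by_ x : I.1 <= x <= I.2 -> normc (cintegral (fun y => q (cpoint x y)) J.1 J.2) <= 2 * K * (J.2 - J.1).
  move=> hx; apply: cintegral_bound hJ _ _; first exact: H2.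
  by move=> y hy; have [] := H x y (conj hx hy).
rewrite /circulation (le_trans (ler_normcD _ _))// (_ : 4 * K * _ =
  (2 * K * (I.2 - I.1) + 2 * K * (I.2 - I.1)) + (2 * K * (J.2 - J.1) + 2 * K * (J.2 - J.1))); last by ring.
have [J1 J2] : J.1 <= J.1 <= J.2 /\ J.1 <= J.2 <= J.2 by rewrite !lexx hJ.
have [I1 I2] : I.1 <= I.1 <= I.2 /\ I.1 <= I.2 <= I.2 by rewrite !lexx hI.
apply: lerD; apply: le_trans (ler_normcB _ _) _; apply: lerD.
- exact: bx.
- exact: bx.
- exact: by_.
- exact: by_.
Qed.

Lemma affine_hor a X Y y x0 x1 : x0 <= x1 ->
  cintegrable (fun x => a + rlinear X Y (cpoint x y)) x0 x1 /\
  cintegral (fun x => a + rlinear X Y (cpoint x y)) x0 x1 =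
    (x1 - x0)%:C * (a + y%:C * Y) + ((x1 ^+ 2 - x0 ^+ 2) / 2)%:C * X.
Proof.
move=> h; have -> : (fun x => a + rlinear X Y (cpoint x y)) = fun x => (a + y%:C * Y) + X * x%:C.
  by apply/funext => x; rewrite /rlinear Re_cpoint Im_cpoint; ring.
split; first by apply: cintegrableD; [exact: cintegrable_cst|apply: cintegrableZ; exact: cintegrable_id].
by rewrite cintegralD ?cintegralZ ?cintegral_id ?cintegral_cst//; [ring|exact: cintegrable_id|exact: cintegrable_cst|apply: cintegrableZ; exact: cintegrable_id].
Qed.

Lemma affine_ver a X Y x y0 y1 : y0 <= y1 ->
  cintegrable (fun y => a + rlinear X Y (cpoint x y)) y0 y1 /\
  cintegral (fun y => a + rlinear X Y (cpoint x y)) y0 y1 =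
    (y1 - y0)%:C * (a + x%:C * X) + ((y1 ^+ 2 - y0 ^+ 2) / 2)%:C * Y.
Proof.
move=> h; have -> : (fun y => a + rlinear X Y (cpoint x y)) = fun y => (a + x%:C * X) + Y * y%:C.
  by apply/funext => y; rewrite /rlinear Re_cpoint Im_cpoint; ring.
split; first by apply: cintegrableD; [exact: cintegrable_cst|apply: cintegrableZ; exact: cintegrable_id].
by rewrite cintegralD ?cintegralZ ?cintegral_id ?cintegral_cst//; [ring|exact: cintegrable_id|exact: cintegrable_cst|apply: cintegrableZ; exact: cintegrable_id].
Qed.

(** An affine closed form has a quadratic primitive. This is the part of a closed form that
    Goursat's argument subtracts near a point. *)
Lemma circulation_affine a b X Y Z I J : I.1 <= I.2 -> J.1 <= J.2 ->
  circulation_integrable (fun z => a + rlinear X Y z) (fun z => b + rlinear Y Z z) I J /\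
  circulation (fun z => a + rlinear X Y z) (fun z => b + rlinear Y Z z) I J = 0.
Proof.
move=> hI hJ; split.
  by split=> [y _|x _]; [have [] := affine_hor a X Y y hI|have [] := affine_ver b Y Z x hJ].
rewrite /circulation.
have E y := proj2 (affine_hor a X Y y hI).
have E' x := proj2 (affine_ver b Y Z x hJ).
by rewrite !E !E' !rmorphB /=; ring.
Qed.

(* The partial derivatives need not be continuous, whence Goursat's bisection
   argument instead of Green's formula. *)
Theorem green_goursat p q I J : I.1 <= I.2 -> J.1 <= J.2 ->
  closed_form p q I J -> circulation p q I J = 0.
Proof.
move=> hI hJ cf; apply/eqP; rewrite -normc_eq0; apply/eqP/le_anti; rewrite normc_ge0 andbT.
have itgQ := closed_form_integrable cf.
pose D (I J : R * R) := (I.2 - I.1) + (J.2 - J.1).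
(* A bound quadratic in the half-perimeter [D] is stable under subdivision: each quarter has half
   the [D], and four times [(D / 2) ^+ 2] is [D ^+ 2]. *)
suff H (e : R) : 0 < e -> normc (circulation p q I J) <= e * D I J ^+ 2.
  apply/ler_addgt0Pr => e e0; rewrite add0r.
  have D0 : 0 < D I J ^+ 2 + 1 by rewrite ltr_wpDl ?sqr_ge0.
  rewrite (le_trans (H (e / (D I J ^+ 2 + 1)) _)) ?divr_gt0//.
  by rewrite mulrAC ler_pdivrMr//; apply: ler_wpM2l; [exact: ltW|rewrite lerDl].
move=> e0.
suff : I.1 <= I.1 -> I.2 <= I.2 -> J.1 <= J.1 -> J.2 <= J.2 -> normc (circulation p q I J) <= e * D I J ^+ 2 by apply.
pose P I' J' := I.1 <= I'.1 -> I'.2 <= I.2 -> J.1 <= J'.1 -> J'.2 <= J.2 ->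
  normc (circulation p q I' J') <= e * D I' J' ^+ 2.
apply: (@bisection P) => //.
  move=> I' J' hI' hJ' H h1 h2 h3 h4.
  rewrite circulation_split//; last exact: circulation_integrable_sub itgQ.
  have Hst s t : normc (circulation p q (half_itv s I') (half_itv t J')) <= e * (D I' J' / 2) ^+ 2.
    have -> : D I' J' / 2 = D (half_itv s I') (half_itv t J').
      by rewrite /D /half_itv; case: s; case: t => /=; field.
    by apply: H; rewrite /half_itv; case: s; case: t => /=; lra.
  have -> : e * D I' J' ^+ 2 = \sum_(s : bool) \sum_(t : bool) e * (D I' J' / 2) ^+ 2.
    by rewrite !big_bool /=; field.
  rewrite (le_trans (normc_sum _ _ _))//; apply: ler_sum => s _.
  by rewrite (le_trans (normc_sum _ _ _))//; apply: ler_sum => t _.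
move=> x y hx hy; have [X [Y [Z [dp dq]]]] := cf x y (conj hx hy).
(* The 4 is the one of [circulation_bound], applied below with the pointwise bound [e / 4 * D]. *)
have e4 : 0 < e / 4 by rewrite divr_gt0.
have [d d0 Hd] := near0I (dp _ e4) (dq _ e4).
exists (d / 2); first by rewrite divr_gt0.
move=> I' J' i1 i2 j1 j2 hx' hy' di dj _ _ _ _.
have hI' : I'.1 <= I'.2 by lra.
have hJ' : J'.1 <= J'.2 by lra.
set z := cpoint x y in dp dq Hd.
(* The first-order expansions at [z] form a closed affine pair of circulation zero, so only the
   remainders contribute. *)
pose ap w := (p z - rlinear X Y z) + rlinear X Y w.
pose aq w := (q z - rlinear Y Z z) + rlinear Y Z w.
have [ia ca] : circulation_integrable ap aq I' J' /\ circulation ap aq I' J' = 0 by exact: circulation_affine.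
have iQ := circulation_integrable_sub i1 i2 j1 j2 itgQ.
have ir : circulation_integrable (fun w => p w - ap w) (fun w => q w - aq w) I' J'.
  split=> [y' h|x' h]; apply: cintegrableB; by [exact: iQ.1|exact: iQ.2|exact: ia.1|exact: ia.2].
have subE (f g : R[i] -> R[i]) : (fun w => f w - g w + g w) = f.
  by apply/funext => w; rewrite subrK.
have := circulationD hI' hJ' ir ia; rewrite ca addr0 !subE => ->.
have -> : e * D I' J' ^+ 2 = 4 * (e / 4 * D I' J') * D I' J' by field.
apply: circulation_bound => // x' y' [hx2 hy2].
have nh : normc (cpoint x' y' - z) <= D I' J'.
  rewrite (le_trans (ler_normc_ReIm _))// Re_add Im_add Re_opp Im_opp /z !Re_cpoint !Im_cpoint.
  by apply: lerD; rewrite ler_norml; lra.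
have nd : normc (cpoint x' y' - z) < d by rewrite (le_lt_trans nh)// /D; lra.
have := Hd _ nd; rewrite (_ : z + (cpoint x' y' - z) = cpoint x' y'); last by ring.
move=> [h1 h2].
have linB X' Y' : rlinear X' Y' (cpoint x' y' - z) = rlinear X' Y' (cpoint x' y') - rlinear X' Y' z.
  by rewrite /rlinear Re_add Im_add Re_opp Im_opp !rmorphD !rmorphN /=; ring.
move: h1 h2; rewrite !linB => h1 h2.
have e4D := ler_wpM2l (ltW e4) nh.
split; apply: le_trans e4D.
  by apply: le_trans h1; rewrite /ap (_ : p _ - _ = p (cpoint x' y') - p z - (rlinear X Y (cpoint x' y') - rlinear X Y z))//; ring.
by apply: le_trans h2; rewrite /aq (_ : q _ - _ = q (cpoint x' y') - q z - (rlinear Y Z (cpoint x' y') - rlinear Y Z z))//; ring.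
Qed.

End Goursat.

(** * Cauchy formula on circles *)

Section Cauchy.
Context {R : realType}.
Implicit Types (x y t : R).

Definition expi t : R[i] := cos t +i* sin t.

Lemma normc_expi t : normc (expi t) = 1.
Proof. by rewrite /expi /= cos2Dsin2 sqrtr1. Qed.

Lemma expi_neq0 t : expi t != 0.
Proof. by rewrite -normc_gt0 normc_expi. Qed.

Lemma expi_conj t : (expi t)^*%C = (expi t)^-1.
Proof.
apply: (mulfI (expi_neq0 t)); rewrite mulfV ?expi_neq0//.
apply: complex_ext; rewrite ?(Re_mul, Im_mul) /=; last by ring.
by rewrite mulrN opprK -!expr2 cos2Dsin2.
Qed.

Lemma expi_2pi : expi (2 * pi) = expi 0.
Proof. by rewrite /expi mulr_natl cos2pi sin2pi cos0 sin0. Qed.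

Lemma derive_expand (f : R -> R) t d : is_derive t (1 : R) f d ->
  forall e, 0 < e -> exists2 u, 0 < u & forall k, `|k| < u -> `|f (t + k) - f t - k * d| <= e * `|k|.
Proof.
move=> df e e0.
have dff : differentiable f t by apply/derivable1_diffP; exact: ex_derive.
have /eqaddoP /(_ e e0) := diff_locally dff.
move=> /nbhs_normP [u /= u0 H]; exists u => // k ku.
have := H k; rewrite /= sub0r normrN => /(_ ku).
rewrite !fctE /= -(mulr1 k) -[k * 1]/(k *: (1 : R)) linearZ /= -deriveE// derive_val.
by rewrite /GRing.scale /= !mulr1 opprD addrA [t + k]addrC.
Qed.

(** A function of the real variable [t] is encoded as a function of [complex.Im w], so that the
    planar rules for [rdiff] also differentiate parametrised circles. *)
Lemma rdiff_expi z : rdiff (fun w => expi (complex.Im w)) z 0 ('i * expi (complex.Im z)).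
Proof.
move=> e e0; have e20 : 0 < e / 2 by rewrite divr_gt0.
have [u u0 hu] := derive_expand (is_derive_cos (complex.Im z)) e20.
have [v v0 hv] := derive_expand (is_derive_sin (complex.Im z)) e20.
exists (Num.min u v); first by rewrite lt_min u0.
move=> h; rewrite lt_min => /andP[h1 h2].
have ih := ler_Im_normc h.
have := hu _ (le_lt_trans ih h1); have := hv _ (le_lt_trans ih h2).
move=> H1 H2; rewrite (le_trans (ler_normc_ReIm _))//.
have E : rlinear 0 ('i * expi (complex.Im z)) h =
    (complex.Im h * - sin (complex.Im z)) +i* (complex.Im h * cos (complex.Im z)).
  by rewrite /rlinear /expi; apply: complex_ext; rewrite ?(Re_add, Im_add, Re_mul, Im_mul) /=; ring.
rewrite E /expi !(Re_add, Im_add, Re_opp, Im_opp) (le_trans (lerD H2 H1))//.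
by rewrite -mulrDl -splitr ler_wpM2l// ltW.
Qed.

Lemma rdiff_Re (z : R[i]) : rdiff (fun w => (complex.Re w)%:C) z 1 0.
Proof.
have := @rdiff_rlinear R 0 1 0 z; apply: eq_rdiff; exists 1 => // h _.
by rewrite /rlinear; ring.
Qed.

Lemma ler_dist_normc (z w : R[i]) : `|normc z - normc w| <= normc (z - w).
Proof.
by rewrite ler_norml ler_normc_sub andbT lerNl opprB normcB ler_normc_sub.
Qed.

Lemma ccont_bounded (f : R -> R[i]) a b : a <= b -> (forall x, a <= x <= b -> ccont f x) ->
  exists K, forall x, a <= x <= b -> normc (f x) <= K.
Proof.
move=> ab cf.
have cn : {within `[a, b], continuous (fun x => normc (f x))}.
  apply: continuous_in_subspaceT => x; rewrite inE /= in_itv /= => /cf cfx.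
  apply/cvgrPdist_lt => e e0; have [d d0 H] := cfx e e0.
  apply/nbhs_normP; exists d => //= y; rewrite /ball_ /= distrC => /H.
  by apply: le_lt_trans; rewrite distrC ler_dist_normc.
have [c _ hc] := EVT_max ab cn.
by exists (normc (f c)) => x hx; apply: hc; rewrite in_itv.
Qed.

Section Loop.
Variables (G : R[i] -> R[i]) (a : R[i]) (r : R).
Hypothesis ar : normc a < r.
Hypothesis dG : forall z, normc z <= r -> exists l, cdiff G z l.

(** The form dw / (w - a) pulled back to the circle w = r e^(it), where dw = i w dt. *)
Definition cauchy_kernel t : R[i] := 'i * r%:C * expi t / (r%:C * expi t - a).

Let r0 : 0 < r. Proof. exact: le_lt_trans (normc_ge0 _) ar. Qed.

Lemma loop_norm t : r - normc a <= normc (r%:C * expi t - a).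
Proof.
have := ler_normc_sub (r%:C * expi t) a.
by rewrite normcM normcR normc_expi mulr1 gtr0_norm.
Qed.

Lemma loop_neq0 t : r%:C * expi t - a != 0.
Proof. by rewrite -normc_gt0 (lt_le_trans _ (loop_norm t))// subr_gt0. Qed.

Lemma normc_cauchy_kernel t : normc (cauchy_kernel t) <= r / (r - normc a).
Proof.
rewrite /cauchy_kernel !normcM normcV normc_i normcR normc_expi gtr0_norm// mul1r mulr1.
apply: ler_wpM2l; first exact: ltW.
by rewrite lef_pV2 ?posrE ?subr_gt0 ?loop_norm// normc_gt0 loop_neq0.
Qed.

Lemma loop_in s t : 0 <= s <= 1 -> normc (a + s%:C * (r%:C * expi t - a)) <= r.
Proof.
move=> /andP[s0 s1].
have -> : a + s%:C * (r%:C * expi t - a) = (1 - s)%:C * a + s%:C * (r%:C * expi t).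
  by rewrite rmorphB /=; ring.
rewrite (le_trans (ler_normcD _ _))// !normcM normc_expi !normcR mulr1.
rewrite !ger0_norm ?subr_ge0 ?(ltW r0)//.
have := ler_wpM2l (_ : 0 <= 1 - s) (ltW ar); rewrite subr_ge0 => /(_ s1); lra.
Qed.

Lemma rdiff_cauchy_kernel z : exists Y, rdiff (fun w => cauchy_kernel (complex.Im w)) z 0 Y.
Proof.
have d1 := rdiffM (rdiff_cst ('i * r%:C) z) (rdiff_expi z).
have d2 := rdiffD (rdiffM (rdiff_cst (r%:C) z) (rdiff_expi z)) (rdiff_cst (- a) z).
have d3 := rdiff_comp d2 (cdiffV (loop_neq0 _)).
have := rdiffM d1 d3; rewrite !(mul0r, mulr0, addr0).
by move=> h; eexists; exact: h.
Qed.

Lemma loop_rdiff z : rdiff (fun w => a + (complex.Re w)%:C * (r%:C * expi (complex.Im w) - a)) z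
  (r%:C * expi (complex.Im z) - a) ((complex.Re z)%:C * (r%:C * ('i * expi (complex.Im z)))).
Proof.
have d2 := rdiffD (rdiffM (rdiff_cst (r%:C) z) (rdiff_expi z)) (rdiff_cst (- a) z).
have := rdiffD (rdiff_cst a z) (rdiffM (rdiff_Re z) d2).
by rewrite !(mul0r, mulr0, addr0, add0r, mul1r).
Qed.

Lemma closed_form_at p q (z X Y X' Z : R[i]) : rdiff p z X Y -> rdiff q z X' Z -> X' = Y ->
  exists X Y Z, rdiff p z X Y /\ rdiff q z Y Z.
Proof. by move=> dp dq E; exists X, X', Z; rewrite {1}E. Qed.

(* Closedness of the form [G Z (ds / s + dg / g)] where [Z = a + s g(t)] and
   [g(t) = r e^(it) - a]. *)
Lemma loop_deform e : 0 < e -> e <= 1 ->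
  cintegral (fun t => G (a + e%:C * (r%:C * expi t - a)) * cauchy_kernel t) 0 (2 * pi) =
  cintegral (fun t => G (r%:C * expi t) * cauchy_kernel t) 0 (2 * pi).
Proof.
move=> e0 e1; pose Z w := a + (complex.Re w)%:C * (r%:C * expi (complex.Im w) - a).
pose p w := G (Z w) * ((complex.Re w)%:C)^-1.
pose q w := G (Z w) * cauchy_kernel (complex.Im w).
have pi0 : 0 <= 2 * pi :> R by rewrite mulr_ge0// pi_ge0.
have := @green_goursat R p q (e, 1) (0, 2 * pi) e1 pi0.
have cf : closed_form p q (e, 1) (0, 2 * pi).
  move=> s t [/= hs ht]; have s0 : 0 < s by lra.
  have [l dl] : exists l, cdiff G (Z (cpoint s t)) l.
    by apply: dG; rewrite /Z Re_cpoint Im_cpoint loop_in//; lra.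
  have dZ := rdiff_comp (loop_rdiff (cpoint s t)) dl.
  have sn0 : (complex.Re (cpoint s t))%:C != 0.
    by rewrite Re_cpoint -normc_gt0 normcR normr_gt0 gt_eqF.
  have dV := rdiff_comp (rdiff_Re (cpoint s t)) (cdiffV sn0).
  have [Y dk] := rdiff_cauchy_kernel (cpoint s t).
  have dp := rdiffM dZ dV; have dq := rdiffM dZ dk.
  apply: (closed_form_at dp dq).
  rewrite /cauchy_kernel; move: sn0; rewrite /Z Re_cpoint Im_cpoint => sn0.
  by field; rewrite sn0 loop_neq0.
move=> /(_ cf); rewrite /circulation /=.
have -> : (fun x => p (cpoint x 0)) = (fun x => p (cpoint x (2 * pi))).
  by apply/funext => x; rewrite /p /Z !Re_cpoint !Im_cpoint expi_2pi.
rewrite subrr add0r => /eqP; rewrite subr_eq0 => /eqP H.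
rewrite (eq_cintegral (g := fun t => q (cpoint e t))); last by move=> t; rewrite /q /Z Re_cpoint Im_cpoint.
rewrite -H; apply: eq_cintegral => t; rewrite /q /Z Re_cpoint Im_cpoint rmorph1 mul1r.
by rewrite addrCA subrr addr0.
Qed.

Lemma cauchy_kernel_cont t : ccont cauchy_kernel t.
Proof.
have [Y /rdiff_ver h] := rdiff_cauchy_kernel (cpoint 0 t).
by move: h; under eq_fun do rewrite Im_cpoint.
Qed.

Lemma loop_cont s t : 0 <= s <= 1 -> ccont (fun t => G (a + s%:C * (r%:C * expi t - a)) * cauchy_kernel t) t.
Proof.
move=> hs; have [l dl] : exists l, cdiff G (a + s%:C * (r%:C * expi t - a)) l by exact/dG/loop_in.
have [Y dk] := rdiff_cauchy_kernel (cpoint s t).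
have dZ : rdiff (fun w => a + (complex.Re w)%:C * (r%:C * expi (complex.Im w) - a)) (cpoint s t) _ _ := loop_rdiff (cpoint s t).
have dl' : cdiff G (a + (complex.Re (cpoint s t))%:C * (r%:C * expi (complex.Im (cpoint s t)) - a)) l.
  by rewrite Re_cpoint Im_cpoint.
have := rdiff_ver (rdiffM (rdiff_comp dZ dl') dk).
by under eq_fun do rewrite Re_cpoint Im_cpoint.
Qed.

(** The circle is contracted towards [a] by [loop_deform]. The kernel does not change under scaling
    about [a], while [G] on the contracted loop tends uniformly to [G a]. *)
Theorem cauchy_loop :
  cintegral (fun t => G (r%:C * expi t) * cauchy_kernel t) 0 (2 * pi) = G a * cintegral cauchy_kernel 0 (2 * pi).
Proof.
have pi0 : 0 <= 2 * pi :> R by rewrite mulr_ge0// pi_ge0.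
apply/eqP; rewrite -subr_eq0 -normc_eq0; apply/eqP/le_anti; rewrite normc_ge0 andbT.
apply/ler_addgt0Pr => e e0; rewrite add0r.
have [l /rdiff_cont dl] := dG (ltW ar).
have K0 : 0 < r / (r - normc a) by rewrite divr_gt0// subr_gt0.
have pi1 : 0 < 2 * pi :> R by rewrite mulr_gt0// pi_gt0.
have D0 : 0 < 2 * (r / (r - normc a)) * (2 * pi) by rewrite mulr_gt0// mulr_gt0.
have e10 : 0 < e / (2 * (r / (r - normc a)) * (2 * pi)) by rewrite divr_gt0.
have [d d0 hd] := dl _ e10.
(* The points of the loop are within [s * (r + normc a)] of [a]; the final division by 2 makes this
   strictly less than [d]. *)
pose s := Num.min 1 (d / (r + normc a) / 2).
have ra : 0 < r + normc a by rewrite ltr_pwDl// normc_ge0.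
have s0 : 0 < s by rewrite lt_min ltr01 !divr_gt0.
have s1 : s <= 1 by rewrite ge_min lexx.
have sd : s * (r + normc a) < d.
  rewrite -ltr_pdivlMr// (@le_lt_trans _ _ (d / (r + normc a) / 2))//.
    by rewrite ge_min lexx orbT.
  by rewrite ltr_pdivrMr// ltr_pMr ?divr_gt0// ltr1n.
have s01 : 0 <= s <= 1 by rewrite s1 ltW.
have ck : cintegrable cauchy_kernel 0 (2 * pi) by apply: ccont_cintegrable => x _; exact: cauchy_kernel_cont.
have cG : cintegrable (fun t => G (a + s%:C * (r%:C * expi t - a)) * cauchy_kernel t) 0 (2 * pi).
  by apply: ccont_cintegrable => x _; exact: loop_cont.
rewrite -(loop_deform s0 s1) -cintegralZ// -cintegralB//; last exact: cintegrableZ.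
rewrite (le_trans (@cintegral_bound _ _ _ _ (e / (2 * (r / (r - normc a)) * (2 * pi)) * (r / (r - normc a))) _ _ _))//.
- by apply: cintegrableB => //; exact: cintegrableZ.
- move=> t _; rewrite -mulrBl normcM ler_pM ?normc_ge0 ?normc_cauchy_kernel//.
  apply/ltW/hd; rewrite normcM normcR gtr0_norm//.
  apply: le_lt_trans sd; rewrite ler_wpM2l ?(ltW s0)//.
  by rewrite (le_trans (ler_normcB _ _))// normcM normcR normc_expi mulr1 gtr0_norm.
- rewrite subr0; move: D0; move: (2 * pi) (r / (r - normc a)) => P K PK.
  have -> : 2 * (e / (2 * K * P) * K) * P = e / (2 * K * P) * (2 * K * P) by move: (_^-1) => u; ring.
  by rewrite mulfVK ?gt_eqF.
Qed.

End Loop.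
End Cauchy.

(** * Mean value property, Cauchy formula and polynomial approximation *)

Section MeanValue.
Context {R : realType}.

Let pi2_ge0 : 0 <= 2 * pi :> R. Proof. by rewrite mulr_ge0// pi_ge0. Qed.
Let pi2_gt0 : 0 < 2 * pi :> R. Proof. by rewrite mulr_gt0// pi_gt0. Qed.

Lemma conjcD (x y : R[i]) : (x + y)^*%C = x^*%C + y^*%C.
Proof. exact: (rmorphD (@conjc R)). Qed.

Lemma conjcM (x y : R[i]) : (x * y)^*%C = x^*%C * y^*%C.
Proof. exact: (rmorphM (@conjc R)). Qed.

Lemma conjcN (x : R[i]) : (- x)^*%C = - x^*%C.
Proof. exact: (rmorphN (@conjc R)). Qed.

Lemma conjcV (x : R[i]) : (x^-1)^*%C = (x^*%C)^-1.
Proof. exact: (fmorphV (@conjc R)). Qed.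

Lemma conjcX (x : R[i]) n : (x ^+ n)^*%C = (x^*%C) ^+ n.
Proof. exact: (rmorphXn (@conjc R)). Qed.

Lemma conjcR (x : R) : (x%:C)^*%C = x%:C.
Proof. by rewrite /= oppr0. Qed.

Lemma circle_cont (G : R[i] -> R[i]) r t l : cdiff G (r%:C * expi t) l ->
  ccont (fun t => G (r%:C * expi t)) t.
Proof.
move=> dl; have d2 := rdiffM (rdiff_cst (r%:C) (cpoint 0 t)) (rdiff_expi (cpoint 0 t)).
have dl' : cdiff G (r%:C * expi (complex.Im (cpoint 0 t))) l by rewrite Im_cpoint.
have := rdiff_ver (rdiff_comp d2 dl').
by under eq_fun do rewrite Im_cpoint.
Qed.

(** For centre 0 the Cauchy kernel is the constant ['i], so [cauchy_loop] yields the mean value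
    before the integral of a general kernel is known; that integral is then deduced from it. *)
Lemma mean_value (G : R[i] -> R[i]) r : 0 < r ->
  (forall z, normc z <= r -> exists l, cdiff G z l) ->
  cintegrable (fun t => G (r%:C * expi t)) 0 (2 * pi) /\
  cintegral (fun t => G (r%:C * expi t)) 0 (2 * pi) = (2 * pi)%:C * G 0.
Proof.
move=> r0 dG; have cG : cintegrable (fun t => G (r%:C * expi t)) 0 (2 * pi).
  apply: ccont_cintegrable => t _; have [|l dl] := dG (r%:C * expi t).
    by rewrite normcM normcR normc_expi mulr1 gtr0_norm.
  exact: circle_cont dl.
split=> //.
have a0 : normc (0 : R[i]) < r by rewrite normc0.
have i0 : 'i != 0 :> R[i] by rewrite -normc_gt0 normc_i.
have kE t : cauchy_kernel 0 r t = 'i.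
  rewrite /cauchy_kernel subr0 -[_ * r%:C * _]mulrA mulfK//.
  by rewrite mulf_neq0 ?expi_neq0// -normc_gt0 normcR normr_gt0 gt_eqF.
have := cauchy_loop a0 dG.
under eq_cintegral do rewrite kE mulrC; under [in RHS]eq_cintegral do rewrite kE.
rewrite cintegralZ// cintegral_cst// subr0 => H; apply: (mulfI i0); rewrite H; ring.
Qed.

Lemma mean_value_at (G : R[i] -> R[i]) z r : 0 < r ->
  (forall w, normc (w - z) <= r -> exists l, cdiff G w l) ->
  cintegrable (fun t => G (z + r%:C * expi t)) 0 (2 * pi) /\
  cintegral (fun t => G (z + r%:C * expi t)) 0 (2 * pi) = (2 * pi)%:C * G z.
Proof.
move=> r0 dG; have := @mean_value (fun w => G (z + w)) r r0; rewrite addr0; apply.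
move=> w wr; have [|l dl] := dG (z + w); first by rewrite addrC addKr.
exists (l * (0 + 1)); exact: (cdiff_comp (cdiffD (cdiff_cst z w) (cdiff_id w)) dl).
Qed.

Lemma cintegral_conj (f : R -> R[i]) a b : cintegrable f a b ->
  cintegrable (fun t => (f t)^*%C) a b /\ cintegral (fun t => (f t)^*%C) a b = (cintegral f a b)^*%C.
Proof.
move=> [h1 h2]; have ReJ z : complex.Re (z^*%C) = complex.Re z :> R by case: z.
have ImJ z : complex.Im (z^*%C) = -1 * complex.Im z :> R by case: z => x y /=; rewrite mulN1r.
split.
  split; first by apply: eq_integrable_seg h1 => x; rewrite ReJ.
  by apply: eq_integrable_seg (integrable_segZ (-1) h2) => x; rewrite ImJ.
rewrite /cintegral; under [X in integral_seg X]eq_fun do rewrite ReJ.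
under [X in _ +i* integral_seg X _ _]eq_fun do rewrite ImJ.
by rewrite integral_segZ//= mulN1r.
Qed.

(** No winding number is computed: on the circle 1/w = conj w / r^2, so w / (w - a) is the conjugate
    of 1 / (1 - conj(a) w / r^2). This last function is holomorphic on the closed disc with value 1
    at 0, and the mean value property applies. *)
Lemma cintegral_cauchy_kernel (a : R[i]) r : normc a < r -> cintegral (cauchy_kernel a r) 0 (2 * pi) = 'i * (2 * pi)%:C.
Proof.
move=> ar; have r0 : 0 < r by exact: le_lt_trans (normc_ge0 _) ar.
have rC0 : r%:C != 0 :> R[i] by rewrite -normc_gt0 normcR normr_gt0 gt_eqF.
pose b := - (a^*%C / r%:C ^+ 2); pose H z := (1 + b * z)^-1.
have H0 z : normc z <= r -> 1 + b * z != 0.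
  move=> zr; rewrite -normc_gt0; have := ler_normc_sub 1 (- (b * z)).
  rewrite opprK normcN normc1 normcM /b normcN normcM normcV normcX normcR normc_conj gtr0_norm//.
  apply: lt_le_trans; rewrite subr_gt0.
  have r2 : 0 < r ^+ 2 by rewrite exprn_gt0.
  rewrite mulrAC ltr_pdivrMr// mul1r expr2.
  apply: le_lt_trans (ler_wpM2l (normc_ge0 a) zr) _; by rewrite ltr_pM2r.
have dH z : normc z <= r -> exists l, cdiff H z l.
  move=> zr; have d1 := cdiffD (cdiff_cst 1 z) (cdiffM (cdiff_cst b z) (cdiff_id z)).
  by eexists; exact: cdiff_comp d1 (cdiffV (H0 z zr)).

have [c1 c2] := mean_value r0 dH; have [c3 c4] := cintegral_conj c1.
have kE t : cauchy_kernel a r t = 'i * (H (r%:C * expi t))^*%C.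
  rewrite /cauchy_kernel -mulrA -mulrA; congr (_ * _).
  have l0 := loop_neq0 ar t.
  have e0 := expi_neq0 t.
  have conj1 : (1 : R[i])^*%C = 1 by exact: (rmorph1 (@conjc R)).
  rewrite /H /b conjcV conjcD conj1 !conjcM conjcN conjcM conjcV conjcX !conjcR expi_conj conjcK.
  by field; rewrite rC0 l0 e0.
under eq_cintegral do rewrite kE; rewrite cintegralZ// c4 c2 /H mulr0 addr0 invr1 mulr1.
by rewrite /= oppr0.
Qed.

Lemma cauchy_formula (G : R[i] -> R[i]) a (r : R) : normc a < r ->
  (forall z, normc z <= r -> exists l, cdiff G z l) ->
  cintegral (fun t => G (r%:C * expi t) * cauchy_kernel a r t) 0 (2 * pi) = 'i * (2 * pi)%:C * G a.
Proof. by move=> ar dG; rewrite cauchy_loop// cintegral_cauchy_kernel// mulrC. Qed.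

Lemma geometric_cauchy_kernel (a : R[i]) (r t : R) N : normc a < r -> cauchy_kernel a r t =
  'i * (\sum_(k < N) a ^+ k * (r%:C * expi t) ^- k + a ^+ N * ((r%:C * expi t) ^- N * (r%:C * expi t / (r%:C * expi t - a)))).
Proof.
move=> ar; have r0 : 0 < r by exact: le_lt_trans (normc_ge0 _) ar.
have rC0 : r%:C != 0 :> R[i] by rewrite -normc_gt0 normcR normr_gt0 gt_eqF.
have l0 := loop_neq0 ar t; rewrite /cauchy_kernel -[_ * r%:C * _]mulrA -[_ * _ / _]mulrA; congr (_ * _).
have : r%:C * expi t != 0 by rewrite mulf_neq0 ?expi_neq0.
move: (r%:C * expi t) l0 => w l0 w0.
elim: N => [|N IH]; first by rewrite big_ord0 expr0 invr1 !mul1r add0r.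
rewrite [LHS]IH big_ord_recr /= -addrA; congr (_ + _).
rewrite !exprS; have wN : w ^+ N != 0 by rewrite expf_neq0.
by field; rewrite l0 wN w0.
Qed.

Lemma geometric_small (x C e : R) : 0 <= x < 1 -> 0 < e -> exists N, x ^+ N * C <= e.
Proof.
move=> /andP[x0 x1] e0.
have C0 : 0 < `|C| + 1 by rewrite ltr_wpDl.
have : (fun n => x ^+ n) @ \oo --> (0 : R) by apply: cvg_expr; rewrite ger0_norm.
move=> /cvgr0Pnorm_lt /(_ (e / (`|C| + 1)) (divr_gt0 e0 C0)) [N _ /(_ N (leqnn _))].
rewrite ger0_norm ?exprn_ge0// ltr_pdivlMr// => H.
exists N; apply: le_trans (ltW H); rewrite ler_wpM2l ?exprn_ge0//.
by rewrite (le_trans (ler_norm _))// lerDl.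
Qed.

(** The polynomial comes from truncating the geometric expansion of the Cauchy kernel; the explicit
    remainder is O((s / r)^N) uniformly on the smaller disc, so no power series is summed. *)
Lemma taylor_approx (G : R[i] -> R[i]) (s r e : R) : 0 <= s -> s < r -> 0 < e ->
  (forall z, normc z <= r -> exists l, cdiff G z l) ->
  exists p : {poly R[i]}, forall z, normc z <= s -> normc (G z - p.[z]) <= e.
Proof.
move=> s0 sr e0 dG; have r0 : 0 < r by exact: le_lt_trans sr.
have rC0 : r%:C != 0 :> R[i] by rewrite -normc_gt0 normcR normr_gt0 gt_eqF.
have nr t : normc (r%:C * expi t) = r by rewrite normcM normcR normc_expi mulr1 gtr0_norm.
have w0 t : r%:C * expi t != 0 by rewrite -normc_gt0 nr.
have cG t : ccont (fun t => G (r%:C * expi t)) t.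
  by have [|l dl] := dG (r%:C * expi t); [rewrite nr|exact: circle_cont dl].
have [K HK] := ccont_bounded pi2_ge0 (fun t _ => cG t).
have K0 : 0 <= K.
  by apply: le_trans (HK 0 _); rewrite ?normc_ge0// lexx.
have rs : 0 < r - s by rewrite subr_gt0.
(* [K] bounds [G] on the circle, [r / (r - s)] bounds w / (w - z) there, and the 2 is that of
   [cintegral_bound]; the length 2 pi cancels with the normalisation. *)
have [|N HN] := @geometric_small (s / r) (2 * (K * (r / (r - s)))) e _ e0.
  by rewrite divr_ge0 ?(ltW r0)//= ltr_pdivrMr// mul1r.
have dGV k z : normc z <= r -> z != 0 -> exists l, cdiff (fun z => G z * z ^- k) z l.
  move=> zr z0; have [l dl] := dG z zr; eexists; apply: cdiffM dl _.
  by apply: cdiff_comp (cdiffX z k) (cdiffV _); rewrite expf_neq0.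
have cGV k : cintegrable (fun t => G (r%:C * expi t) * (r%:C * expi t) ^- k) 0 (2 * pi).
  apply: ccont_cintegrable => t _; have [||l dl] := dGV k (r%:C * expi t); rewrite ?nr//.
  exact: circle_cont dl.
pose c k := cintegral (fun t => G (r%:C * expi t) * (r%:C * expi t) ^- k) 0 (2 * pi) / (2 * pi)%:C.
have piC0 : (2 * pi)%:C != 0 :> R[i] by rewrite -normc_gt0 normcR normr_gt0 gt_eqF.
exists (\poly_(k < N) c k) => z zs; have zr : normc z < r by exact: le_lt_trans sr.
pose E t := G (r%:C * expi t) * ((r%:C * expi t) ^- N * (r%:C * expi t / (r%:C * expi t - z))).
have cE : cintegrable E 0 (2 * pi).
  apply: ccont_cintegrable => t _; have [||l dl] := dGV N (r%:C * expi t); rewrite ?nr//.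
  have d1 : cdiff (fun w => w / (w - z)) (r%:C * expi t) _ :=
    cdiffM (cdiff_id _) (cdiff_comp (cdiffD (cdiff_id _) (cdiff_cst (- z) _)) (cdiffV (loop_neq0 zr t))).
  have := circle_cont (cdiffM dl d1).
  by under eq_fun do rewrite -mulrA.
have H := cauchy_formula zr dG.
have HE : cintegral (fun t => G (r%:C * expi t) * cauchy_kernel z r t) 0 (2 * pi) =
    'i * (\sum_(k < N) z ^+ k * cintegral (fun t => G (r%:C * expi t) * (r%:C * expi t) ^- k) 0 (2 * pi)
       + z ^+ N * cintegral E 0 (2 * pi)).
  have -> : (fun t => G (r%:C * expi t) * cauchy_kernel z r t) = (fun t => 'i *
     (\sum_(k < N) z ^+ k * (G (r%:C * expi t) * (r%:C * expi t) ^- k) + z ^+ N * E t)).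
    apply/funext => t; rewrite (geometric_cauchy_kernel t N zr) mulrCA; congr (_ * _).
    rewrite mulrDr mulr_sumr /E; congr (_ + _); last by ring.
    by apply: eq_bigr => k _; ring.
  have [c1 c2] := @cintegral_sum R N (fun k t => z ^+ k * (G (r%:C * expi t) * (r%:C * expi t) ^- k)) 0 (2 * pi) (fun k => cintegrableZ _ (cGV k)).
  have c3 := cintegrableZ (z ^+ N) cE.
  rewrite cintegralZ; last exact: cintegrableD.
  rewrite cintegralD// c2 cintegralZ//; congr (_ * (_ + _)).
  by apply: eq_bigr => k _; rewrite cintegralZ.
have i0 : 'i != 0 :> R[i] by rewrite -normc_gt0 normc_i.
have GE : G z - (\poly_(k < N) c k).[z] = z ^+ N * cintegral E 0 (2 * pi) / (2 * pi)%:C.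
  move: HE; rewrite H -mulrA => /(mulfI i0) HE.
  have pE : (\poly_(k < N) c k).[z] = (\sum_(k < N) z ^+ k *
      cintegral (fun t => G (r%:C * expi t) * (r%:C * expi t) ^- k) 0 (2 * pi)) / (2 * pi)%:C.
    by rewrite horner_poly mulr_suml; apply: eq_bigr => k _; rewrite /c; move: (_^-1) => u; ring.
  have GzE : G z = (2 * pi)%:C * G z / (2 * pi)%:C by rewrite mulrAC mulfV// mul1r.
  by rewrite pE {}GzE HE -mulrBl addrAC subrr add0r.
rewrite GE !normcM normcV normcR gtr0_norm// ler_pdivrMr//.
have hE : normc (cintegral E 0 (2 * pi)) <= 2 * (K * (r ^- N * (r / (r - s)))) * (2 * pi - 0).
  apply: cintegral_bound pi2_ge0 cE _ => t ht.
  rewrite /E normcM ler_pM ?normc_ge0 ?HK// normcM normcV normcX nr ler_wpM2l ?invr_ge0 ?exprn_ge0 ?(ltW r0)//.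
  rewrite normcM normcV nr ler_wpM2l ?(ltW r0)// lef_pV2 ?posrE//.
    by rewrite (le_trans _ (loop_norm zr t))// lerB.
  by rewrite normc_gt0 loop_neq0.
rewrite subr0 in hE; rewrite normcX.
have zN : normc z ^+ N <= s ^+ N by rewrite lerXn2r ?nnegrE ?normc_ge0.
apply: le_trans (ler_pM _ (normc_ge0 _) zN hE) _; first by rewrite exprn_ge0 ?normc_ge0.
have HN' := ler_wpM2r pi2_ge0 HN; apply: le_trans HN'.
rewrite expr_div_n; move: (2 * pi) (r ^- N) (r - s)^-1 => P u v.
by rewrite le_eqVlt; apply/orP; left; apply/eqP; ring.
Qed.

End MeanValue.

(** * Coefficients of polyanalytic polynomials *)

Section Coefficients.
Context {R : realType}.
Implicit Types (p q : {poly R[i]}).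

Let pi2_gt0 : 0 < 2 * pi :> R. Proof. by rewrite mulr_gt0// pi_gt0. Qed.

Lemma cintegral_expiX k : cintegrable (fun t : R => expi t ^+ k) 0 (2 * pi) /\
  cintegral (fun t : R => expi t ^+ k) 0 (2 * pi) = (2 * pi)%:C * (k == 0%N)%:R.
Proof.
have [|h1 h2] := @mean_value R (fun z => z ^+ k) 1 ltr01.
  by move=> z _; eexists; exact: cdiffX.
have E : (fun t : R => (1%:C * expi t) ^+ k) = fun t => expi t ^+ k.
  by apply/funext => t; rewrite mul1r.
by move: h1 h2; rewrite E expr0n.
Qed.

Lemma cintegral_expi_orth j k : cintegrable (fun t : R => expi t ^+ j * (expi t ^+ k)^*%C) 0 (2 * pi) /\
  cintegral (fun t : R => expi t ^+ j * (expi t ^+ k)^*%C) 0 (2 * pi) = (2 * pi)%:C * (j == k)%:R.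
Proof.
have e0 t : expi t != 0 :> R[i] := expi_neq0 t.
have [kj|jk] := leqP k j.
  have [h1 h2] := cintegral_expiX (j - k); rewrite subn_eq0 in h2.
  have E : (fun t : R => expi t ^+ j * (expi t ^+ k)^*%C) = fun t => expi t ^+ (j - k).
    by apply/funext => t; rewrite conjcX expi_conj exprVn expfB_cond ?(negbTE (e0 t)).
  by rewrite E h2; split=> //; congr (_ * _%:R); rewrite eqn_leq kj andbT.
have [h1 h2] := cintegral_expiX (k - j); have [h3 h4] := cintegral_conj h1.
have E : (fun t : R => expi t ^+ j * (expi t ^+ k)^*%C) = fun t => (expi t ^+ (k - j))^*%C.
  apply/funext => t; rewrite !conjcX expi_conj !exprVn -[in LHS](subnK (ltnW jk)) exprD invfM.
  by rewrite mulrCA mulfV ?mulr1// expf_neq0.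
rewrite E h4 h2; split=> //.
by rewrite subn_eq0 leqNgt jk (ltn_eqF jk) !mulr0 /= oppr0.
Qed.

(** The coefficient is the mean of p(e^(it)) e^(-ikt) by orthogonality; the 2 is inherited from
    [cintegral_bound]. *)
Lemma cauchy_coef p (K : R) k : (forall t, normc p.[expi t] <= K) -> normc p`_k <= 2 * K.
Proof.
move=> H.
have E : (fun t : R => p.[expi t] * (expi t ^+ k)^*%C) =
   fun t => \sum_(j < size p) p`_j * (expi t ^+ j * (expi t ^+ k)^*%C).
  by apply/funext => t; rewrite horner_coef mulr_suml; apply: eq_bigr => j _; rewrite mulrA.
have [c1 c2] := @cintegral_sum R (size p) (fun j t => p`_j * (expi t ^+ j * (expi t ^+ k)^*%C))
  0 (2 * pi) (fun j => cintegrableZ _ (proj1 (cintegral_expi_orth j k))).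
have c3 : cintegral (fun t : R => p.[expi t] * (expi t ^+ k)^*%C) 0 (2 * pi) = (2 * pi)%:C * p`_k.
  rewrite E c2.
  under eq_bigr => j _ do rewrite (cintegralZ _ (proj1 (cintegral_expi_orth j k))) (proj2 (cintegral_expi_orth j k)) mulrCA.
  rewrite -mulr_sumr; congr (_ * _).
  have [ks|sk] := ltnP k (size p); last first.
    rewrite nth_default// big1// => j _; rewrite ltn_eqF ?mulr0//.
    exact: leq_trans (ltn_ord j) sk.
  rewrite (bigD1 (Ordinal ks)) //= eqxx mulr1 big1 ?addr0// => j.
  by rewrite -val_eqE /= => /negbTE ->; rewrite mulr0.
rewrite -E in c1.
have := cintegral_bound (K := K) (ltW pi2_gt0) c1.
rewrite c3 normcM normcR gtr0_norm// subr0 [_ * (2 * pi)]mulrC ler_pM2l//; apply => t _.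
by rewrite normcM normc_conj normcX normc_expi expr1n mulr1.
Qed.

(* Induction on [n] by divided differences [(p - p(x_n)) / ('X - x_n)]. *)
Lemma interpolation_coef n p (x : nat -> R) (L d B : R) :
  (size p <= n.+1)%N -> 0 < d -> 0 <= L ->
  (forall i, (i <= n)%N -> `|x i| <= L) ->
  (forall i j, (j < i)%N -> (i <= n)%N -> d <= `|x j - x i|) ->
  (forall i, (i <= n)%N -> normc p.[(x i)%:C] <= B) ->
  forall k, normc p`_k <= B * (1 + (1 + L) * (2 / d)) ^+ n.
Proof.
move=> sp d0 L0; set A := 1 + _.
have A1 : 1 <= A by rewrite /A lerDl mulr_ge0 ?divr_ge0 ?addr_ge0 ?(ltW d0).
elim: n p B sp => [|n IH] p B sp xL xd pB k.
  have /size1_polyC pE := sp; have := pB 0%N isT; rewrite pE hornerC coefC expr0 mulr1.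
  by case: ifP => // _; rewrite normc0; apply: le_trans; exact: normc_ge0.
pose a : R[i] := (x n.+1)%:C; pose c := p.[a].
have /factor_theorem [q pq] : root (p - c%:P) a by rewrite /root !hornerE subrr.
have sq : (size q <= n.+1)%N.
  have [->|q0] := eqVneq q 0; first by rewrite size_poly0.
  have := size_Mmonic q0 (monicXsubC a); rewrite -pq size_XsubC addn2 /= => E.
  rewrite -ltnS -E (leq_trans (size_polyD _ _))// geq_max sp size_polyN.
  by rewrite (leq_trans (size_polyC_leq1 _)).
have B0 : 0 <= B by apply: le_trans (pB 0%N isT); exact: normc_ge0.
have qB i : (i <= n)%N -> normc q.[(x i)%:C] <= 2 * B / d.
  move=> ni; have xi := xd _ _ (_ : (i < n.+1)%N) (leqnn _); have {}xi := xi ni.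
  have e : q.[(x i)%:C] * ((x i)%:C - a) = p.[(x i)%:C] - c.
    by have := congr1 (fun r => r.[(x i)%:C]) pq; rewrite !hornerE => ->.
  rewrite ler_pdivlMr// (@le_trans _ _ (normc (p.[(x i)%:C] - c)))//.
    by rewrite -e normcM ler_wpM2l ?normc_ge0// /a -rmorphB normcR.
  rewrite (le_trans (ler_normcB _ _))// mulr_natl mulr2n lerD// pB// leqW//.
have qk := IH q (2 * B / d) sq (fun i ni => xL i (leqW ni)) (fun i j ji ni => xd i j ji (leqW ni)) qB.
have An : 1 <= A ^+ n by rewrite exprn_ege1.
have cB : normc c <= B by exact: pB.
have aL : normc a <= L by rewrite normcR xL.
(* Expanding p = (X - a) q + c gives the bound B + (1 + L) (2B/d) A^n = B + B (A - 1) A^n, which is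
   at most B A^(n+1) because A^n >= 1. *)
have coefE : p`_k = (c *+ (k == 0%N)) + ((if k is k'.+1 then q`_k' else 0) - a * q`_k).
  have : p = q * ('X - a%:P) + c%:P by rewrite -pq subrK.
  move=> ->; rewrite coefD coefC mulrBr coefB coefMX coefMC [q`_k * a]mulrC.
  by case: k => [|k] /=; rewrite ?mulr1n ?mulr0n addrC.
have C0 : 0 <= 2 * B / d * A ^+ n by rewrite mulr_ge0 ?divr_ge0 ?mulr_ge0 ?(ltW d0)// ltW// (lt_le_trans ltr01).
have h1 : normc (c *+ (k == 0%N)) <= B by case: (k == 0%N); rewrite ?mulr1n ?mulr0n ?normc0.
have h2 : normc (if k is k'.+1 then q`_k' else 0) <= 2 * B / d * A ^+ n.
  by case: (k) => [|k']; rewrite ?normc0.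
have h3 : normc (a * q`_k) <= L * (2 * B / d * A ^+ n).
  by rewrite normcM ler_pM ?normc_ge0.
rewrite coefE (le_trans (ler_normcD _ _))// (le_trans (lerD h1 (ler_normcB _ _)))//.
rewrite (le_trans (lerD (lexx _) (lerD h2 h3)))//.
have -> : B + (2 * B / d * A ^+ n + L * (2 * B / d * A ^+ n)) = B + B * (A - 1) * A ^+ n.
  by rewrite /A; move: (_^-1) => u; ring.
rewrite exprS; have := ler_wpM2l B0 An; lra.
Qed.

(** * The complexified polynomial: bounds away from the real plane *)

Section Bivariate.
Variables (n : nat) (P : nat -> {poly R[i]}) (M : R).

(* Complexification of [F]: the value of [F] at [z] is [bieval z (conj z)]. *)
Definition bieval (u v : R[i]) := \sum_(k < n.+1) (P k).[u] * v ^+ k.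

Hypothesis PM : forall z : R[i], normc z < 4 -> normc (bieval z z^*%C) <= M.

Definition scale_poly (p : {poly R[i]}) (a : R[i]) := \poly_(j < size p) (p`_j * a ^+ j).

Lemma horner_scale p a x : (scale_poly p a).[x] = p.[a * x].
Proof.
by rewrite horner_poly horner_coef; apply: eq_bigr => j _; rewrite exprMn mulrA.
Qed.

Lemma coef_scale p a j : (scale_poly p a)`_j = p`_j * a ^+ j.
Proof. by rewrite coef_poly; case: ltnP => // h; rewrite nth_default// mul0r. Qed.

(* On the circle of radius [t], [conj z = t^2 / z], so that [z^n] times the
   polyanalytic polynomial restricts to a polynomial in [z]. *)
Definition circle_poly (t : R) : {poly R[i]} :=
  \sum_(k < n.+1) (t%:C ^+ k) *: (scale_poly (P k) t%:C * 'X^(n - k)).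

(** On a circle, z^j conj(z)^k has frequency j - k. After the shift by [n], frequency [i] picks from
    [P k] the coefficient of index j = i - (n - k). *)
Definition radial_coef (i k : nat) : R[i] := if (n - k <= i)%N then (P k)`_(i - (n - k)) else 0.

Lemma circle_poly_bound (t s : R) : 0 < t < 4 -> normc (circle_poly t).[expi s] <= M.
Proof.
move=> /andP[t0 t4].
have -> : (circle_poly t).[expi s] = expi s ^+ n * bieval (t%:C * expi s) (t%:C * expi s)^*%C.
  rewrite /circle_poly horner_sum /bieval mulr_sumr; apply: eq_bigr => k _.
  rewrite hornerZ hornerM horner_scale hornerXn conjcM conjcR expi_conj exprMn exprVn.
  have e0 := expi_neq0 s.
  by rewrite expfB_cond ?(negbTE e0)// -1?ltnS ?ltn_ord//; ring.
rewrite normcM normcX normc_expi expr1n mul1r PM//.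
by rewrite normcM normcR normc_expi mulr1 gtr0_norm.
Qed.

(** The monomial of indices j, k has modulus t^(j + k) = t^(i - n) (t^2)^k on the circle when its
    shifted frequency is i = j + n - k. The factor t^n stands on the left to avoid a negative
    exponent. *)
Lemma circle_poly_coef (t : R) i : t%:C ^+ n * (circle_poly t)`_i =
  t%:C ^+ i * (\poly_(k < n.+1) radial_coef i k).[(t ^+ 2)%:C].
Proof.
rewrite /circle_poly coef_sum horner_poly !mulr_sumr; apply: eq_bigr => k _.
rewrite coefZ coefMXn /radial_coef ltnNge; case: leqP => /= h; last by rewrite mulr0 mul0r !mulr0.
rewrite coef_scale rmorphXn /= -exprM.
have kn : (k <= n)%N by rewrite -ltnS.
transitivity ((P k)`_(i - (n - k)) * t%:C ^+ (n + k + (i - (n - k)))).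
  by rewrite !exprD; ring.
have -> : (n + k + (i - (n - k)) = i + 2 * k)%N.
  apply/eqP; rewrite -(eqn_add2r (n - k)) -addnA subnK// mul2n -addnn.
  by rewrite -!addnA subnKC// addnA addnC (addnC k n).
by rewrite exprD; ring.
Qed.

(** Radii below 4 give the factor 4^n, and radii at least 3 give the decay 3^-i, which makes the
    series in u converge at modulus 27/10. *)
Lemma radial_bound (t : R) i : 3 <= t < 4 ->
  normc (\poly_(k < n.+1) radial_coef i k).[(t ^+ 2)%:C] <= 2 * M * 4 ^+ n / 3 ^+ i.
Proof.
move=> /andP[t3 t4]; have t0 : 0 < t by lra.
have t04 : 0 < t < 4 by rewrite t0.
have := cauchy_coef i (fun s => circle_poly_bound s t04).
set c := normc _ => hc; pose q := (\poly_(k < n.+1) radial_coef i k).[(t ^+ 2)%:C]; rewrite -/q.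
have E : t ^+ n * c = t ^+ i * normc q.
  have := congr1 (fun x => normc x) (circle_poly_coef t i).
  by rewrite !normcM !normcX normcR gtr0_norm.
have c0 : 0 <= c := normc_ge0 _.
have tn : t ^+ n <= 4 ^+ n by rewrite lerXn2r ?nnegrE ?(ltW t0)// ltW.
have ti : 3 ^+ i <= t ^+ i by rewrite lerXn2r ?nnegrE ?(ltW t0).
rewrite ler_pdivlMr ?exprn_gt0// mulrC (@le_trans _ _ (t ^+ i * normc q))//.
  by rewrite ler_wpM2r ?normc_ge0.
by rewrite -E mulrC ler_pM// exprn_ge0// ltW.
Qed.

Lemma coef_bound k j : (k <= n)%N ->
  normc (P k)`_j <= 2 * M * (24 * n.+1%:R) ^+ n / 3 ^+ j.
Proof.
move=> kn; set i := (j + (n - k))%N.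
have -> : (P k)`_j = (\poly_(k < n.+1) radial_coef i k)`_k.
  by rewrite coef_poly ltnS kn /radial_coef /i leq_addl addnK.
have n0 : 0 < n.+1%:R :> R by rewrite ltr0n.
(* Interpolation takes place in the variable t^2, so the n + 1 nodes are equally spaced in [9, 16[,
   with step 7 / (n + 1); the radii are their square roots, in [3, 4[. *)
pose x m : R := 9 + 7 * m%:R / n.+1%:R.
have x3 m : (m <= n)%N -> 9 <= x m < 16.
  move=> mn; rewrite /x lerDl divr_ge0 ?mulr_ge0//=.
  have : 7 * m%:R / n.+1%:R < 7 :> R by rewrite ltr_pdivrMr// ltr_pM2l// ltr_nat ltnS.
  move: (_ / _) => u hu; lra.
have M0 : 0 <= M by apply: le_trans (PM (_ : normc 0 < 4)); rewrite ?normc_ge0// normc0.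
have B0 : 0 <= 2 * M * 4 ^+ n / 3 ^+ i by rewrite divr_ge0 ?mulr_ge0 ?exprn_ge0.
have d0 : 0 < 7 / n.+1%:R :> R by rewrite divr_gt0.
have xL m : (m <= n)%N -> `|x m| <= 16.
  by move=> /x3 /andP[h1 h2]; rewrite ger0_norm ?(ltW h2)// (le_trans _ h1).
have xd m l : (l < m)%N -> (m <= n)%N -> 7 / n.+1%:R <= `|x l - x m|.
  move=> lm mn; rewrite /x.
  have h : 7 / n.+1%:R <= 7 * (m%:R - l%:R) / n.+1%:R :> R.
    by rewrite ler_pM2r ?invr_gt0// ler_peMr// -natrB 1?ltnW// ler1n subn_gt0.
  rewrite (_ : 9 + 7 * l%:R / n.+1%:R - _ = - (7 * (m%:R - l%:R) / n.+1%:R)); last by ring.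
  by rewrite normrN (le_trans h)// ler_norm.
have xB m : (m <= n)%N -> normc (\poly_(k < n.+1) radial_coef i k).[(x m)%:C] <= 2 * M * 4 ^+ n / 3 ^+ i.
  move=> /x3 /andP[h1 h2].
  have sx : Num.sqrt (x m) ^+ 2 = x m by rewrite sqr_sqrtr// (le_trans _ h1).
  have s3 : Num.sqrt (3 ^+ 2) = 3 :> R by rewrite sqrtr_sqr ger0_norm.
  have s4 : Num.sqrt (4 ^+ 2) = 4 :> R by rewrite sqrtr_sqr ger0_norm.
  rewrite -sx radial_bound// -[X in X <= _]s3 -[X in _ < X]s4 ler_wsqrtr ?ltr_sqrt//=; first by rewrite (lt_le_trans h2)//; lra.
  by rewrite (le_trans _ h1)//; lra.
have ls16 : 0 <= 16 :> R by [].
apply: le_trans (interpolation_coef (size_poly _ _) d0 ls16 xL xd xB k) _.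
(* With L = 16 and d = 7 / (n + 1) the interpolation factor is 1 + (34/7) (n + 1), at most 6 (n +
   1); together with 4^n this gives the 24. *)
have A6 : 1 + (1 + 16) * (2 / (7 / n.+1%:R)) <= 6 * n.+1%:R :> R.
  rewrite (_ : (1 + 16) * _ = 34 / 7 * n.+1%:R); last by field; rewrite gt_eqF.
  have : 1 <= n.+1%:R :> R by rewrite ler1n.
  lra.
have A0 : 0 <= 1 + (1 + 16) * (2 / (7 / n.+1%:R)) :> R.
  by rewrite addr_ge0// mulr_ge0// ?addr_ge0// divr_ge0// divr_ge0// ltW.
have An : (1 + (1 + 16) * (2 / (7 / n.+1%:R))) ^+ n <= (6 * n.+1%:R) ^+ n :> R.
  by rewrite lerXn2r ?nnegrE// (le_trans A0).
apply: le_trans (ler_wpM2l B0 An) _.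
rewrite (_ : 24 * n.+1%:R = 4 * (6 * n.+1%:R)); last by ring.
rewrite [(4 * _) ^+ n]exprMn; have N0 : 0 <= (6 * n.+1%:R) ^+ n :> R by rewrite exprn_ge0.
have h3 : (3 ^+ i)^-1 <= (3 ^+ j)^-1 :> R.
  rewrite lef_pV2 ?posrE ?exprn_gt0// ler_eXn2l ?leq_addr// ltr1n//.
have C0 : 0 <= 2 * M * (4 ^+ n * (6 * n.+1%:R) ^+ n) by rewrite !mulr_ge0 ?exprn_ge0.
apply: le_trans (ler_wpM2l C0 h3); rewrite le_eqVlt; apply/orP; left; apply/eqP.
by move: (6 * _) (_^-1) => u v; ring.
Qed.

Lemma geometric_sum_le (N : nat) : \sum_(j < N) (9 / 10 : R) ^+ j <= 10.
Proof.
have -> : \sum_(j < N) (9 / 10 : R) ^+ j = 10 * (1 - (9 / 10) ^+ N).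
  elim: N => [|N IH]; first by rewrite big_ord0 expr0 subrr mulr0.
  by rewrite big_ord_recr /= IH exprS; field.
have : 0 <= (9 / 10 : R) ^+ N by rewrite exprn_ge0// divr_ge0.
lra.
Qed.

(** Here 20 is the 2 of [cauchy_coef] times the sum 10 of the geometric series of ratio (27/10) / 3;
    n + 1 counts the powers of v, and 72 = 3 * 24 because |v|^k <= 3^n. *)
Lemma bieval_bound u v : normc u <= 27 / 10 -> normc v <= 27 / 10 ->
  normc (bieval u v) <= 20 * n.+1%:R * (72 * n.+1%:R) ^+ n * M.
Proof.
move=> hu hv.
have M0 : 0 <= M by apply: le_trans (PM (_ : normc 0 < 4)); rewrite ?normc_ge0// normc0.
pose C := 2 * M * (24 * n.+1%:R) ^+ n.
have C0 : 0 <= C by rewrite !mulr_ge0 ?exprn_ge0.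
have hk (k : nat) : (k <= n)%N -> normc ((P k).[u] * v ^+ k) <= C * 10 * 3 ^+ n.
  move=> kn; rewrite normcM normcX ler_pM ?normc_ge0 ?exprn_ge0 ?normc_ge0//; last first.
    rewrite (@le_trans _ _ (3 ^+ k))//; last by rewrite ler_weXn2l// ler1n.
    by rewrite lerXn2r ?nnegrE ?normc_ge0//; lra.
  rewrite horner_coef (le_trans (normc_sum _ _ _))//.
  apply: le_trans (ler_wpM2l C0 (geometric_sum_le (size (P k)))).
  rewrite mulr_sumr; apply: ler_sum => j _; rewrite normcM normcX.
  have h1 := coef_bound j kn; rewrite -/C in h1.
  have h2 : normc u ^+ j <= (27 / 10) ^+ j by rewrite lerXn2r ?nnegrE ?normc_ge0// divr_ge0.
  rewrite (le_trans (ler_pM _ _ h1 h2)) ?exprn_ge0 ?normc_ge0// -mulrA ler_wpM2l//.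
  have -> : (9 / 10 : R) = 27 / 10 / 3 by field.
  by rewrite [leRHS]expr_div_n mulrC.
rewrite /bieval (le_trans (normc_sum _ _ _))//.
apply: le_trans (_ : \sum_(k < n.+1) C * 10 * 3 ^+ n <= _).
  by apply: ler_sum => k _; apply: hk; rewrite -ltnS.
rewrite sumr_const card_ord -mulr_natr /C.
rewrite (_ : 72 * n.+1%:R = 3 * (24 * n.+1%:R)); last by ring.
by rewrite [(3 * _) ^+ n]exprMn le_eqVlt; apply/orP; left; apply/eqP; move: ((24 * _) ^+ n) => w; ring.
Qed.

End Bivariate.
End Coefficients.

(** * Plurisubharmonicity of log |f| *)

Section Logarithm.
Context {R : realType}.

Lemma rdiff_real_comp (F : R[i] -> R[i]) (z X Y : R[i]) (f : R -> R) d :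
  rdiff F z X Y -> is_derive (complex.Re (F z)) (1 : R) f d ->
  rdiff (fun w => (f (complex.Re (F w)))%:C) z (d * complex.Re X)%:C (d * complex.Re Y)%:C.
Proof.
move=> dF df e e0; set K := normc X + normc Y + 1.
have K0 : 0 < K by rewrite /K; have := normc_ge0 X; have := normc_ge0 Y; lra.
have e10 : 0 < e / 2 / K by rewrite !divr_gt0.
have d0 : 0 < `|d| + 1 by rewrite ltr_wpDl.
have e20 : 0 < e / 2 / (`|d| + 1) by rewrite !divr_gt0.
have [u u0 hu] := derive_expand df e10.
have := near0I (near0I (rdiff_lip dF) (rdiff_cont dF u0)) (dF _ e20).
move=> h; apply: (near0S h) => {}h [[h1 h2] h3].
set k := complex.Re (F (z + h) - F z).
have kn : `|k| <= normc (F (z + h) - F z) := ler_Re_normc _.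
have := hu k (le_lt_trans kn h2).
have -> : complex.Re (F z) + k = complex.Re (F (z + h)) by rewrite /k Re_add Re_opp addrC subrK.
move=> H1.
have H2 : `|k - complex.Re (rlinear X Y h)| <= e / 2 / (`|d| + 1) * normc h.
  by apply: le_trans h3; rewrite /k -Re_opp -Re_add; exact: ler_Re_normc.
have linE : rlinear (d * complex.Re X)%:C (d * complex.Re Y)%:C h = (d * complex.Re (rlinear X Y h))%:C.
  by rewrite /rlinear Re_add !Re_mul /=; apply: complex_ext; rewrite ?(Re_add, Im_add, Re_mul, Im_mul) /=; ring.
rewrite linE -!rmorphB normcR.
set fw := f _; set fz := f _.
rewrite (_ : fw - fz - d * complex.Re (rlinear X Y h) =
  (fw - fz - k * d) + d * (k - complex.Re (rlinear X Y h))); last by ring.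
rewrite (le_trans (ler_normD _ _))// normrM.
have nh := normc_ge0 h.
have H3 : `|fw - fz - k * d| <= e / 2 * normc h.
  rewrite (le_trans H1)// (le_trans (ler_wpM2l (ltW e10) (le_trans kn h1)))//.
  by rewrite -/K mulrA mulfVK// gt_eqF.
have H4 : `|d| * `|k - complex.Re (rlinear X Y h)| <= e / 2 * normc h.
  rewrite (le_trans (ler_wpM2l (normr_ge0 d) H2))// mulrA ler_wpM2r//.
  rewrite mulrCA ler_piMr ?divr_ge0 ?(ltW e0)// ler_pdivrMr// mul1r lerDl//.
by lra.
Qed.

Lemma rdiff_Im (z : R[i]) : rdiff (fun w => (complex.Im w)%:C) z 0 1.
Proof.
have := @rdiff_rlinear R 0 0 1 z; apply: eq_rdiff; exists 1 => // h _.
by rewrite /rlinear; ring.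
Qed.

(** The principal logarithm on the right half-plane, where atan(y / x) is the argument. *)
Definition clog (w : R[i]) : R[i] :=
  (ln (complex.Re w ^+ 2 + complex.Im w ^+ 2) / 2)%:C +
  'i * (atan (complex.Im w / complex.Re w))%:C.

Lemma Re_clog w : 0 < complex.Re w -> complex.Re (clog w) = ln (normc w).
Proof.
case: w => x y x0; rewrite /clog Re_add Re_mul /= mul0r mul1r subr0 addr0.
have n0 : 0 < x ^+ 2 + y ^+ 2 by rewrite ltr_pwDl ?exprn_gt0 ?sqr_ge0.
set n := _ + _ in n0 *; rewrite -[in LHS](sqr_sqrtr (ltW n0)).
by rewrite lnXn ?sqrtr_gt0//= -mulr_natr; field.
Qed.

Lemma clog1 : clog 1 = 0.
Proof.
by rewrite /clog /= expr1n expr0n /= addr0 ln1 mul0r mul0r atan0 mulr0 addr0.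
Qed.

Lemma complexRV (y : R) : (y%:C)^-1 = (y^-1)%:C.
Proof. by rewrite fmorphV. Qed.

Lemma cauchy_riemann (F : R[i] -> R[i]) z X Y : rdiff F z X Y -> Y = 'i * X ->
  exists l, cdiff F z l.
Proof. by move=> dF YX; exists X; rewrite /cdiff -YX. Qed.

Lemma rdiff_eq (F : R[i] -> R[i]) z X Y X' Y' : rdiff F z X Y -> X = X' -> Y = Y' ->
  rdiff F z X' Y'.
Proof. by move=> dF <- <-. Qed.

Lemma clog_cdiff w : 0 < complex.Re w -> exists l, cdiff clog w l.
Proof.
move=> x0; set x := complex.Re w in x0; set y := complex.Im w.
have xn0 : x != 0 by rewrite gt_eqF.
have xC0 : x%:C != 0 by rewrite -normc_gt0 normcR normr_gt0.
have n0 : 0 < x ^+ 2 + y ^+ 2 by rewrite ltr_pwDl ?exprn_gt0 ?sqr_ge0.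
have d1 : rdiff (fun w => (complex.Re w)%:C * (complex.Re w)%:C + (complex.Im w)%:C * (complex.Im w)%:C)
    w (2 * x)%:C (2 * y)%:C.
  apply: (rdiff_eq (rdiffD (rdiffM (rdiff_Re w) (rdiff_Re w)) (rdiffM (rdiff_Im w) (rdiff_Im w)))).
    by rewrite rmorphM rmorph_nat -/x; ring.
  by rewrite rmorphM rmorph_nat -/y; ring.
have nE (a b : R) : complex.Re (a%:C * a%:C + b%:C * b%:C) = a ^+ 2 + b ^+ 2.
  by rewrite -!rmorphM -rmorphD.
have p1 : 0 < complex.Re (x%:C * x%:C + y%:C * y%:C) by rewrite nE.
have d2 := rdiff_real_comp d1 (is_derive1_ln p1); rewrite -/x -/y nE /= in d2.
have d3 : rdiff (fun w => (complex.Im w)%:C / (complex.Re w)%:C) w (- y / x ^+ 2)%:C (x^-1)%:C.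
  apply: (rdiff_eq (rdiffM (rdiff_Im w) (rdiff_comp (rdiff_Re w) (cdiffV xC0)))).
    by rewrite mul0r add0r mulr1 rmorphM rmorphN fmorphV rmorphXn /=; move: (_^-1) => u; ring.
  by rewrite mulr0 mulr0 addr0 mul1r complexRV.
have qE (a b : R) : complex.Re (a%:C / b%:C) = a / b by rewrite complexRV -rmorphM.
have d4 := rdiff_real_comp d3 (is_derive1_atan _); rewrite -/x -/y qE /= in d4.
have d5 := rdiffD (rdiffM d2 (rdiff_cst (2^-1 : R)%:C w)) (rdiffM (rdiff_cst 'i w) d4).
have E : (fun w0 : R[i] => (ln (complex.Re ((complex.Re w0)%:C * (complex.Re w0)%:C + (complex.Im w0)%:C * (complex.Im w0)%:C)))%:C * (2^-1)%:C + 'i * (atan (complex.Re ((complex.Im w0)%:C / (complex.Re w0)%:C)))%:C) = clog.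
  apply/funext => v; by rewrite /clog nE qE rmorphM.
rewrite E in d5; apply: (cauchy_riemann d5).
have n1 : x ^+ 2 + y ^+ 2 != 0 by rewrite gt_eqF.
have n2 : 1 + (y / x) ^+ 2 != 0 by rewrite gt_eqF// ltr_wpDr ?sqr_ge0.
apply: complex_ext; rewrite !(Re_add, Im_add, Re_mul, Im_mul) /=; field; rewrite xn0 n1 //.
Qed.

End Logarithm.

(** * Subharmonicity of the truncated logarithm of a modulus *)

Section Subharmonic.
Context {R : realType}.
Notation C2 := (R[i] * R[i])%type.

Let pi2_ge0 : 0 <= 2 * pi :> R. Proof. by rewrite mulr_ge0// pi_ge0. Qed.

Lemma integral_seg_EFin (f : R -> R) a b : integrable_seg f a b ->
  (\int[@lebesgue_measure R]_(t in `[a, b]) (f t)%:E)%E = (integral_seg f a b)%:E.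
Proof. by move=> h; rewrite /integral_seg /Rintegral fineK//; exact: integrable_fin_num. Qed.

Lemma le_integral_seg (f g : R -> R) a b : integrable_seg f a b -> integrable_seg g a b ->
  (forall t, f t <= g t) -> integral_seg f a b <= integral_seg g a b.
Proof. by move=> hf hg fg; apply: le_Rintegral. Qed.

Lemma circle_ccont (f : R[i] -> R[i]) z (r : R) t l : cdiff f (z + r%:C * expi t) l ->
  ccont (fun t => f (z + r%:C * expi t)) t.
Proof.
move=> dl; apply: (@circle_cont R (fun w => f (z + w)) r t (l * (0 + 1))).
exact: (cdiff_comp (cdiffD (cdiff_cst z _) (cdiff_id _)) dl).
Qed.

(** The mean value property holds with equality. It serves for the test function of
    [brudnyi_constant_gt1]. *)
Lemma Re_subharmonic (f : R[i] -> R[i]) (c : R) : (forall z, exists l, cdiff f z l) ->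
  subharmonic (fun z => complex.Re (f z) + c).
Proof.
move=> df; split.
  move=> z a; rewrite -subr_gt0 => h; have [l /rdiff_cont dl] := df z.
  have [d d0 hd] := dl _ h; exists d => // w /hd; rewrite subrKC => h1.
  have := le_lt_trans (ler_Re_normc _) h1; rewrite Re_add Re_opp ltr_norml; lra.
move=> z; exists 1 => // r r0 _.
have [|c1 c2] := @mean_value_at R f z r r0; first by move=> w _; exact: df.
have cI : integrable_seg (fun t => complex.Re (f (z + r%:C * expi t)) + c) 0 (2 * pi).
  exact: integrable_segD (proj1 c1) (integrable_seg_cst _ _ _).
rewrite (integral_seg_EFin cI) lee_fin integral_segD ?integral_seg_cst//; [|exact: (proj1 c1)|exact: integrable_seg_cst].
have -> : integral_seg (fun x => complex.Re (f (z + r%:C * expi x))) 0 (2 * pi) = 2 * pi * complex.Re (f z).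
  by rewrite -[LHS]/(complex.Re (cintegral (fun t => f (z + r%:C * expi t)) 0 (2 * pi))) c2 Re_mul /= mul0r subr0.
by rewrite subr0 le_eqVlt; apply/orP; left; apply/eqP; ring.
Qed.

Definition logmax (d : R) (z : R[i]) : R := ln (Num.max (normc z) d).

Lemma logmax_cont (d : R) (f : R -> R[i]) t : 0 < d -> ccont f t ->
  {for t, continuous (fun t => logmax d (f t))}.
Proof.
move=> d0 cf.
have cn : {for t, continuous (fun t => Num.max (normc (f t)) d)}.
  apply/cvgrPdist_lt => e e0; have [u u0 H] := cf e e0.
  apply/nbhs_normP; exists u => //= y; rewrite /ball_ /= distrC => /H h.
  have := ler_dist_normc (f y) (f t) => h1; have h2 := le_lt_trans h1 h.
  move: h2; rewrite !ltr_norml => /andP[h2 h3].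
  by case: (leP (normc (f t)) d) => ?; case: (leP (normc (f y)) d) => ?; lra.
apply: (@continuous_comp _ _ _ (fun t => Num.max (normc (f t)) d) (@ln R)) => //.
by apply: continuous_ln; rewrite lt_max d0 orbT.
Qed.

(** Around each centre there is a minorant whose mean is the value at the centre: the constant ln d
    where |f z| <= d, and the harmonic function ln |f|, obtained from a local holomorphic logarithm,
    where |f z| > d. *)
Lemma logmax_subharmonic (f : R[i] -> R[i]) (d k c : R) : 0 < d -> 0 < k ->
  (forall z, exists l, cdiff f z l) ->
  subharmonic (fun z => k * (logmax d (f z) - c)).
Proof.
move=> d0 k0 df; split.
  move=> z a h; pose b := expR (a / k + c).
  have bE w : (k * (logmax d w - c) < a) = (normc w < b) && (d < b).
    have m0 : 0 < Num.max (normc w) d by rewrite lt_max d0 orbT.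
    rewrite mulrC -ltr_pdivlMr// ltrBlDr /b -gt_max -ltr_expR lnK//.
  move: h; rewrite bE => /andP[zb db]; have [l /rdiff_cont dl] := df z.
  have [|e e0 he] := dl (b - normc (f z)); first by rewrite subr_gt0.
  exists e => // w /he; rewrite subrKC bE db andbT => h1.
  by have := ler_normc_sub (f w) (f z); lra.
have gen z r (L : R -> R) : 0 < r -> integrable_seg L 0 (2 * pi) -> integral_seg L 0 (2 * pi) = 2 * pi * logmax d (f z) ->
    (forall t, L t <= logmax d (f (z + r%:C * expi t))) ->
    ((2 * pi * (k * (logmax d (f z) - c)))%:E <= \int[@lebesgue_measure R]_(t in `[0%R, (2 * pi)%R])
       (k * (logmax d (f (z + r%:C * expi t)) - c))%:E)%E.
  move=> r0 hL iL H.
  have ci : integrable_seg (fun t => logmax d (f (z + r%:C * expi t))) 0 (2 * pi).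
    apply: continuous_integrable_seg => t _; apply: logmax_cont => //.
    by have [l dl] := df (z + r%:C * expi t); exact: circle_ccont dl.
  have ci2 : integrable_seg (fun t => logmax d (f (z + r%:C * expi t)) - c) 0 (2 * pi).
    exact: integrable_segD ci (integrable_seg_cst _ _ _).
  rewrite (integral_seg_EFin (integrable_segZ k ci2)) lee_fin integral_segZ// integral_segD//; last exact: integrable_seg_cst.
  rewrite integral_seg_cst// subr0 mulrCA ler_pM2l// mulrBr mulNr [c * _]mulrC lerD2r -iL.
  exact: le_integral_seg.
move=> z; have [zd|dz] := leP (normc (f z)) d.
  exists 1 => // r r0 _; apply: (gen z r (fun=> ln d)) => //; first exact: integrable_seg_cst.
    by rewrite integral_seg_cst// /logmax max_r// subr0 mulrC.
  move=> t; rewrite /logmax ler_ln ?posrE// ?le_max ?lexx ?orbT//.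
  by rewrite lt_max d0 orbT.
have fz0 : f z != 0 by rewrite -normc_gt0 (lt_trans d0).
have nf0 : 0 < normc (f z) by rewrite normc_gt0.
have [l0 /rdiff_cont dl0] := df z; have [e e0 he] := dl0 _ nf0.
exists (e / 2); first by rewrite divr_gt0.
move=> r r0 re.
(* On so small a circle f(w) / f(z) stays within distance 1 of 1, hence in the half-plane where
   [clog] is holomorphic. *)
have Rep w : normc (w - z) <= r -> 0 < complex.Re (f w / f z).
  move=> wr; have := he (w - z); rewrite subrKC => H.
  have {}H : normc (f w - f z) < normc (f z) by apply: H; lra.
  have -> : f w / f z = 1 + (f w - f z) / f z by rewrite mulrBl divff// addrC subrK.
  have h1 : normc ((f w - f z) / f z) < 1 by rewrite normcM normcV ltr_pdivrMr// mul1r.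
  have := le_lt_trans (ler_Re_normc _) h1; rewrite ltr_norml Re_add /=; lra.
pose G w := clog (f w / f z).
have dG w : normc (w - z) <= r -> exists l, cdiff G w l.
  move=> wr; have [l dl] := df w; have [l' dl'] := clog_cdiff (Rep w wr).
  eexists; exact: (cdiff_comp (cdiffM dl (cdiff_cst (f z)^-1 w)) dl').
have [c1 c2] := mean_value_at r0 dG.
have Gz : G z = 0 by rewrite /G divff// clog1.
have onc t : normc (z + r%:C * expi t - z) <= r.
  by rewrite addrC addKr normcM normcR normc_expi mulr1 gtr0_norm.
apply: (gen z r (fun t => complex.Re (G (z + r%:C * expi t)) + ln (normc (f z)))) => //.
- exact: integrable_segD (proj1 c1) (integrable_seg_cst _ _ _).
- rewrite integral_segD ?integral_seg_cst//; [|exact: (proj1 c1)|exact: integrable_seg_cst].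
  have -> : integral_seg (fun x => complex.Re (G (z + r%:C * expi x))) 0 (2 * pi) = 0.
    by rewrite -[LHS]/(complex.Re (cintegral (fun t => G (z + r%:C * expi t)) 0 (2 * pi))) c2 Gz mulr0.
  by rewrite add0r subr0 mulrC /logmax max_l// ltW.
- move=> t; have h := Rep _ (onc t).
  have q0 : 0 < normc (f (z + r%:C * expi t) / f z).
    by apply: lt_le_trans h _; rewrite (le_trans (ler_norm _))// ler_Re_normc.
  have w0 : 0 < normc (f (z + r%:C * expi t)).
    by move: q0; rewrite normcM normcV pmulr_lgt0// invr_gt0.
  rewrite Re_clog// normcM normcV ln_div ?posrE// subrK /logmax ler_ln ?posrE//.
    by rewrite le_max lexx.
  by rewrite lt_max d0 orbT.
Qed.

Definition continuous_C2 (P : C2 -> R[i]) := forall z e, 0 < e ->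
  exists2 d : R, 0 < d & forall w, ball_C z d w -> normc (P w - P z) < e.

Lemma logmax_psh (P : C2 -> R[i]) (d k c : R) : 0 < d -> 0 < k -> continuous_C2 P ->
  (forall a b : C2, forall z, exists l, cdiff (fun z => P (a.1 + z * b.1, a.2 + z * b.2)) z l) ->
  plurisubharmonic (fun z => k * (logmax d (P z) - c)).
Proof.
move=> d0 k0 cP dP; split; last first.
  by move=> a b; apply: (@logmax_subharmonic (fun z => P (a.1 + z * b.1, a.2 + z * b.2))).
move=> z a h; pose b := expR (a / k + c).
have bE w : (k * (logmax d w - c) < a) = (normc w < b) && (d < b).
  have m0 : 0 < Num.max (normc w) d by rewrite lt_max d0 orbT.
  rewrite mulrC -ltr_pdivlMr// ltrBlDr /b -gt_max -ltr_expR lnK//.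
move: h; rewrite bE => /andP[zb db].
have [|e e0 he] := cP z (b - normc (P z)); first by rewrite subr_gt0.
exists e => // w /he; rewrite bE db andbT => h1.
by have := ler_normc_sub (P w) (P z); lra.
Qed.

Lemma continuous_C2_D P Q : continuous_C2 P -> continuous_C2 Q -> continuous_C2 (fun z => P z + Q z).
Proof.
move=> cP cQ z e e0; have e2 : 0 < e / 2 by rewrite divr_gt0.
have [d d0 hd] := cP z _ e2; have [d' d'0 hd'] := cQ z _ e2.
exists (Num.min d d'); first by rewrite lt_min d0.
move=> w; rewrite /ball_C /= lt_min => /andP[h1 h2].
rewrite (_ : _ - _ = (P w - P z) + (Q w - Q z)); last by ring.
by rewrite (le_lt_trans (ler_normcD _ _))//; have := hd w h1; have := hd' w h2; lra.
Qed.

Lemma continuous_C2_M P Q : continuous_C2 P -> continuous_C2 Q -> continuous_C2 (fun z => P z * Q z).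
Proof.
move=> cP cQ z e e0.
have nP := normc_ge0 (P z); have nQ := normc_ge0 (Q z).
set K := normc (P z) + normc (Q z) + 1; have K0 : 0 < K by rewrite /K; lra.
pose e1 := Num.min 1 (e / (2 * K)).
have e10 : 0 < e1 by rewrite lt_min ltr01 divr_gt0// mulr_gt0.
have e11 : e1 <= 1 by rewrite ge_min lexx.
have e12 : e1 * K <= e / 2.
  have : e1 <= e / (2 * K) by rewrite ge_min lexx orbT.
  by rewrite invfM mulrA ler_pdivlMr.
have [d d0 hd] := cP z _ e10; have [d' d'0 hd'] := cQ z _ e10.
exists (Num.min d d'); first by rewrite lt_min d0.
move=> w; rewrite /ball_C /= lt_min => /andP[h1 h2].
have {}h1 := hd w h1; have {}h2 := hd' w h2.
rewrite (_ : _ - _ = (P w - P z) * (Q w - Q z) + P z * (Q w - Q z) + (P w - P z) * Q z); last by ring.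
rewrite (le_lt_trans (ler_normcD _ _))// (le_lt_trans (lerD (ler_normcD _ _) (lexx _)))// !normcM.
have H1 : normc (P w - P z) * normc (Q w - Q z) <= e1 * 1.
  by rewrite ler_pM ?normc_ge0// ltW// (lt_le_trans h2).
have H2 : normc (P z) * normc (Q w - Q z) <= normc (P z) * e1 by rewrite ler_wpM2l// ltW.
have H3 : normc (P w - P z) * normc (Q z) <= e1 * normc (Q z) by rewrite ler_wpM2r// ltW.
have e2 : e / 2 < e by lra.
have EK : e1 * K = e1 * 1 + normc (P z) * e1 + e1 * normc (Q z) by rewrite /K; ring.
lra.
Qed.

Lemma continuous_C2_cst c : continuous_C2 (fun=> c).
Proof. by move=> z e e0; exists 1 => // w _; rewrite subrr normc0. Qed.

Lemma norm2_ge (z : C2) : normc z.1 <= norm2 z /\ normc z.2 <= norm2 z.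
Proof.
rewrite /norm2; split.
  by rewrite -[leLHS](ger0_norm (normc_ge0 _)) -sqrtr_sqr ler_wsqrtr// lerDl sqr_ge0.
by rewrite -[leLHS](ger0_norm (normc_ge0 _)) -sqrtr_sqr ler_wsqrtr// lerDr sqr_ge0.
Qed.

Lemma continuous_C2_fst : continuous_C2 (fun z => z.1).
Proof.
move=> z e e0; exists e => // w; rewrite /ball_C /=; apply: le_lt_trans.
by have [] := norm2_ge (w.1 - z.1, w.2 - z.2).
Qed.

Lemma continuous_C2_snd : continuous_C2 (fun z => z.2).
Proof.
move=> z e e0; exists e => // w; rewrite /ball_C /=; apply: le_lt_trans.
by have [] := norm2_ge (w.1 - z.1, w.2 - z.2).
Qed.

Lemma continuous_C2_sum n (P : nat -> C2 -> R[i]) : (forall k, continuous_C2 (P k)) ->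
  continuous_C2 (fun z => \sum_(k < n) P k z).
Proof.
move=> cP; elim: n => [|n IH].
  have -> : (fun z => \sum_(k < 0) P k z) = fun=> 0 by apply/funext => z; rewrite big_ord0.
  exact: continuous_C2_cst.
have -> : (fun z => \sum_(k < n.+1) P k z) = fun z => (\sum_(k < n) P k z) + P n z.
  by apply/funext => z; rewrite big_ord_recr.
exact: continuous_C2_D.
Qed.

Lemma continuous_C2_X n P : continuous_C2 P -> continuous_C2 (fun z => P z ^+ n).
Proof.
move=> cP; elim: n => [|n IH]; first exact: continuous_C2_cst.
have -> : (fun z => P z ^+ n.+1) = fun z => P z * P z ^+ n by apply/funext => z; rewrite exprS.
exact: continuous_C2_M.
Qed.

End Subharmonic.

(** * Plane Lebesgue measure *)

Section Area.
Context {R : realType}.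
Notation TR := (measurableTypeR R).
Notation lam := (@lebesgue_measure R).

(** The pushforward under scaling, multiplied by [s], gives half-open intervals their length;
    Lebesgue measure is determined by these values. *)
Lemma lebesgue_scale (s : R) (A : set R) : 0 < s -> measurable A ->
  lebesgue_measure A = (s%:E * lebesgue_measure ((fun x : R => (s * x)%R) @^-1` A))%E.
Proof.
move=> s0 mA; pose f : TR -> TR := fun x : R => s * x.
have mf : measurable_fun setT f by exact: mulrl_measurable.
pose m0 := measure_function_pushforward__canonical__measure_function_Measure lam mf.
pose m := mscale (NngNum (ltW s0)) m0.
rewrite (@lebesgue_measure_unique R m _ A mA)//.
move=> _ [[a b]] _ <-.
rewrite /m /mscale /= /m0 /= /pushforward.
rewrite [X in (_ = _ * lam X)%E](_ : _ = [set` `]a / s, b / s]]); last first.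
  by apply/seteqP; split => x /=; rewrite !in_itv /= /f ltr_pdivrMr// ler_pdivlMr// mulrC.
rewrite !lebesgue_measure_itv /= !lte_fin ltr_pM2r ?invr_gt0//.
by case: ifP => _; rewrite ?mule0// -!EFinB -EFinM -mulrBl mulrCA mulfV ?mulr1 ?gt_eqF.
Qed.

Lemma borel2X (A B : set R) : measurable A -> measurable B ->
  borel2 (A `*` B) = (lam A * lam B)%E.
Proof. by move=> mA mB; rewrite /borel2 product_measure1E. Qed.

Lemma area2_measurable (A : set (R * R)) : measurable A -> area2 A = borel2 A.
Proof.
by move=> mA; exact: (@measurable_mu_extE _ R (TR * TR)%type (lam \x lam)%E A mA).
Qed.

Lemma le_area2 (A B : set (R * R)) : A `<=` B -> (area2 A <= area2 B)%E.
Proof. by move=> AB; exact: (@le_mu_ext _ (TR * TR)%type R (lam \x lam)%E). Qed.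

Lemma area2_ge0 (A : set (R * R)) : (0 <= area2 A)%E.
Proof. by apply: (@mu_ext_ge0 _ (TR * TR)%type R (lam \x lam)%E). Qed.

Lemma area2_set0 : area2 (set0 : set (R * R)) = 0%E.
Proof. by rewrite area2_measurable// /borel2 measure0. Qed.

Lemma area2_gt0_nonempty (E : set (R * R)) : (0 < area2 E)%E -> E !=set0.
Proof. by move=> E0; apply/set0P/eqP => E00; move: E0; rewrite E00 area2_set0 ltxx. Qed.

Definition scale2 (s : R) (p : R * R) : R * R := (s * p.1, s * p.2).

Lemma measurable_scale2 s (A : set (R * R)) : measurable A -> measurable (scale2 s @^-1` A).
Proof.
move=> mA; rewrite -[X in measurable X]setTI.
have : measurable_fun [set: R * R] (scale2 s).
  apply: measurable_fun_pair; apply: measurableT_comp => //; exact: mulrl_measurable.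
by apply.
Qed.

Lemma borel2_scale (s : R) (A : set (R * R)) : 0 < s -> measurable A ->
  borel2 A = ((s ^+ 2)%:E * borel2 (scale2 s @^-1` A))%E.
Proof.
move=> s0 mA; pose f : TR * TR -> TR * TR := scale2 s.
have mf : measurable_fun setT f.
  apply: measurable_fun_pair; apply: measurableT_comp => //; exact: mulrl_measurable.
pose m0 := measure_function_pushforward__canonical__measure_function_Measure (lam \x lam)%E mf.
pose m := mscale (NngNum (sqr_ge0 s)) m0.
rewrite /borel2 (@product_measure_unique _ _ _ _ _ _ _ m _ A mA)//.
move=> B C mB mC; pose g (x : R) := s * x.
rewrite -[LHS]/((s ^+ 2)%:E * (lam \x lam) ((g @^-1` B) `*` (g @^-1` C)))%E.
have mp (D : set R) : measurable D -> measurable (g @^-1` D).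
  by move=> mD; rewrite -[X in measurable X]setTI; apply: (@mulrl_measurable R setT s).
rewrite product_measure1E; [|exact: mp|exact: mp].
transitivity ((s%:E * lam (g @^-1` B)) * (s%:E * lam (g @^-1` C)))%E; last first.
  by congr (_ * _)%E; [exact/esym/lebesgue_scale|exact/esym/lebesgue_scale].
by rewrite expr2 EFinM muleACA.
Qed.

(** [E] is a Borel set [A] together with a part of a Borel null set [N']. The outer measure of [E]
    is thus at most the measure of [A], which scales exactly, and the preimage of [A] lies in that
    of [E]. This direction of the inequality is the one that bounds Brudnyi's ratio from above. *)
Lemma scale2_measurable (s : R) (E : set (R * R)) : 0 < s ->
  lebesgue_measurable2 E -> lebesgue_measurable2 (scale2 s @^-1` E) /\
  (area2 E <= (s ^+ 2)%:E * area2 (scale2 s @^-1` E))%E.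
Proof.
move=> s0 [A mA [N [N' [mN' N'0 NN']]] AN].
have s20 : 0 < s ^+ 2 by rewrite exprn_gt0.
have N'0' : borel2 (scale2 s @^-1` N') = 0%E.
  have := borel2_scale s0 mN'; rewrite [X in X = _](N'0) => /esym/eqP.
  by rewrite mule_eq0 eqe gt_eqF//= => /eqP.
split.
  exists (scale2 s @^-1` A); first exact: measurable_scale2.
  exists (scale2 s @^-1` N); last by rewrite -AN.
  exists (scale2 s @^-1` N'); split => //; first exact: measurable_scale2.
  by move=> x; exact: NN'.
apply: (@le_trans _ _ (borel2 (A `|` N'))).
  rewrite -area2_measurable; last exact: measurableU.
  by apply: le_area2; rewrite -AN; exact: setUS.
apply: (@le_trans _ _ (borel2 A)).
  have := @measureU2 _ (TR * TR)%type R (lam \x lam)%E A N' mA mN'.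
  by rewrite [X in (_ <= _ + X)%E](N'0) adde0.
rewrite (borel2_scale s0 mA) lee_pmul2l// -area2_measurable; last exact: measurable_scale2.
by apply: le_area2; rewrite -AN => x; left.
Qed.

Lemma itv_measure (a b : R) : a <= b -> lam [set` `[a, b]] = (b - a)%:E.
Proof.
move=> ab; rewrite lebesgue_measure_itv /= lte_fin; case: ltP => // ba.
by have -> : a = b by [apply/le_anti; rewrite ab ba]; rewrite subrr.
Qed.

Definition rectangle (a b c d : R) : set (R * R) := [set` `[a, b]] `*` [set` `[c, d]].

Lemma rect_measurable a b c d : measurable (rectangle a b c d).
Proof. by apply: measurableX; exact: measurable_itv. Qed.

Lemma area2_rect a b c d : a <= b -> c <= d -> area2 (rectangle a b c d) = ((b - a) * (d - c))%:E.
Proof.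
move=> ab cd; rewrite area2_measurable; last exact: rect_measurable.
by rewrite borel2X// !itv_measure// EFinM.
Qed.

Lemma sub_rect_fin (E : set (R * R)) a b c d : a <= b -> c <= d -> E `<=` rectangle a b c d ->
  area2 E \is a fin_num /\ fine (area2 E) <= (b - a) * (d - c).
Proof.
move=> ab cd /le_area2; rewrite area2_rect// => h.
have f : area2 E \is a fin_num.
  by rewrite ge0_fin_numE ?area2_ge0// (le_lt_trans h)// ltry.
by split=> //; rewrite -lee_fin fineK.
Qed.

Lemma rect_sub_ge (E : set (R * R)) a b c d : a <= b -> c <= d -> rectangle a b c d `<=` E ->
  area2 E \is a fin_num -> (b - a) * (d - c) <= fine (area2 E).
Proof.
by move=> ab cd /le_area2; rewrite area2_rect// => h f; rewrite -lee_fin fineK.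
Qed.

Lemma normc_lt_sqr (z : R[i]) (t : R) : 0 < t ->
  (normc z < t) = (complex.Re z ^+ 2 + complex.Im z ^+ 2 < t ^+ 2).
Proof.
move=> t0; case: z => x y /=; rewrite -[in LHS](ger0_norm (ltW t0)) -sqrtr_sqr ltr_sqrt//.
by rewrite exprn_gt0.
Qed.

Lemma ball_RE (t : R) : 0 < t -> ball_R 0 t = [set p | p.1 ^+ 2 + p.2 ^+ 2 < t ^+ 2].
Proof.
move=> t0; apply/seteqP; split => -[x y]; rewrite /ball_R /ball_C /of_real /norm2 /= !subr0.
  rewrite !expr0n /= !addr0 !sqr_sqrtr ?sqr_ge0// -[in X in X -> _](ger0_norm (ltW t0)) -sqrtr_sqr ltr_sqrt//.
  by rewrite exprn_gt0.
rewrite !expr0n /= !addr0 !sqr_sqrtr ?sqr_ge0// -[in X in _ -> X](ger0_norm (ltW t0)) -sqrtr_sqr ltr_sqrt//.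
by rewrite exprn_gt0.
Qed.

Lemma disc_coordsE (t : R) : 0 < t -> coords (disc 0 t) = ball_R 0 t.
Proof.
move=> t0; rewrite ball_RE//; apply/seteqP; split=> p.
  rewrite -[X in X -> _]/(is_true (normc (p.1 +i* p.2 - 0) < t)).
  by rewrite subr0 normc_lt_sqr.
rewrite -[X in _ -> X]/(is_true (normc (p.1 +i* p.2 - 0) < t)).
by rewrite subr0 normc_lt_sqr.
Qed.

Lemma sqr_lt_itv (x y t : R) : 0 < t -> x ^+ 2 + y ^+ 2 < t ^+ 2 -> - t <= x <= t.
Proof.
move=> t0 h; have : x ^+ 2 <= t ^+ 2 by have := sqr_ge0 y; lra.
by rewrite -ler_norml => h2; rewrite -ler_sqr ?nnegrE ?(ltW t0)// real_normK ?num_real.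
Qed.

Lemma ball_R_sub (t : R) : 0 < t -> ball_R 0 t `<=` rectangle (- t) t (- t) t.
Proof.
move=> t0; rewrite ball_RE// => -[x y] /= h; split; rewrite /= in_itv /=.
  exact: sqr_lt_itv h.
by move: h; rewrite addrC; exact: sqr_lt_itv.
Qed.

Lemma ball_R_sup (t : R) : 0 < t -> rectangle (- t / 2) (t / 2) (- t / 2) (t / 2) `<=` ball_R 0 t.
Proof.
move=> t0; rewrite ball_RE// => -[x y] [] /=; rewrite !in_itv /= => hx hy.
have sq (u : R) : - t / 2 <= u <= t / 2 -> u ^+ 2 <= t ^+ 2 / 4.
  move=> hu; rewrite (_ : t ^+ 2 / 4 = (t / 2) ^+ 2); last by field.
  by rewrite -[u ^+ 2]real_normK ?num_real// lerXn2r ?nnegrE ?divr_ge0 ?(ltW t0)// ler_norml -mulNr.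
have := sq _ hx; have := sq _ hy; have : 0 < t ^+ 2 by rewrite exprn_gt0.
lra.
Qed.

(** An inscribed and a circumscribed square suffice: the loss of a factor 4 against the exact ratio
    of areas goes into the constant c. *)
Lemma ball_R_area (t : R) : 0 < t -> [/\ area2 (ball_R 0 t) \is a fin_num,
  t ^+ 2 <= fine (area2 (ball_R 0 t)) & fine (area2 (ball_R 0 t)) <= 4 * t ^+ 2].
Proof.
move=> t0; have tt : - t <= t by lra.
have tt2 : - t / 2 <= t / 2 by lra.
have [f h] := sub_rect_fin tt tt (ball_R_sub t0); split=> //.
  have := rect_sub_ge tt2 tt2 (ball_R_sup t0) f; apply: le_trans.
  by rewrite le_eqVlt; apply/orP; left; apply/eqP; field.
by apply: le_trans h _; rewrite le_eqVlt; apply/orP; left; apply/eqP; ring.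
Qed.

Lemma ball_R_measurable (t : R) : 0 < t -> measurable (ball_R 0 t).
Proof.
move=> t0; rewrite ball_RE//.
have mf : measurable_fun [set: R * R] (fun p : R * R => p.1 ^+ 2 + p.2 ^+ 2).
  by apply: measurable_funD; apply: measurable_funX.
rewrite (_ : [set p | _] = setT `&` (fun p : R * R => p.1 ^+ 2 + p.2 ^+ 2) @^-1` [set` `]-oo, (t ^+ 2)[]).
  by apply: mf => //; exact: measurable_itv.
by rewrite setTI; apply/seteqP; split => p /=; rewrite in_itv.
Qed.

End Area.

(** * Brudnyi's inequality *)

Section Kappa.
Context {R : realType}.
Notation C2 := (R[i] * R[i])%type.
Notation TR := (measurableTypeR R).

Lemma sup_eq (S : set R) (b : R) : (forall x, S x -> x <= b) ->
  (forall e : R, 0 < e -> exists2 x, S x & b - e < x) -> sup S = b.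
Proof.
move=> ub adh; have [x0 Sx0 _] := adh 1 ltr01.
apply/le_anti/andP; split; first by apply: ge_sup; [exists x0|exact: ub].
rewrite leNgt; apply/negP => h; have e0 : 0 < b - sup S by rewrite subr_gt0.
have [x Sx] := adh _ e0; rewrite subKr; apply/negP; rewrite -leNgt.
apply: (sup_upper_bound (E := S)) => //; split; first by exists x0.
by exists b => y; exact: ub.
Qed.

Lemma le_sup_of (S : set R) (b x : R) : (forall x, S x -> x <= b) -> S x -> x <= sup S.
Proof.
move=> ub Sx; apply: (sup_upper_bound (E := S)) => //; split; first by exists x.
by exists b => y; exact: ub.
Qed.

Lemma norm2R (x : R) : norm2 (x%:C, 0) = `|x|.
Proof. by rewrite /norm2 normcR normc0 expr0n /= addr0 real_normK ?num_real// sqrtr_sqr. Qed.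

Lemma ball_C0E (t : R) : ball_C 0 t = [set z : C2 | norm2 z < t].
Proof.
apply/seteqP; split => -[z w]; rewrite /ball_C /= !subr0 //.
Qed.

Lemma of_real0 : of_real (0 : R * R) = 0 :> C2.
Proof. by []. Qed.

Lemma Re_fst_psh (c : R) : plurisubharmonic (fun z : C2 => complex.Re z.1 + c).
Proof.
split.
  move=> z a; rewrite -subr_gt0 => h; exists (a - (complex.Re z.1 + c)) => // w.
  rewrite /ball_C /= => /(le_lt_trans (proj1 (norm2_ge (w.1 - z.1, w.2 - z.2)))) /= h1.
  have := le_lt_trans (ler_Re_normc _) h1; rewrite Re_add Re_opp ltr_norml; lra.
move=> a b; apply: (@Re_subharmonic R (fun z => a.1 + z * b.1)) => z.
eexists; exact: cdiffD (cdiff_cst _ _) (cdiffM (cdiff_id _) (cdiff_cst _ _)).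
Qed.

Lemma sup_Re_ball (t c : R) : 0 < t ->
  sup [set complex.Re z.1 + c | z in (ball_C 0 t : set C2)] = t + c.
Proof.
move=> t0; apply: sup_eq.
  move=> _ [z + <-]; rewrite ball_C0E /= => zt; rewrite lerD2r.
  rewrite (le_trans (ler_norm _))// (le_trans (ler_Re_normc _))//.
  by rewrite (le_trans (proj1 (norm2_ge z)))// ltW.
move=> e e0; pose x := Num.max 0 (t - e / 2).
have x0 : 0 <= x by rewrite le_max lexx.
have xt : x < t by rewrite gt_max t0 ltrBlDr ltrDl divr_gt0.
exists (x + c); last first.
  have : t - e / 2 <= x by rewrite le_max lexx orbT.
  lra.
exists (x%:C, 0) => //; rewrite ball_C0E /=.
by rewrite -[X in X < _]/(norm2 (x%:C, 0)) norm2R ger0_norm.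
Qed.

(* With [kappa = 1], removing from a real ball a cap of height [d], hence of area
   O(d^(3/2)), could lower the supremum of [Re z_1] by O(d^(3/2)) only, but it
   lowers it by [d]. *)
Lemma brudnyi_constant_gt1 (kappa : R) : brudnyi_constant kappa -> 1 < kappa.
Proof.
move=> [k1 H]; rewrite lt_neqAle k1 andbT; apply/eqP => kE; move: H; rewrite -{}kE => {kappa k1} H.
have a1 : 1 < 3 / 2 :> R by lra.
have r1 : 1 < 2 :> R by lra.
have [c c0 {}H] := H _ _ a1 r1.
(* The shift by -2 is the normalisation: the suprema over the balls of radii 2 and 1 become 0 and
   -1. *)
pose h (z : C2) := complex.Re z.1 + - 2.
have hr : sup [set h z | z in ball_C 0 2] = 0 by rewrite /h sup_Re_ball// subrr.
have h1 : -1 <= sup [set h z | z in ball_C 0 1] by rewrite /h sup_Re_ball//; lra.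
have hb : ball_C (of_real (0 : R * R)) (3 / 2 * (1 / 2)) `<=` ball_C 0 1.
  rewrite of_real0 !ball_C0E => z /= /lt_trans; apply; lra.
have t0 : 0 < 1 / 2 :> R by lra.
(* The cap of height d = e^2 of the ball of radius 1/2 has half-width at most e, so it has area at
   most 2 e d, while at least 1/4 remains. The logarithm is then at most 8 e d, and 16 c e <= 1
   turns the inequality into d <= d / 2. *)
pose e := Num.min (1 / 4) (1 / (16 * c)).
have e0 : 0 < e by rewrite lt_min !divr_gt0// mulr_gt0.
have e4 : e <= 1 / 4 by rewrite ge_min lexx.
have ec : 16 * c * e <= 1.
  have : e <= 1 / (16 * c) by rewrite ge_min lexx orbT.
  by rewrite ler_pdivlMr ?mulr_gt0// mulrC.
pose d := e ^+ 2; have d0 : 0 < d by rewrite exprn_gt0.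
have d4 : d < 1 / 4.
  have : e * e <= e * (1 / 4) by rewrite ler_pM2l.
  by rewrite /d expr2; lra.
pose B : set (R * R) := ball_R 0 (1 / 2).
pose E : set (R * R) := B `&` [set p | p.1 < 1 / 2 - d].
have mB : measurable B by exact: ball_R_measurable.
have mE : measurable E.
  apply: measurableI => //.
  rewrite (_ : [set p | _] = setT `&` (fst : R * R -> R) @^-1` [set` `]-oo, (1 / 2 - d)[]).
    by apply: measurable_fst => //; exact: measurable_itv.
  by rewrite setTI; apply/seteqP; split => p /=; rewrite in_itv.
have EB : E `<=` B by move=> p [].
have [fB B1 B2] := ball_R_area t0.
have ee : - e <= e by lra.
have dd : 1 / 2 - d <= 1 / 2 by lra.
have cover : B `<=` E `|` rectangle (1 / 2 - d) (1 / 2) (- e) e.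
  move=> p Bp; have [pd|dp] := ltP p.1 (1 / 2 - d); first by left.
  right; move: Bp; rewrite /B ball_RE// => /= hp.
  have /andP[_ p12] := sqr_lt_itv t0 hp.
  have y2 : p.2 ^+ 2 <= e ^+ 2.
    have : (1 / 2 - d) ^+ 2 <= p.1 ^+ 2 by rewrite ler_sqr ?nnegrE//; lra.
    have := sqr_ge0 d; rewrite -/d; lra.
  split; rewrite /= in_itv /=; first by rewrite dp.
  by rewrite -ler_norml -ler_sqr ?nnegrE ?(ltW e0)// real_normK ?num_real.
have fE : area2 E \is a fin_num.
  rewrite ge0_fin_numE ?area2_ge0// (le_lt_trans (le_area2 EB))//.
  by rewrite -ge0_fin_numE ?area2_ge0.
have tt : - (1 / 2) / 2 <= 1 / 2 / 2 :> R by lra.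
have E4 : 1 / 4 <= fine (area2 E).
  have sub : rectangle (- (1 / 2) / 2) (1 / 2 / 2) (- (1 / 2) / 2) (1 / 2 / 2) `<=` E.
    move=> p hp; split; first exact: ball_R_sup.
    by case: hp => /=; rewrite in_itv /= => /andP[_ h2] _; lra.
  have := rect_sub_ge tt tt sub fE; lra.
have BE : fine (area2 B) <= fine (area2 E) + 2 * e * d.
  rewrite -lee_fin EFinD !fineK//.
  have -> : (2 * e * d)%:E = area2 (rectangle (1 / 2 - d) (1 / 2) (- e) e).
    by rewrite area2_rect//; congr EFin; ring.
  have mr := @rect_measurable R (1 / 2 - d) (1 / 2) (- e) e.
  rewrite (le_trans (le_area2 cover))// (area2_measurable mE) (area2_measurable mr).
  rewrite area2_measurable; last exact: measurableU.
  exact: (@measureU2 _ (TR * TR)%type R (@lebesgue_measure R \x @lebesgue_measure R)%E E _ mE mr).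
have lE : lebesgue_measurable2 E.
  exists E => //; exists set0; last by rewrite setU0.
  by exists set0; split.
have E0 : (0 < area2 E)%E by rewrite -(fineK fE) lte_fin; lra.
have := H h (Re_fst_psh _) hr h1 0 (1 / 2) hb E lE EB E0.
have -> : sup [set h (of_real y) | y in ball_R 0 (1 / 2)] = 1 / 2 + - 2.
  apply: sup_eq.
    move=> _ [p + <-]; rewrite ball_RE// => hp; rewrite /h /= lerD2r.
    by have /andP[] := sqr_lt_itv t0 hp.
  move=> u u0; pose x := Num.max 0 (1 / 2 - u / 2).
  have x0 : 0 <= x by rewrite le_max lexx.
  have xt : x < 1 / 2 by rewrite gt_max t0 ltrBlDr ltrDl divr_gt0.
  exists (x + - 2); last first.
    have : 1 / 2 - u / 2 <= x by rewrite le_max lexx orbT.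
    lra.
  exists (x, 0) => //; rewrite ball_RE//= expr0n /= addr0.
  by rewrite ltr_sqr ?nnegrE// ltW.
have supE : sup [set h (of_real y) | y in E] <= 1 / 2 - d + - 2.
  apply: ge_sup; last by move=> _ [p [_ pd] <-]; rewrite /h /= lerD2r ltW.
  exists (h (of_real 0)), 0 => //; split.
    by apply: ball_R_sup => //; split; rewrite /= in_itv /=; lra.
  by rewrite /=; lra.
have q0 : 0 < fine (area2 E) by lra.
have lnle : ln (1 * fine (area2 B) / fine (area2 E)) <= 8 * e * d.
  have p0 : 0 < 1 * fine (area2 B) / fine (area2 E).
    rewrite mul1r divr_gt0//; have : 0 < (1 / 2 : R) ^+ 2 by rewrite exprn_gt0.
    by move: B1; rewrite -/B; lra.
  have ln1 : ln (1 * fine (area2 B) / fine (area2 E)) <= 1 * fine (area2 B) / fine (area2 E) - 1.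
    have := expR_ge1Dx (ln (1 * fine (area2 B) / fine (area2 E))).
    by rewrite lnK ?posrE//; lra.
  rewrite (le_trans ln1)// mul1r lerBlDr ler_pdivrMr// (le_trans BE)//.
  have : 2 * e * d <= 8 * e * d * fine (area2 E).
    rewrite (_ : 2 * e * d = 8 * e * d * (1 / 4)); last by field.
    by rewrite ler_pM2l// mulr_gt0// mulr_gt0.
  lra.
move=> HH; have H1 := ler_wpM2l (ltW c0) lnle.
have : d <= c * (8 * e * d) by move: HH H1 supE; rewrite -/B; lra.
rewrite (_ : c * (8 * e * d) = (16 * c * e) * (d / 2)); last by field.
have : 16 * c * e * (d / 2) <= 1 * (d / 2) by rewrite ler_pM2r// divr_gt0.
lra.
Qed.

End Kappa.

(** * Brudnyi's inequality for the complexified polynomial *)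

Section Remez.
Context {R : realType}.
Notation C2 := (R[i] * R[i])%type.

Lemma le_limit (x y C d : R) : 0 < d -> 0 <= C ->
  (forall e, 0 < e -> e <= d -> x <= y + C * e) -> x <= y.
Proof.
move=> d0 C0 H; apply/ler_addgt0Pr => e e0.
have C1 : 0 < C + 1 by rewrite ltr_wpDl.
pose u := Num.min d (e / (C + 1)).
have u0 : 0 < u by rewrite lt_min d0 divr_gt0.
have ud : u <= d by rewrite ge_min lexx.
rewrite (le_trans (H u u0 ud))// lerD2l.
have : u <= e / (C + 1) by rewrite ge_min lexx orbT.
rewrite ler_pdivlMr// mulrDr mulr1 mulrC; lra.
Qed.

(* Brudnyi's inequality is applied to [h = (ln (max |Phi| d) - L) / A], where [L]
   makes the supremum of [h] vanish; the truncation at [d] keeps [h] finite at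
   the zeros of [Phi], and [d] tends to [0] at the end. *)
Lemma brudnyi_complex (kappa c' : R) (Phi : C2 -> R[i]) (K m A : R) :
  (forall h : C2 -> R, plurisubharmonic h ->
    sup [set h z | z in ball_C 0 (6 / 5)] = 0 ->
    -1 <= sup [set h z | z in ball_C 0 1] ->
  forall (x : R * R) (t : R), ball_C (of_real x) (5 / 4 * t) `<=` ball_C 0 1 ->
    forall E : set (R * R), lebesgue_measurable2 E -> E `<=` ball_R x t ->
    (0 < area2 E)%E ->
    sup [set h (of_real y) | y in ball_R x t] <=
      c' * ln (kappa * fine (area2 (ball_R x t)) / fine (area2 E)) +
      sup [set h (of_real y) | y in E]) ->
  continuous_C2 Phi ->
  (forall a b : C2, forall z, exists l, cdiff (fun z => Phi (a.1 + z * b.1, a.2 + z * b.2)) z l) ->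
  (forall z, ball_C 0 (6 / 5) z -> normc (Phi z) <= K) ->
  normc (Phi 0) = m -> 0 < m -> 0 < A -> ln K - ln m <= A ->
  forall E, lebesgue_measurable2 E -> E `<=` ball_R 0 (2 / 3) -> (0 < area2 E)%E ->
  0 < kappa * fine (area2 (ball_R 0 (2 / 3))) / fine (area2 E) ->
  forall S, (forall y, E y -> normc (Phi (of_real y)) <= S) ->
  forall y, ball_R 0 (2 / 3) y -> normc (Phi (of_real y)) <=
    (kappa * fine (area2 (ball_R 0 (2 / 3))) / fine (area2 E)) `^ (c' * A) * S.
Proof.
move=> Hb cP dP PK Pm m0 A0 KA E mE EB E0 q0 S ES y By.
set q := kappa * _ / _ in q0 *; set Q := q `^ _.
have S0 : 0 <= S.
  have [z Ez] := area2_gt0_nonempty E0.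
  exact: le_trans (normc_ge0 _) (ES z Ez).
have Q0 : 0 <= Q by exact: powR_ge0.
have b0 : (ball_C 0 (6 / 5) : set C2) 0.
  by rewrite ball_C0E /= -[X in X < _]/(norm2 ((0 : R)%:C, 0)) norm2R normr0; lra.
have mK : m <= K by rewrite -Pm PK.
have sub6 (t : R) (z : C2) : t <= 6 / 5 -> ball_C 0 t z -> ball_C 0 (6 / 5) z.
  by move=> t6; rewrite !ball_C0E /= => /lt_le_trans; apply.
have realball (z : R * R) (t : R) : ball_R 0 t z -> ball_C 0 t (of_real z).
  by rewrite /ball_R /= of_real0.
apply: (@le_limit _ _ Q m) => // d d0 dm.
pose L := sup [set logmax d (Phi z) | z in ball_C 0 (6 / 5)].
pose h z := A^-1 * (logmax d (Phi z) - L).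
have mx (w : R[i]) : 0 < Num.max (normc w) d by rewrite lt_max d0 orbT.
have lK z : ball_C 0 (6 / 5) z -> logmax d (Phi z) <= ln K.
  move=> bz; rewrite /logmax ler_ln ?posrE//; last exact: lt_le_trans mK.
  by rewrite ge_max PK//= (le_trans dm).
have ubL x : [set logmax d (Phi z) | z in ball_C 0 (6 / 5)] x -> x <= ln K.
  by move=> [z bz <-]; exact: lK.
have Lz z : ball_C 0 (6 / 5) z -> logmax d (Phi z) <= L.
  by move=> bz; apply: (le_sup_of ubL); exists z.
have LK : L <= ln K by apply: ge_sup => //; exists (logmax d (Phi 0)), 0.
have Ai : 0 < A^-1 by rewrite invr_gt0.
have h0 z : ball_C 0 (6 / 5) z -> h z <= 0.
  by move=> bz; rewrite /h pmulr_rle0// subr_le0 Lz.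
have psh : plurisubharmonic h by exact: logmax_psh.
have hr : sup [set h z | z in ball_C 0 (6 / 5)] = 0.
  apply: sup_eq; first by move=> _ [z bz <-]; exact: h0.
  move=> e e0; have eA : 0 < e * A by rewrite mulr_gt0.
  have hs : has_sup [set logmax d (Phi z) | z in ball_C 0 (6 / 5)].
    by split; [exists (logmax d (Phi 0)), 0|exists (ln K)].
  have [_ [z bz <-] zL] := sup_adherent eA hs.
  exists (h z); first by exists z.
  by rewrite sub0r /h mulrC ltr_pdivlMr// mulNr; move: zL; rewrite -/L; lra.
have h1 : -1 <= sup [set h z | z in ball_C 0 1].
  apply: (@le_trans _ _ (h 0)); last first.
    apply: (@le_sup_of R _ 0); last first.
      exists 0 => //; rewrite ball_C0E /= -[X in X < _]/(norm2 ((0 : R)%:C, 0)) norm2R normr0; lra.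
    by move=> _ [z bz <-]; apply: h0; apply: sub6 bz; lra.
  (* Since d <= m, truncation leaves the value ln m at the origin, and L <= ln K <= ln m + A gives
     h(0) >= -1. *)
  rewrite /h mulrC ler_pdivlMr// mulN1r /logmax Pm max_l//; lra.
have tb : ball_C (of_real (0 : R * R)) (5 / 4 * (2 / 3)) `<=` ball_C 0 1.
  by rewrite of_real0 !ball_C0E => z /= /lt_trans; apply; lra.
have := Hb h psh hr h1 0 (2 / 3) tb E mE EB E0; rewrite -/q => Hq.
have hy : h (of_real y) <= sup [set h (of_real y) | y in ball_R 0 (2 / 3)].
  apply: (@le_sup_of R _ 0); last by exists y.
  by move=> _ [z bz <-]; apply: h0; apply: sub6 (realball _ _ bz); lra.
have hE : sup [set h (of_real y) | y in E] <= A^-1 * (ln (Num.max S d) - L).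
  apply: ge_sup.
    have [z Ez] := area2_gt0_nonempty E0.
    by exists (h (of_real z)), z.
  move=> _ [z Ez <-]; rewrite /h ler_pM2l// lerD2r /logmax ler_ln ?posrE//.
    by rewrite ge_max !le_max ES//= lexx orbT.
  by rewrite lt_max d0 orbT.
have Sd : 0 < Num.max S d by rewrite lt_max d0 orbT.
have H1 : logmax d (Phi (of_real y)) <= c' * A * ln q + ln (Num.max S d).
  have : A * h (of_real y) <= A * (c' * ln q + A^-1 * (ln (Num.max S d) - L)).
    by rewrite ler_pM2l// (le_trans hy)// (le_trans Hq)// lerD2l.
  have -> : A * h (of_real y) = logmax d (Phi (of_real y)) - L.
    by rewrite /h mulrA mulfV ?mul1r// gt_eqF.
  have -> : A * (c' * ln q + A^-1 * (ln (Num.max S d) - L)) = c' * A * ln q + (ln (Num.max S d) - L).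
    by field; rewrite gt_eqF.
  lra.
have H2 : Num.max (normc (Phi (of_real y))) d <= Q * Num.max S d.
  rewrite -ler_ln ?posrE ?mulr_gt0 ?powR_gt0//.
  rewrite lnM ?posrE ?powR_gt0// ln_powR.
  exact: H1.
have H3 : normc (Phi (of_real y)) <= Num.max (normc (Phi (of_real y))) d by rewrite le_max lexx.
rewrite (le_trans H3)// (le_trans H2)// -mulrDr ler_wpM2l//.
by rewrite ge_max lerDl (ltW d0) lerDr S0.
Qed.

(** For real [z] the two arguments are conjugate to each other, so the real plane of Brudnyi's
    theorem is the one where the complexification restricts to the approximant of [F]. *)
Definition bieval2 n (P : nat -> {poly R[i]}) (s : R) (z : C2) : R[i] :=
  bieval n P (s%:C * (z.1 + 'i * z.2)) (s%:C * (z.1 - 'i * z.2)).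

Lemma continuous_C2_horner (p : {poly R[i]}) (f : C2 -> R[i]) : continuous_C2 f ->
  continuous_C2 (fun z => p.[f z]).
Proof.
move=> cf; have -> : (fun z => p.[f z]) = fun z => \sum_(j < size p) p`_j * f z ^+ j.
  by apply/funext => z; rewrite horner_coef.
apply: (@continuous_C2_sum R (size p) (fun j z => p`_j * f z ^+ j)) => j.
by apply: continuous_C2_M; [exact: continuous_C2_cst|exact: continuous_C2_X].
Qed.

Lemma cdiff_horner (p : {poly R[i]}) (f : R[i] -> R[i]) z l : cdiff f z l ->
  exists l', cdiff (fun z => p.[f z]) z l'.
Proof.
move=> df; have -> : (fun z => p.[f z]) = fun z => \sum_(j < size p) p`_j * f z ^+ j.
  by apply/funext => w; rewrite horner_coef.
apply: (@cdiff_sum R _ _ _ (fun (j : 'I_(size p)) z => p`_j * f z ^+ j)) => j _.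
eexists; exact: cdiffM (cdiff_cst _ _) (cdiff_comp df (cdiffX _ _)).
Qed.

Lemma bieval2_cont n P s : continuous_C2 (bieval2 n P s).
Proof.
have cu (c : R[i]) : continuous_C2 (fun z : C2 => s%:C * (z.1 + c * z.2)).
  apply: continuous_C2_M; first exact: continuous_C2_cst.
  apply: continuous_C2_D; first exact: continuous_C2_fst.
  by apply: continuous_C2_M; [exact: continuous_C2_cst|exact: continuous_C2_snd].
apply: (@continuous_C2_sum R n.+1 (fun k z => (P k).[s%:C * (z.1 + 'i * z.2)] * (s%:C * (z.1 - 'i * z.2)) ^+ k)) => k.
apply: continuous_C2_M; first exact/continuous_C2_horner/cu.
apply: continuous_C2_X; have := cu (- 'i).
by under eq_fun do rewrite mulNr.
Qed.

Lemma bieval2_cdiff n P s (a b : C2) z :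
  exists l, cdiff (fun z => bieval2 n P s (a.1 + z * b.1, a.2 + z * b.2)) z l.
Proof.
have cu (c : R[i]) : cdiff (fun z => s%:C * ((a.1 + z * b.1) + c * (a.2 + z * b.2))) z _ :=
  cdiffM (cdiff_cst s%:C z) (cdiffD (cdiffD (cdiff_cst a.1 z) (cdiffM (cdiff_id z) (cdiff_cst b.1 z)))
    (cdiffM (cdiff_cst c z) (cdiffD (cdiff_cst a.2 z) (cdiffM (cdiff_id z) (cdiff_cst b.2 z))))).
rewrite /bieval2 /bieval /=.
apply: (@cdiff_sum R _ _ _ (fun (k : 'I_n.+1) z => (P k).[s%:C * (a.1 + z * b.1 + 'i * (a.2 + z * b.2))] *
  (s%:C * (a.1 + z * b.1 - 'i * (a.2 + z * b.2))) ^+ k)) => k _.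
have [l dl] := cdiff_horner (P k) (cu 'i).
have d2 := cdiff_comp (cu (- 'i)) (cdiffX _ k).
eexists; apply: eq_rdiff (cdiffM dl d2).
by exists 1 => // h _; rewrite mulNr.
Qed.

(** By Cauchy-Schwarz |z_1| + |z_2| is at most sqrt 2 times 6/5, less than 9/5, and (3/2)(9/5) =
    27/10. *)
Lemma bieval2_arg (z : C2) (c : R[i]) : normc c = 1 -> ball_C 0 (6 / 5) z ->
  normc ((3 / 2 : R)%:C * (z.1 + c * z.2)) <= 27 / 10.
Proof.
move=> c1; rewrite ball_C0E /= => hz.
rewrite normcM normcR ger0_norm; last by lra.
have h : normc (z.1 + c * z.2) <= normc z.1 + normc z.2.
  by rewrite (le_trans (ler_normcD _ _))// normcM c1 mul1r.
have [n1 n2] := (normc_ge0 z.1, normc_ge0 z.2).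
have n3 : norm2 z ^+ 2 = normc z.1 ^+ 2 + normc z.2 ^+ 2.
  by rewrite /norm2 sqr_sqrtr// addr_ge0 ?sqr_ge0.
have n20 : 0 <= norm2 z by exact: sqrtr_ge0.
have n4 : norm2 z ^+ 2 <= (6 / 5) ^+ 2 by rewrite lerXn2r ?nnegrE ?divr_ge0 ?(ltW hz).
have : normc z.1 + normc z.2 <= 9 / 5.
  rewrite -ler_sqr ?nnegrE ?addr_ge0//.
  rewrite (_ : (_ + _) ^+ 2 = 2 * (normc z.1 ^+ 2 + normc z.2 ^+ 2) - (normc z.1 - normc z.2) ^+ 2); last by ring.
  rewrite -n3; have := sqr_ge0 (normc z.1 - normc z.2); move: n4 (_ ^+ 2) => n4 u u0.
  lra.
lra.
Qed.

End Remez.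

(** * Approximation on the scaled disc and numerical estimates *)

Section Assembly.
Context {R : realType}.

Lemma disc0P (t : R) z : disc 0 t z <-> normc z < t.
Proof. by rewrite /disc /mkset subr0. Qed.

Lemma ball_RP (y : R * R) (t : R) : 0 < t -> ball_R 0 t y <-> normc (y.1 +i* y.2) < t.
Proof. by move=> t0; rewrite ball_RE// normc_lt_sqr. Qed.

Lemma polyanalytic_approx n (F : R[i] -> R[i]) (r : R) : 0 < r ->
  polyanalytic n F (disc 0 (5 * r)) -> forall e : R, 0 < e ->
  exists P : nat -> {poly R[i]}, forall z, normc z <= 4 ->
    normc (F (r%:C * z) - bieval n P z z^*%C) <= e.
Proof.
move=> r0 /polyanalytic_decomp [G [cG FG]] e e0.
have inD z : normc z < 5 -> disc 0 (5 * r) (r%:C * z).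
  by move=> z5; rewrite /disc /= subr0 normcM normcR gtr0_norm// mulrC ltr_pM2r.
(* The tolerance is shared among the n + 1 terms, in each of which the error is multiplied by |z|^k
   <= 4^n. *)
have e10 : 0 < e / (n.+1%:R * 4 ^+ n) by rewrite divr_gt0// mulr_gt0// exprn_gt0.
have H k : exists p : {poly R[i]}, forall z, normc z <= 4 ->
    normc (r%:C ^+ k * G k (r%:C * z) - p.[z]) <= e / (n.+1%:R * 4 ^+ n).
  apply: (@taylor_approx R (fun z => r%:C ^+ k * G k (r%:C * z)) 4 (9 / 2)) => //; first by lra.
  move=> z z5; have [|l dl] := cG k (r%:C * z); first by apply: inD; lra.
  eexists; apply: cdiffM (cdiff_cst _ _) _.
  exact: cdiff_comp (cdiffM (cdiff_cst _ _) (cdiff_id z)) dl.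
have [P HP] := choice H; exists P => z z4.
rewrite FG; last by apply: inD; lra.
rewrite /bieval -sumrB (le_trans (normc_sum _ _ _))//.
have -> : e = \sum_(k < n.+1) e / (n.+1%:R * 4 ^+ n) * 4 ^+ n.
  rewrite sumr_const card_ord -mulr_natr.
  by field; rewrite nat1r pnatr_eq0 /= expf_neq0.
apply: ler_sum => k _.
rewrite (_ : _ - _ = (r%:C ^+ k * G k (r%:C * z) - (P k).[z]) * (z^*%C) ^+ k); last first.
  by rewrite conjcM conjcR exprMn; ring.
rewrite normcM normcX normc_conj ler_pM ?normc_ge0 ?exprn_ge0 ?normc_ge0 ?HP//.
apply: (@le_trans _ _ (4 ^+ k)); first by rewrite lerXn2r ?nnegrE ?normc_ge0.
by rewrite ler_weXn2l ?ler1n// -ltnS.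
Qed.

Lemma horner_bounded (p : {poly R[i]}) : exists K : R, forall z, normc z <= 4 -> normc p.[z] <= K.
Proof.
exists (\sum_(j < size p) normc p`_j * 4 ^+ j) => z z4.
rewrite horner_coef (le_trans (normc_sum _ _ _))//; apply: ler_sum => j _.
by rewrite normcM normcX ler_wpM2l ?normc_ge0// lerXn2r ?nnegrE ?normc_ge0.
Qed.

(** [sup] is a genuine supremum only for a set bounded above; this makes M and the other [sup_mod]
    values meaningful. The bound is that of one polynomial approximant, up to 1. *)
Lemma polyanalytic_bounded n (F : R[i] -> R[i]) (r : R) : 0 < r ->
  polyanalytic n F (disc 0 (5 * r)) ->
  exists K : R, forall z, disc 0 (4 * r) z -> normc (F z) <= K.
Proof.
move=> r0 /(polyanalytic_approx r0) /(_ 1 ltr01) [P HP].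
have [K HK] := choice (fun k => horner_bounded (P k)).
exists (1 + \sum_(k < n.+1) K k * 4 ^+ k) => z.
rewrite /disc /= subr0 => zr; pose w := (r^-1)%:C * z.
have rC0 : r%:C != 0 :> R[i] by rewrite -normc_gt0 normcR normr_gt0 gt_eqF.
have zw : z = r%:C * w by rewrite /w -complexRV mulrA mulfV// mul1r.
have w4 : normc w <= 4.
  by rewrite /w normcM normcR gtr0_norm ?invr_gt0// mulrC ler_pdivrMr// ltW.
have := HP w w4; rewrite -zw => h.
rewrite -[F z](subrK (bieval n P w w^*%C)) (le_trans (ler_normcD _ _))// lerD//.
rewrite /bieval (le_trans (normc_sum _ _ _))//; apply: ler_sum => k _.
rewrite normcM normcX normc_conj ler_pM ?normc_ge0 ?exprn_ge0 ?normc_ge0 ?HK//.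
by rewrite lerXn2r ?nnegrE ?normc_ge0.
Qed.

Lemma half_le_of (a b c : R) : 0 < a -> c <= a / 4 -> a <= b + c -> a / 2 <= b.
Proof. lra. Qed.

(** With y = 4 (n + 2) >= 8, both 80 (n + 1) and 72 (n + 1) are at most y^4, so the logarithm is at
    most 4 (n + 1) ln y. *)
Lemma exponent_bound (n : nat) :
  ln (80 * n.+1%:R * (72 * n.+1%:R) ^+ n) <= 4 * (n.+2%:R ^+ 2 * ln (4 * n.+2%:R)) :> R.
Proof.
set y : R := 4 * n.+2%:R.
have n1 : 0 < n.+1%:R :> R by rewrite ltr0n.
have n2 : 2 <= n.+2%:R :> R by rewrite ler_nat.
have n12 : n.+1%:R <= n.+2%:R :> R by rewrite ler_nat.
have y8 : 8 <= y by rewrite /y; lra.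
have y1 : 1 <= y by lra.
have y0 : 0 < y by lra.
have ny : n.+1%:R <= y by rewrite /y; lra.
have y2 : 64 <= y ^+ 2.
  have : 8 * 8 <= y * y by rewrite ler_pM.
  by rewrite expr2; lra.
have y3 : 80 <= y ^+ 3.
  have : y * 64 <= y * y ^+ 2 by rewrite ler_pM2l.
  by rewrite -exprS; lra.
have h : 80 * n.+1%:R * (72 * n.+1%:R) ^+ n <= y ^+ 4 * (y ^+ 4) ^+ n.
  have hn : 80 * n.+1%:R <= y ^+ 4.
    by rewrite exprSr ler_pM// ltW.
  apply: ler_pM => //; rewrite ?mulr_ge0 ?exprn_ge0 ?(ltW n1)//.
  rewrite lerXn2r ?nnegrE ?exprn_ge0 ?mulr_ge0 ?(ltW y0) ?(ltW n1)//.
  by apply: le_trans hn; rewrite ler_pM2r// ler_nat.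
have h0 : 0 < 80 * n.+1%:R * (72 * n.+1%:R) ^+ n :> R by rewrite !mulr_gt0 ?exprn_gt0 ?mulr_gt0.
apply: (@le_trans _ _ (ln (y ^+ 4 * (y ^+ 4) ^+ n))).
  by rewrite ler_ln ?posrE// mulr_gt0// ?exprn_gt0// exprn_gt0.
rewrite -exprS -exprM lnXn// -(mulr_natl (ln y)) [leRHS]mulrA ler_wpM2r ?ln_ge0//.
have h4 : 4 * n.+1%:R <= 4 * n.+2%:R ^+ 2 :> R.
  rewrite ler_pM2l// (le_trans n12)// expr2 ler_peMr//; lra.
by apply: le_trans h4; rewrite natrM.
Qed.

Lemma bieval2_real n (P : nat -> {poly R[i]}) (s : R) (y : R * R) :
  bieval2 n P s (of_real y) = bieval n P (s%:C * (y.1 +i* y.2)) (s%:C * (y.1 +i* y.2))^*%C.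
Proof.
have e1 : y.1 +i* y.2 = y.1%:C + 'i * y.2%:C by rewrite [LHS]complexRI.
have e2 : (y.1 +i* y.2)^*%C = y.1%:C - 'i * y.2%:C.
  by apply: complex_ext; rewrite ?(Re_add, Im_add, Re_mul, Im_mul, Re_opp, Im_opp) /=; ring.
by rewrite conjcM conjcR e2 e1.
Qed.

End Assembly.

Theorem theorem3p3 (R : realType) (kappa : R) (Hkappa : brudnyi_constant kappa) :
  exists c : R -> R,
  forall (rho r : R) (Omega : set R[i]) (n : nat) (F : R[i] -> R[i]),
    0 < rho -> rho <= r ->
    lebesgue_measurable Omega -> Omega `<=` disc 0 r ->
    (0 < area Omega)%E -> (area Omega <= area (disc 0%R rho))%E ->
    polyanalytic n F (disc 0 (5 * r)) ->
    let M := sup_mod F (disc 0 (4 * r)) in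
    let m := normc (F 0) in
    0 < m ->
    sup_mod F (disc 0 rho) <=
      (kappa * fine (area (disc 0 rho)) / fine (area Omega)) `^
        (c (rho / r) * (ln (M / m) + n.+2%:R ^+ 2 * ln (4 * n.+2%:R))) *
      sup_mod F Omega.
Proof.
have k1 := brudnyi_constant_gt1 Hkappa.
have lnk : 0 < ln kappa by rewrite ln_gt0.
have a1 : 1 < 5 / 4 :> R by lra.
have r1 : 1 < 6 / 5 :> R by lra.
have [c' c'0 Hb] := (proj2 Hkappa) _ _ a1 r1.
(* The 4 comes from [exponent_bound]. The bracket pays for passing from radius r to radius rho: with
   x = rho / r, the factor 4 / x^2 is at most q to the power ln (4 / x^2) / ln kappa as soon as q >=
   kappa. *)
exists (fun x => 4 * c' * (1 + ln (4 / x ^+ 2) / ln kappa)).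
move=> rho r Om n F rho0 rhor mOm OmD Om0 Omrho pF M m m0.
have r0 : 0 < r := lt_le_trans rho0 rhor.
have [KF HKF] := polyanalytic_bounded r0 pF.
have ubM x : [set normc (F z) | z in disc 0 (4 * r)] x -> x <= KF.
  by move=> [z dz <-]; exact: HKF.
have FM z : disc 0 (4 * r) z -> normc (F z) <= M.
  by move=> dz; apply: (le_sup_of ubM); exists z.
have disc4 (t : R) : t <= 4 * r -> disc 0 t `<=` (disc 0 (4 * r) : set R[i]).
  by move=> tr z /disc0P zt; apply/disc0P; exact: lt_le_trans zt tr.
have mM : m <= M by apply: FM; apply/disc0P; rewrite normc0 mulr_gt0.
have M0 : 0 < M := lt_le_trans m0 mM.
set X := ln (M / m) + _.
have lnMm : 0 <= ln (M / m) by rewrite ln_ge0// ler_pdivlMr// mul1r.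
have X0 : 0 < X.
  rewrite ltr_wpDl// mulr_gt0 ?exprn_gt0// ln_gt0//.
  have : 2 <= n.+2%:R :> R by rewrite ler_nat.
  lra.
pose s : R := 3 / 2; have s0 : 0 < s by rewrite /s; lra.
have rs0 : 0 < r * s by rewrite mulr_gt0.
have s23 : s * (2 / 3) = 1 by rewrite /s; field.
(* Division by r s sends the disc of radius r to the ball of radius 2/3. *)
pose E := scale2 (r * s) @^-1` (coords Om).
have [mE areaE] := scale2_measurable rs0 mOm; rewrite -/E in mE areaE.
have ptE (y : R * R) : (scale2 (r * s) y).1 +i* (scale2 (r * s) y).2 = r%:C * (s%:C * (y.1 +i* y.2)).
  by rewrite /scale2 /=; apply: complex_ext; rewrite ?(Re_mul, Im_mul) /=; ring.
have t0 : 0 < 2 / 3 :> R by lra.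
have EB : E `<=` ball_R 0 (2 / 3).
  move=> y /OmD /disc0P; rewrite ptE !normcM !normcR !gtr0_norm// => h.
  by apply/(ball_RP y t0); rewrite gtr_pMr// in h; rewrite -(ltr_pM2l s0) s23.
have sy1 (y : R * R) : ball_R 0 (2 / 3) y -> normc (s%:C * (y.1 +i* y.2)) < 1.
  by move=> /(ball_RP y t0) h; rewrite normcM normcR gtr0_norm//; move: h; rewrite -(ltr_pM2l s0) s23.
have [fB _ B2] := ball_R_area t0.
have fE : area2 E \is a fin_num.
  rewrite ge0_fin_numE ?area2_ge0// (le_lt_trans (le_area2 EB))//.
  by rewrite -ge0_fin_numE ?area2_ge0.
have [frho rho1 _] : [/\ area (disc 0 rho) \is a fin_num, rho ^+ 2 <= fine (area (disc 0 rho)) & True].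
  by rewrite /area disc_coordsE//; have [h1 h2 _] := ball_R_area rho0.
have fOm : area Om \is a fin_num.
  rewrite ge0_fin_numE ?area2_ge0// (le_lt_trans Omrho)//.
  by rewrite -ge0_fin_numE ?area2_ge0.
have Om0' : 0 < fine (area Om) by rewrite -lte_fin fineK.
have areaE' : fine (area Om) <= (r * s) ^+ 2 * fine (area2 E).
  by rewrite -lee_fin EFinM !fineK.
have E0' : 0 < fine (area2 E).
  have := lt_le_trans Om0' areaE'; rewrite pmulr_rgt0// exprn_gt0//.
have E0 : (0 < area2 E)%E by rewrite -(fineK fE) lte_fin.
pose qB := kappa * fine (area2 (ball_R 0 (2 / 3))) / fine (area2 E).
set q := kappa * fine (area (disc 0 rho)) / fine (area Om).
(* The assumption |Omega| <= |D_rho| enters here and gives ln q >= ln kappa > 0. *)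
have kq : kappa <= q.
  rewrite /q ler_pdivlMr// ler_pM2l ?(lt_trans ltr01)//.
  by rewrite -lee_fin !fineK.
have q0 : 0 < q by rewrite (lt_le_trans _ kq)// (lt_trans ltr01).
have lq0 : 0 < ln q by rewrite ln_gt0// (lt_le_trans k1).
have k0 : 0 < kappa by rewrite (lt_trans ltr01).
have B0 : 0 < fine (area2 (ball_R 0 (2 / 3) : set (R * R))).
  by have [_ h _] := ball_R_area t0; apply: lt_le_trans h; rewrite exprn_gt0.
have qB0 : 0 < qB by rewrite /qB divr_gt0// mulr_gt0.
pose A := 4 * X; have A0 : 0 < A by rewrite mulr_gt0.
have xrho : 0 < rho / r by rewrite divr_gt0.
have x1 : rho / r <= 1 by rewrite ler_pdivrMr// mul1r.
pose D := 4 / (rho / r) ^+ 2.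
have D1 : 1 <= D.
  rewrite /D ler_pdivlMr ?exprn_gt0// mul1r.
  have : (rho / r) ^+ 2 <= 1 by rewrite expr_le1// ltW.
  by move=> /le_trans; apply; rewrite ler1n.
(* By the square bounds, the ball of radius 2/3 has area at most 4 r^2 / (r s)^2 and D_rho has area
   at least rho^2; [areaE'] compares |Omega| with (r s)^2 |E|. *)
have qBq : qB <= D * q.
  rewrite /qB ler_pdivrMr//.
  have h1 : fine (area2 (ball_R 0 (2 / 3) : set (R * R))) <= 16 / 9 by apply: le_trans B2 _; lra.
  have -> : D * q * fine (area2 E) = kappa * (4 * r ^+ 2 * (fine (area (disc 0 rho)) / rho ^+ 2) * (fine (area2 E) / fine (area Om))).
    by rewrite /D /q; field; rewrite !gt_eqF.
  rewrite ler_pM2l// (le_trans h1)//.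
  have h2 : 1 <= fine (area (disc 0 rho)) / rho ^+ 2 by rewrite ler_pdivlMr ?exprn_gt0// mul1r.
  have h3 : 1 <= (r * s) ^+ 2 * (fine (area2 E) / fine (area Om)).
    by rewrite mulrA ler_pdivlMr// mul1r.
  have h4 : 16 / 9 * ((r * s) ^+ 2 * (fine (area2 E) / fine (area Om))) = 4 * r ^+ 2 * (fine (area2 E) / fine (area Om)).
    by rewrite /s; move: (fine _ / _) => u; field.
  have h5 : 0 <= 4 * r ^+ 2 * (fine (area2 E) / fine (area Om)).
    by apply: mulr_ge0; [rewrite mulr_ge0 ?sqr_ge0|rewrite divr_ge0 ?(ltW E0') ?(ltW Om0')].
  rewrite (@le_trans _ _ (4 * r ^+ 2 * (fine (area2 E) / fine (area Om))))//.
    by rewrite -h4 ler_peMr.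
  by rewrite [leRHS]mulrAC ler_peMr.
have lnq : ln qB <= (1 + ln D / ln kappa) * ln q.
  apply: (@le_trans _ _ (ln (D * q))).
    by rewrite ler_ln ?posrE// mulr_gt0// (lt_le_trans ltr01).
  rewrite lnM ?posrE ?(lt_le_trans ltr01 D1)// mulrDl mul1r addrC lerD2l.
  rewrite mulrAC ler_pdivlMr// ler_wpM2l ?ln_ge0// ler_ln ?posrE//.
set Q := q `^ _.
have Q0 : 0 <= Q by exact: powR_ge0.
have QB : qB `^ (c' * A) <= Q.
  rewrite /Q /powR !gt_eqF// ler_expR /A -/D.
  have -> : 4 * c' * (1 + ln D / ln kappa) * X * ln q = c' * (4 * X) * ((1 + ln D / ln kappa) * ln q).
    by move: (_ / _) => u; ring.
  by rewrite ler_pM2l// mulr_gt0.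
have ubO x : [set normc (F z) | z in Om] x -> x <= M.
  move=> [z /OmD dz <-]; apply: FM; apply: disc4 dz; lra.
set S := sup_mod F Om.
have FS z : Om z -> normc (F z) <= S by move=> Oz; apply: (le_sup_of ubO); exists z.
have [y0 Ey0] := area2_gt0_nonempty E0.
have S0 : 0 <= S by apply: le_trans (normc_ge0 _) (FS _ Ey0).
apply: ge_sup; first by exists m, 0 => //; apply/disc0P; rewrite normc0.
move=> _ [z /disc0P zrho <-].
(* The bound reached for each e is Q (S + e) + e. Taking e <= m / 4 keeps |Phi 0| above m / 2 and
   the approximant below 2 M. *)
apply: (@le_limit R _ _ (Q + 1) (m / 4)); [by rewrite divr_gt0|by rewrite addr_ge0|].
move=> e e0 em.
have [P HP] := polyanalytic_approx r0 pF e0.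
have PM w : normc w < 4 -> normc (bieval n P w w^*%C) <= 2 * M.
  move=> w4; have h := HP w (ltW w4).
  have h2 : normc (F (r%:C * w)) <= M.
    by apply/FM/disc0P; rewrite normcM normcR gtr0_norm// mulrC ltr_pM2r.
  rewrite normcB in h; apply: le_trans (normc_le_add h h2) _.
  by rewrite mulr_natl mulr2n lerD2l (le_trans em)// (le_trans _ mM)// ler_pdivrMr// ler_peMr ?ler1n// ltW.
pose Phi := bieval2 n P s.
pose K := 20 * n.+1%:R * (72 * n.+1%:R) ^+ n * (2 * M).
have PK w : ball_C 0 (6 / 5) w -> normc (Phi w) <= K.
  move=> bw; apply: bieval_bound PM _ _ _ _.
    by apply: bieval2_arg bw; exact: normc_i.
  by rewrite -mulNr; apply: bieval2_arg bw; rewrite normcN; exact: normc_i.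
have Phi0 : m / 2 <= normc (Phi 0).
  have := HP 0; rewrite normc0 => /(_ (ltW (ltr0n _ 4))); rewrite mulr0 => h.
  have -> : Phi 0 = bieval n P 0 0^*%C.
    rewrite (_ : 0^*%C = 0); last by rewrite conjc0.
    by rewrite /Phi /bieval2 /= !(mulr0, addr0, subr0).
  exact: half_le_of m0 em (normc_le_add h (lexx _)).
have Phi00 : 0 < normc (Phi 0) by apply: lt_le_trans Phi0; rewrite divr_gt0.
have KA : ln K - ln (normc (Phi 0)) <= A.
  have nn : 0 < 20 * n.+1%:R * (72 * n.+1%:R) ^+ n :> R.
    by rewrite !mulr_gt0 ?exprn_gt0 ?mulr_gt0 ?ltr0n.
  have K0 : 0 < K by rewrite /K mulr_gt0// mulr_gt0.
  have h1 : ln (m / 2) <= ln (normc (Phi 0)) by rewrite ler_ln ?posrE ?divr_gt0.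
  apply: (@le_trans _ _ (ln K - ln (m / 2))); first by rewrite lerD2l lerN2.
  rewrite -ln_div ?posrE ?divr_gt0//.
  (* 80 = 20 * 2 * 2: one 2 comes from the bound 2 M, the other from m / 2. *)
  have -> : K / (m / 2) = (80 * n.+1%:R * (72 * n.+1%:R) ^+ n) * (M / m).
    by rewrite /K; move: (n.+1%:R) ((_ * _) ^+ n) => u v; field; rewrite gt_eqF.
  have n80 : 0 < 80 * n.+1%:R * (72 * n.+1%:R) ^+ n :> R.
    by rewrite !mulr_gt0 ?exprn_gt0 ?mulr_gt0 ?ltr0n.
  rewrite lnM ?posrE ?n80 ?divr_gt0//.
  rewrite /A /X mulrDr [leLHS]addrC; apply: lerD; last exact: exponent_bound.
  by rewrite ler_peMl// ler1n.
have PS y : E y -> normc (Phi (of_real y)) <= S + e.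
  move=> Ey.
  rewrite /Phi bieval2_real; set w := s%:C * _.
  have w4 : normc w <= 4 by rewrite (le_trans (ltW (sy1 _ (EB _ Ey))))// ler1n.
  have h1 := HP w w4; rewrite normcB in h1; apply: (normc_le_add h1).
  by have := FS _ Ey; rewrite ptE.
pose y := (complex.Re z / (r * s), complex.Im z / (r * s)).
have zy : z = r%:C * (s%:C * (y.1 +i* y.2)).
  rewrite [LHS]complexRI; apply: complex_ext; rewrite ?(Re_add, Im_add, Re_mul, Im_mul) /=; field; by rewrite !gt_eqF.
have zr : normc z < r by exact: lt_le_trans zrho rhor.
have By : ball_R 0 (2 / 3) y.
  apply/(ball_RP y t0); move: zr; rewrite zy !normcM !normcR !gtr0_norm//.
  by rewrite gtr_pMr// => h; rewrite -(ltr_pM2l s0) s23.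
have := brudnyi_complex Hb (@bieval2_cont R n P s) (@bieval2_cdiff R n P s) PK erefl Phi00 A0 KA mE EB E0 qB0 PS By.
rewrite -/qB => H.
have H2 : normc (Phi (of_real y)) <= Q * (S + e).
  by apply: le_trans H _; rewrite ler_wpM2r// addr_ge0// ltW.
have h4 : normc (s%:C * (y.1 +i* y.2)) <= 4 by rewrite (le_trans (ltW (sy1 _ By)))// ler1n.
have := HP _ h4; rewrite -zy -bieval2_real -/Phi => h5.
by rewrite (le_trans (normc_le_add h5 H2))// mulrDr mulrDl mul1r addrA.
Qed.
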